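(* Let $p$ be a prime and $l\ge 1$ an integer. The function $$\Theta_l(X_0,\dots,X_{l-1})=\theta_l(X_0)\,\theta_{l-1}(X_1)\cdots\theta_1(X_{l-1}),$$ defined for $X_j\in D\bigl(0,p^{(p^{l-j-1}(p-1))^{-1}}\bigr)\subset\mathbb{C}_p$, $0\le j\le l-1$, is a splitting function of level $l$.
   Context: $\mathbb{C}_p$ is the completion of an algebraic closure of $\mathbb{Q}_p$, with valuation $v_p$ normalized by $v_p(p)=1$ and absolute value $|x|=p^{-v_p(x)}$; $D(0,r)$ is the open disk of center $0$ and radius $r$. For $x,y,z\in\mathbb{C}_p$, $x\equiv y\ [z]$ means $v_p(x-y)\ge v_p(z)$. $\Omega_l\subset\mathbb{C}_p$ is the extension of $\mathbb{Q}_p$ generated by a primitive $p^l$-th root of unity. Artin-Hasse series: $AH(X)=\sum_{i\ge 0}X^{p^i}/p^i\in\mathbb{Q}_p[[X]]$ (roots are taken in the open unit disk of $\mathbb{C}_p$). For each $k\ge1$ it has exactly $p^k-p^{k-1}$ roots of valuation $(p^k-p^{k-1})^{-1}$. Put $\pi_0=0$, and fix a compatible sequence $(\pi_l)_{l\ge 1}$: each $\pi_l$ is a root of $AH$ with $v_p(\pi_l)=(p^l-p^{l-1})^{-1}$, and $\pi_{l-1}\equiv \pi_l^p\ [p\pi_l]$ for all $l\ge1$. Let $E(X)=\exp(AH(X))\in 1+X\mathbb{Z}_p[[X]]$ and $\theta_l(X)=E(\pi_lX)$. Let $R=\mathbb{Z}_p/p^l\mathbb{Z}_p$ and, for $m\ge1$,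 $R_m=\mathcal{O}_m^{(u)}/p^l\mathcal{O}_m^{(u)}$, where $\mathcal{O}_m^{(u)}$ is the ring of integers of $\mathbb{Q}_p(\zeta_{p^m-1})\subset\mathbb{C}_p$. There are canonical isomorphisms $R\simeq W_l(\mathbb{F}_p)$, $R_m\simeq W_l(\mathbb{F}_{p^m})$ with rings of ($p$-typical) Witt vectors of length $l$. The Frobenius $F$ of $R_m/R$ corresponds to $(x_0,\dots,x_{l-1})\mapsto(x_0^p,\dots,x_{l-1}^p)$, and the trace from $R_m$ to $R$ is $\mathrm{Tr}(x)=x+Fx+\dots+F^{m-1}x$. For $x_0\in\mathbb{F}_{p^m}$, $\widetilde{x_0}$ denotes its Teichmüller representative, i.e. the unique $t\in\mathcal{O}_m^{(u)}$ with $t^{p^m}=t$ reducing to $x_0$ modulo $p$. For $x\in R_m$ corresponding to $(x_0,\dots,x_{l-1})\in W_l(\mathbb{F}_{p^m})$, put $\hat x=(\widetilde{x_0},\dots,\widetilde{x_{l-1}})\in\mathbb{C}_p^l$ and $F^i\hat x=(\widetilde{x_0}^{p^i},\dots,\widetilde{x_{l-1}}^{p^i})$ for $i\ge0$. Definition. A splitting function of level $l$ is a power series $\Theta$ in $l$ variables with coefficients in $\Omega_l$, converging on an open set of $\mathbb{C}_p^l$ of the form $D(0,r_1)\times\dots\times D(0,r_l)$ with $r_1,\dots,r_l>1$, such that: (i) the function $R\to\mathbb{C}_p$, $x\mapsto\Theta(\hat x)$, is an additive character $\psi_l$ of $R$ of order $p^l$, with values in $\Omega_l$; (ii) for each $m\ge1$,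 the additive character $\psi_{l,m}=\psi_l\circ\mathrm{Tr}$ of $R_m$ (with $\mathrm{Tr}:R_m\to R$) satisfies $\psi_{l,m}(x)=\prod_{i=0}^{m-1}\Theta(F^i\hat x)$ for all $x\in R_m$. *)

(* Defs.v *)
From HB Require Import structures.
From mathcomp Require Import all_boot all_order all_algebra.
From mathcomp Require Import finmap.
From mathcomp Require Import all_classical all_reals all_analysis.
From mathcomp.analysis.showcase Require Import summability.

Set Implicit Arguments.
Unset Strict Implicit.
Unset Printing Implicit Defensive.

Import Order.TTheory GRing.Theory Num.Theory.
Import numFieldNormedType.Exports.

Local Open Scope classical_set_scope.
Local Open Scope ring_scope.

(** * The field C_p *)

(** A field, complete for a non-archimedean absolute value such that
    |p| = 1/p; the uniform structure is the one of the absolute value. *)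
HB.mixin Record isPadicValued (R : realType) (p : nat) K
    of GRing.Field K & Uniform K := {
  abs : K -> R;
  abs_ge0 : forall x, 0 <= abs x;
  abs_eq0 : forall x, abs x = 0 <-> x = 0;
  absM : forall x y, abs (x * y) = abs x * abs y;
  abs_ultra : forall x y, abs (x + y) <= Num.max (abs x) (abs y);
  abs_p : abs p%:R = p%:R^-1;
  entourage_abs :
    @entourage K = entourage_ (fun x (e : R) => [set y : K | abs (x - y) < e]);
  abs_complete : forall F : set_system K,
    ProperFilter F -> cauchy F -> exists x : K, F --> x
}.

#[short(type="padicValuedType")]
HB.structure Definition PadicValued (R : realType) (p : nat) :=
  {K of isPadicValued R p K & GRing.Field K & Uniform K}.

Section Qp.
Context {R : realType} {p : nat} (K : padicValuedType R p).

(** As [K] is complete and restricts to the p-adic absolute value on the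
    rationals, the closure of the prime field is Q_p. *)
Definition Qp : set K := closure (range (@ratr K)).

Definition Qpbar : set K :=
  [set x | exists2 q : {poly K}, q != 0 & (forall i, Qp q`_i) /\ root q x].

End Qp.

Arguments Qp {R p} K.
Arguments Qpbar {R p} K.

(** [Qpbar K] is an algebraic closure of Q_p and [K] is its completion. This
    characterizes C_p up to isometric isomorphism. *)
HB.mixin Record isCp (R : realType) (p : nat) K of PadicValued R p K := {
  Qpbar_closed : forall q : {poly K}, (1 < size q)%N ->
    (forall i, Qpbar K q`_i) -> exists2 x, Qpbar K x & root q x;
  Qpbar_dense : dense (Qpbar K)
}.

#[short(type="cpType")]
HB.structure Definition Cp (R : realType) (p : nat) :=
  {K of isCp R p K & PadicValued R p K}.

Section Valuation.
Context {R : realType} {p : nat} {K : cpType R p}.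
Implicit Types x y z : K.

Definition vp x : \bar R :=
  if x == 0 then +oo%E else (- (ln (abs x) / ln p%:R))%:E.

Definition congv x y z : Prop := (vp z <= vp (x - y)%R)%E.

Lemma abs_vp x : prime p -> x != 0 -> abs x = p%:R `^ (- fine (vp x)).
Proof.
move=> pp x0; rewrite /vp (negbTE x0) /= opprK.
have p1 : 1 < p%:R :> R by rewrite ltr1n prime_gt1.
have lp : ln (p%:R : R) != 0 by rewrite gt_eqF // ln_gt0.
rewrite /powR gt_eqF ?(lt_trans ltr01) // divfK // lnK // posrE lt_neqAle.
by rewrite abs_ge0 andbT eq_sym; apply/eqP => /abs_eq0/eqP; rewrite (negbTE x0).
Qed.

Lemma vp_p : prime p -> vp (p%:R : K) = 1%:E.
Proof.
move=> pp; have p1 : 1 < p%:R :> R by rewrite ltr1n prime_gt1.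
have p0 : 0 < p%:R :> R by apply: lt_trans p1.
have lp : ln (p%:R : R) != 0 by rewrite gt_eqF // ln_gt0.
rewrite /vp ifN; last first.
  apply/eqP => /(@abs_eq0 R p K); rewrite abs_p => /eqP.
  by rewrite invr_eq0 gt_eqF.
by rewrite abs_p lnV ?posrE // mulNr opprK divff.
Qed.

End Valuation.

Notation "x == y %[ 'vmod' z ]" := (congv x y z)
  (at level 70, y at next level, format "x  ==  y  %[ 'vmod'  z ]").

Section Subfields.
Context {R : realType} {p : nat} (K : cpType R p).

Definition subfield (L : set K) : Prop := divring_closed [in L].

(** The subfield Q_p(S). *)
Definition adjoin_Qp (S : set K) : set K := smallest subfield (Qp K `|` S).

Definition Omega (l : nat) : set K :=
  adjoin_Qp [set z | (p ^ l).-primitive_root z].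

Definition integers (L : set K) : set K := [set x | L x /\ abs x <= 1].

Definition padic_int : set K := integers (Qp K).

(** The ring of integers of Q_p(zeta_(p^m-1)). *)
Definition Ou (m : nat) : set K :=
  integers (adjoin_Qp [set z | (p ^ m - 1).-primitive_root z]).

End Subfields.

Arguments adjoin_Qp {R p K} S.
Arguments Omega {R p} K l.
Arguments padic_int {R p} K.
Arguments Ou {R p} K m.

(** * Witt vectors *)

(** The quotient rings O/p^l O and O/pO of a ring of integers [O] are handled
    through representatives in [O]: for x, y in [O], the classes of x and y
    modulo p^l are equal iff [x == y %[vmod p ^+ l]]. *)
Section Witt.
Context {R : realType} {p : nat} {K : cpType R p} {l : nat}.
Implicit Types (O : set K) (a b c : 'I_l -> K) (x y : K).

Definition ghost (n : 'I_l) a : K :=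
  \sum_(i < l | (i <= n)%N) p%:R ^+ i * a i ^+ (p ^ (n - i)).

(** The vector of classes modulo p of c is obtained from those of a and b by
    the operation of the ring of Witt vectors of length l lifting op, which is
    the addition or the multiplication. The operation is defined by universal
    polynomials S_0, ..., S_(l-1) with integer coefficients; as p is
    invertible in K, the values s_i = S_i(a, b) are determined by the ghost
    components of s. *)
Definition witt_op (op : K -> K -> K) a b c : Prop :=
  exists2 s : 'I_l -> K,
    forall n, ghost n s = op (ghost n a) (ghost n b) &
    forall i, c i == s i %[vmod p%:R].

(** [phi] induces the canonical isomorphism from O/p^l O onto the ring of Witt
    vectors of length l over O/pO, that is, the ring isomorphism inducing the
    identity on the residue ring O/pO. *)
Record canonical_iso O (phi : K -> 'I_l -> K) : Prop := {
  iso_int : forall x, O x -> forall i, O (phi x i);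
  iso_inj : forall x y, O x -> O y ->
    x == y %[vmod p%:R ^+ l] <->
    (forall i, phi x i == phi y i %[vmod p%:R]);
  iso_surj : forall a, (forall i, O (a i)) ->
    exists2 x, O x & forall i, phi x i == a i %[vmod p%:R];
  iso_one : forall i : 'I_l,
    phi 1 i == (val i == 0%N)%:R %[vmod p%:R];
  iso_add : forall x y, O x -> O y ->
    witt_op +%R (phi x) (phi y) (phi (x + y));
  iso_mul : forall x y, O x -> O y ->
    witt_op *%R (phi x) (phi y) (phi (x * y));
  iso_residue : forall x, O x -> forall i : 'I_l, val i = 0%N ->
    phi x i == x %[vmod p%:R]
}.

(** The Teichmueller representative of the class of x modulo p. *)
Definition teich (m : nat) O x : K :=
  xget 0 [set t | [/\ O t, t ^+ (p ^ m) = t & t == x %[vmod p%:R]]].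

Definition hat (m : nat) O (phi : K -> 'I_l -> K) x : 'I_l -> K :=
  fun j => teich m O (phi x j).

(** A representative of the class of F x modulo p^l. *)
Definition frob O (phi : K -> 'I_l -> K) x : K :=
  xget 0 [set y | O y /\ forall i, phi y i == phi x i ^+ p %[vmod p%:R]].

(** A representative in Z_p of the trace x + F x + ... + F^(m-1) x. *)
Definition trace (m : nat) O (phi : K -> 'I_l -> K) x : K :=
  xget 0 [set y | padic_int K y /\
    y == \sum_(i < m) iter i (frob O phi) x %[vmod p%:R ^+ l]].

End Witt.

(** * Power series *)

Section OneVariable.
Context {R : realType} {p : nat} {K : cpType R p}.
Implicit Types (f g : nat -> K) (x s : K).

(** [f n] is the coefficient of X^n. *)
Definition fps_sums f x s : Prop :=
  series (fun n => f n * x ^+ n) @ \oo --> s.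

Definition fps_mul f g : nat -> K :=
  fun n => \sum_(i < n.+1) f i * g (n - i)%N.

Definition fps_exprn f k : nat -> K :=
  iter k (fps_mul f) (fun n => (n == 0%N)%:R).

(** exp(f) for f without constant term: f^k / k! contributes to the
    coefficient of X^n only if k <= n. *)
Definition fps_exp f : nat -> K :=
  fun n => \sum_(k < n.+1) fps_exprn f k n / k`!%:R.

Definition AH : nat -> K :=
  fun n => \sum_(i < n.+1 | (p ^ i == n)%N) (p ^ i)%:R^-1.

Definition E : nat -> K := fps_exp AH.

Definition theta (pi : nat -> K) (k : nat) : nat -> K :=
  fun n => E n * pi k ^+ n.

Record compatible_roots (pi : nat -> K) : Prop := {
  root_0 : pi 0%N = 0;
  root_disk : forall k, (1 <= k)%N -> abs (pi k) < 1;
  root_AH : forall k, (1 <= k)%N -> fps_sums AH (pi k) 0;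
  root_vp : forall k, (1 <= k)%N ->
    vp (pi k) = ((p ^ k - p ^ k.-1)%:R^-1)%:E;
  root_compat : forall k, (1 <= k)%N ->
    pi k.-1 == pi k ^+ p %[vmod p%:R * pi k]
}.

End OneVariable.

Section SeveralVariables.
Context {R : realType} {p : nat} {K : cpType R p} {l : nat}.

(** Power series in X_0, ..., X_(l-1), given by their coefficients. *)
Definition mfps := {ffun 'I_l -> nat} -> K.

Implicit Types (c : mfps) (r : 'I_l -> R).

Definition mfps_sums c (x : 'I_l -> K) (s : K) : Prop :=
  partial_sum (fun a => c a * \prod_(j < l) x j ^+ a j) @ totally --> s.

Definition mfps_eval c (x : 'I_l -> K) : K := xget 0 [set s | mfps_sums c x s].

Definition polydisk r : set ('I_l -> K) :=
  [set x | forall j, abs (x j) < r j].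

Definition mfps_cvg_on c (U : set ('I_l -> K)) : Prop :=
  forall x, U x -> exists s, mfps_sums c x s.

(** An additive character of Z_p/p^l Z_p. *)
Record additive_character (psi : K -> K) : Prop := {
  char_wd : forall x y, padic_int K x -> padic_int K y ->
    x == y %[vmod p%:R ^+ l] -> psi x = psi y;
  char_0 : psi 0 = 1;
  char_add : forall x y, padic_int K x -> padic_int K y -> psi (x + y) = psi x * psi y
}.

Definition has_order (psi : K -> K) (N : nat) : Prop :=
  forall n : nat, (forall x, padic_int K x -> psi x ^+ n = 1) <-> (N %| n)%N.

(** [phiR] and [phi m] are the canonical isomorphisms of R and of R_m. *)
Definition splitting_function (phiR : K -> 'I_l -> K)
    (phi : nat -> K -> 'I_l -> K) (c : mfps) : Prop :=
  let psi := fun x => mfps_eval c (hat 1 (padic_int K) phiR x) in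
  [/\ forall a, Omega K l (c a),
      exists2 r : 'I_l -> R, (forall j, 1 < r j) &
        mfps_cvg_on c (polydisk r),
      [/\ additive_character psi, has_order psi (p ^ l) &
          forall x, padic_int K x -> Omega K l (psi x)] &
      forall m, (1 <= m)%N -> forall x, Ou K m x ->
        psi (trace m (Ou K m) (phi m) x) =
        \prod_(i < m) mfps_eval c
          (fun j => hat m (Ou K m) (phi m) x j ^+ (p ^ i))].

(** theta_l(X_0) theta_(l-1)(X_1) ... theta_1(X_(l-1)) *)
Definition Theta (pi : nat -> K) : mfps :=
  fun a => \prod_(j < l) theta pi (l - j) (a j).

Definition Theta_radius (j : 'I_l) : R :=
  p%:R `^ ((p ^ (l - j - 1) * (p - 1))%:R^-1).

End SeveralVariables.

Arguments mfps {R p} K l.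

(* Main.v *)
Require Import Defs.
From HB Require Import structures.
From mathcomp Require Import all_boot all_order all_algebra finfield.
From mathcomp Require Import finmap ring.
From mathcomp Require Import all_classical all_reals all_analysis.
From mathcomp.analysis.showcase Require Import summability.

Set Implicit Arguments.
Unset Strict Implicit.
Unset Printing Implicit Defensive.

Import Order.TTheory GRing.Theory Num.Theory.
Import numFieldNormedType.Exports.

Local Open Scope classical_set_scope.
Local Open Scope ring_scope.

(** Write |.| for the absolute value, and zeta_k = E(pi_k). Formally
    E = exp(AH), and AH(pi_k) = 0, so zeta_k would be exp(0) = 1; the series
    exp does not converge far enough for this, but the computation is valid for
    E^(p^N) = exp(p^N AH) with N large, so zeta_k is a root of unity of p-power
    order ([E_root_unity]). As E(X) = 1 + X + ... has coefficients in Z_p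
    (Dwork's congruence, [E_padic_int]), |zeta_k - 1| = |pi_k|, which forces the
    order to be p^k ([root_unity_primitive]); the same rigidity turns the
    congruence between pi_(k-1) and pi_k^p into zeta_k^p = zeta_(k-1)
    ([zeta_compat]).

    Let t^(p^m) = t. As formal series, the product of the E(t^(p^i) X), for
    i < m, is exp(Tr(t) AH(X)) with Tr(t) the sum of the t^(p^i), because the
    coefficients of AH live in the degrees p^j and Tr(t^(p^j)) = Tr(t). The
    number Tr(t) is in Z_p, and z |-> exp(z AH)(pi_k) is continuous on Z_p and
    equal to zeta_k^z on the natural numbers; so the product of the
    E(pi_k t^(p^i)) is zeta_k^Tr(t) ([E_teich_prod]).

    On the other side, let x have Witt components with Teichmueller
    representatives t_j. The ghost components of the Witt vector of x are ring
    morphisms modulo powers of p, and this gives that x is congruent to the sum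
    of the p^j t_j^(p^(-j)) modulo p^l ([teich_sum_congr]). Hence the trace of x
    is the sum of the p^j Tr(t_j) ([trace_spec]), and
    zeta_l^Tr(x) is the product of the zeta_(l-j)^Tr(t_j), which is the product
    of the values of Theta on the orbit ([Theta_orbit_prod]). For m = 1 this says
    that x |-> Theta(x) is the character x |-> zeta_l^x, and for general m it is
    the trace formula.

    This uses that the residue ring of the ring of integers of
    Q_p(zeta_(p^m-1)) is generated by Teichmueller representatives
    ([Ou_unramified]), which comes from the Frobenius congruence
    f(t)^p = f(t^p) mod p for f in Z[X]; the same congruence shows that Tr(t)
    is in Z_p ([frob_fixed_near_int]). Finally pi_k lies in Q_p(zeta_k): the
    equation E(x) = zeta_k is solved by successive approximations in Z_p[zeta_k],
    which is complete because the powers of zeta_k - 1 of exponents less than the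
    degree have absolute values that differ by more than powers of |p|
    ([pi_span]). *)

(** * The ultrametric absolute value *)

Section AbsoluteValue.
Variables (R : realType) (p : nat) (K : cpType R p).
Hypothesis p_prime : prime p.
Implicit Types (x y z s t : K) (e : R) (u v : nat -> K).

Lemma abs0 : abs (0 : K) = 0.
Proof. exact/abs_eq0. Qed.

Lemma abs_neq0 x : (abs x == 0) = (x == 0).
Proof. by apply/eqP/eqP => /abs_eq0. Qed.

Lemma abs_gt0 x : (0 < abs x) = (x != 0).
Proof. by rewrite lt_neqAle abs_ge0 andbT eq_sym abs_neq0. Qed.

Lemma abs1 : abs (1 : K) = 1.
Proof.
have a0 : abs (1 : K) != 0 by rewrite abs_neq0 oner_eq0.
by apply: (mulfI a0); rewrite -absM !mulr1.
Qed.

Lemma absX x n : abs (x ^+ n) = abs x ^+ n.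
Proof. by elim: n => [|n IH]; rewrite ?expr0 ?abs1 // !exprS absM IH. Qed.

Lemma absN x : abs (- x) = abs x.
Proof.
rewrite -mulN1r absM [X in X * _](_ : _ = 1) ?mul1r //; apply/eqP.
by rewrite -(@pexpr_eq1 _ _ 2) ?abs_ge0 // -absX sqrrN expr1n abs1.
Qed.

Lemma abs_subC x y : abs (x - y) = abs (y - x).
Proof. by rewrite -absN opprB. Qed.

Lemma absV x : abs x^-1 = (abs x)^-1.
Proof.
have [->|x0] := eqVneq x 0; first by rewrite invr0 abs0 invr0.
have a0 : abs x != 0 by rewrite abs_neq0.
by apply: (mulfI a0); rewrite -absM !divff // abs1.
Qed.

Lemma abs_prod (I : Type) (r : seq I) (P : pred I) (F : I -> K) :
  abs (\prod_(i <- r | P i) F i) = \prod_(i <- r | P i) abs (F i).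
Proof. by apply: (big_morph _ _ abs1) => x y; rewrite absM. Qed.

Lemma absD_le x y e : abs x <= e -> abs y <= e -> abs (x + y) <= e.
Proof. by move=> xe ye; rewrite (le_trans (abs_ultra _ _)) // ge_max xe. Qed.

Lemma absB_le x y e : abs x <= e -> abs y <= e -> abs (x - y) <= e.
Proof. by move=> xe ye; rewrite absD_le ?absN. Qed.

Lemma absD_lt x y e : abs x < e -> abs y < e -> abs (x + y) < e.
Proof. by move=> xe ye; rewrite (le_lt_trans (abs_ultra _ _)) // gt_max xe. Qed.

Lemma absB_lt x y e : abs x < e -> abs y < e -> abs (x - y) < e.
Proof. by move=> xe ye; rewrite absD_lt ?absN. Qed.

Lemma abs_sub_le y x z e : abs (x - y) <= e -> abs (y - z) <= e -> abs (x - z) <= e.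
Proof. by move=> xe ye; rewrite -(subrK y x) -addrA absD_le. Qed.

Lemma abs_sub_lt y x z e : abs (x - y) < e -> abs (y - z) < e -> abs (x - z) < e.
Proof. by move=> xe ye; rewrite -(subrK y x) -addrA absD_lt. Qed.

Lemma abs_sum_le (I : Type) (r : seq I) (P : pred I) (F : I -> K) e :
  0 <= e -> (forall i, P i -> abs (F i) <= e) ->
  abs (\sum_(i <- r | P i) F i) <= e.
Proof.
move=> e0 Fe; elim/big_rec: _ => [|i x Pi xe]; first by rewrite abs0.
by rewrite absD_le ?Fe.
Qed.

Lemma abs_dominant x y : abs y < abs x -> abs (x + y) = abs x.
Proof.
move=> yx; apply/le_anti/andP; split; first by rewrite absD_le // ltW.
rewrite leNgt; apply/negP => h.
by move: (absB_lt h yx); rewrite addrK ltxx.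
Qed.

Lemma abs_close_eq x y e : abs (x - y) < e -> e <= abs x -> abs y = abs x.
Proof.
move=> h ex; rewrite -{1}(subKr x y) abs_dominant // absN.
exact: lt_le_trans h ex.
Qed.

Lemma abs_nat_le1 n : abs (n%:R : K) <= 1.
Proof.
by elim: n => [|n IH]; rewrite ?abs0 ?ler01 // -natr1 absD_le ?abs1.
Qed.

Lemma abs_int_le1 n : abs (n%:~R : K) <= 1.
Proof.
by case: n => n; rewrite ?NegzE ?mulrNz ?absN -?pmulrn abs_nat_le1.
Qed.

Lemma absM_le1 x y e : abs x <= 1 -> abs y <= e -> abs (x * y) <= e.
Proof.
move=> x1 ye; rewrite absM (le_trans _ ye) //.
by rewrite -[leRHS]mul1r ler_wpM2r ?abs_ge0.
Qed.

Lemma absX_le1 x n : abs x <= 1 -> abs (x ^+ n) <= 1.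
Proof. by move=> x1; rewrite absX exprn_ile1 ?abs_ge0. Qed.

Notation ip := (p%:R^-1 : R).

Lemma ip_gt0 : 0 < ip.
Proof. by rewrite invr_gt0 ltr0n prime_gt0. Qed.

Lemma ip_lt1 : ip < 1.
Proof. by rewrite invf_lt1 ?ltr0n ?prime_gt0 // ltr1n prime_gt1. Qed.

Lemma ip_ge0 : 0 <= ip. Proof. exact/ltW/ip_gt0. Qed.
Lemma ip_le1 : ip <= 1. Proof. exact/ltW/ip_lt1. Qed.

Lemma ipX_gt0 n : 0 < ip ^+ n. Proof. exact/exprn_gt0/ip_gt0. Qed.
Lemma ipX_ge0 n : 0 <= ip ^+ n. Proof. exact/ltW/ipX_gt0. Qed.

Lemma ipX_le m n : (m <= n)%N -> ip ^+ n <= ip ^+ m.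
Proof. exact: ler_wiXn2l ip_ge0 ip_le1 _ _. Qed.

Lemma abs_pX n : abs (p%:R ^+ n : K) = ip ^+ n.
Proof. by rewrite absX abs_p. Qed.

Lemma pK_neq0 : (p%:R : K) != 0.
Proof. by rewrite -abs_gt0 abs_p ip_gt0. Qed.

Lemma expr_small (r e : R) : 0 <= r -> r < 1 -> 0 < e ->
  exists N, forall n, (N <= n)%N -> r ^+ n < e.
Proof.
move=> r0 r1 e0; have /cvgr0Pnorm_lt/(_ _ e0)[N _ hN] : r ^+ n @[n --> \oo] --> 0.
  by apply: cvg_expr; rewrite ger0_norm.
by exists N => n /hN; rewrite ger0_norm ?exprn_ge0.
Qed.

Lemma ipX_small e : 0 < e -> exists N, forall n, (N <= n)%N -> ip ^+ n < e.
Proof. exact: expr_small ip_ge0 ip_lt1. Qed.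

(** With z = 0 both sides mean x = y, as vp 0 is infinite. *)
Lemma congvP x y z : congv x y z <-> abs (x - y) <= abs z.
Proof.
have p1 : 1 < p%:R :> R by rewrite ltr1n prime_gt1.
have lp : 0 < ln (p%:R : R) by rewrite ln_gt0.
rewrite /congv /vp; case: (eqVneq z 0) => [->|z0].
  rewrite leye_eq abs0; case: (eqVneq (x - y) 0) => [->|xy]; first by rewrite abs0.
  by split=> //; rewrite le_eqVlt abs_neq0 (negbTE xy) ltNge abs_ge0.
case: (eqVneq (x - y) 0) => [->|xy]; first by rewrite leey abs0 abs_ge0.
by rewrite lee_fin lerN2 ler_pM2r ?invr_gt0 // ler_ln ?posrE ?abs_gt0.
Qed.

Lemma congv_pX x y n : congv x y (p%:R ^+ n) <-> abs (x - y) <= ip ^+ n.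
Proof. by rewrite congvP abs_pX. Qed.

Lemma congv_p x y : congv x y p%:R <-> abs (x - y) <= ip.
Proof. by rewrite congvP abs_p. Qed.

(** A Bezout relation u n = 1 mod p excludes |n| < 1. *)
Lemma abs_nat_coprime n : coprime p n -> abs (n%:R : K) = 1.
Proof.
move=> cop; apply/le_anti; rewrite abs_nat_le1 /= leNgt; apply/negP => n1.
case: (egcdnP n (prime_gt0 p_prime)) => u v /= Huv _.
have : abs ((u * p)%:R - (v * n)%:R : K) < 1.
  by apply: absB_lt; rewrite natrM; apply: le_lt_trans (absM_le1 _ (lexx _)) _;
    rewrite ?abs_nat_le1 ?abs_p ?ip_lt1.
by rewrite Huv (eqP cop) natrD addrAC subrr add0r abs1 ltxx.
Qed.

Lemma abs_nat n : (0 < n)%N -> abs (n%:R : K) = ip ^+ logn p n.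
Proof.
move=> n0; have [n' cop {1}->] := pfactor_coprime p_prime n0.
by rewrite natrM absM abs_nat_coprime // mul1r natrX abs_pX.
Qed.

Lemma natK_neq0 n : (0 < n)%N -> (n%:R : K) != 0.
Proof. by move=> n0; rewrite -abs_gt0 abs_nat // ipX_gt0. Qed.

Lemma abs_eq0_small x : (forall k, abs x <= ip ^+ k) -> x = 0.
Proof.
move=> h; apply/eqP; rewrite -abs_neq0; apply/eqP/le_anti.
rewrite abs_ge0 andbT leNgt; apply/negP => /ipX_small[N /(_ N (leqnn N))].
by rewrite ltNge h.
Qed.

(** * Convergence *)

(** Convergence in terms of the absolute value; [tendsP] relates it to the
    uniform structure. *)
Definition tends (u : nat -> K) s :=
  forall e, 0 < e -> exists N, forall n, (N <= n)%N -> abs (u n - s) < e.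

Lemma nbhs_absP x (U : set K) :
  nbhs x U <-> exists2 e, 0 < e & forall y, abs (x - y) < e -> U y.
Proof.
rewrite (nbhsP x U) entourage_abs; split.
  case=> V [e e0 eV] VU; exists e => // y xy; apply: VU.
  by rewrite /xsection /= inE; apply: eV.
case=> e e0 eU; exists [set xy | abs (xy.1 - xy.2) < e]; first by exists e.
by move=> y; rewrite /xsection /= inE => /eU.
Qed.

Lemma cvg_absP (T : Type) (F : set_system T) (f : T -> K) s : Filter F ->
  f @ F --> s <-> forall e, 0 < e -> F [set x | abs (f x - s) < e].
Proof.
move=> FF; split.
  move=> cv e e0; have := cv [set y | abs (s - y) < e].
  move=> H; have : F (f @^-1` [set y | abs (s - y) < e]).
    by apply: H; apply/nbhs_absP; exists e.
  by apply: filterS => x /=; rewrite abs_subC.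
move=> h U /nbhs_absP[e e0 eU]; change (F (f @^-1` U)).
by apply: filterS (h _ e0) => x /= xe; apply: eU; rewrite abs_subC.
Qed.

Lemma tendsP (u : nat -> K) s : u @ \oo --> s <-> tends u s.
Proof.
rewrite cvg_absP; split=> h e e0.
  by have [N _ hN] := h _ e0; exists N => n /hN.
by have [N hN] := h _ e0; exists N => // n /hN.
Qed.

Lemma cvg_abs_unique (T : Type) (F : set_system T) (f : T -> K) s t :
  ProperFilter F -> f @ F --> s -> f @ F --> t -> s = t.
Proof.
move=> FF fs ft; apply/eqP; rewrite -subr_eq0; apply: contraT => st.
have e0 : 0 < abs (s - t) by rewrite abs_gt0.
have h1 := (cvg_absP _ _ _).1 fs _ e0; have h2 := (cvg_absP _ _ _).1 ft _ e0.
have [x [/= x1 x2]] := filter_ex (filterI (h1 _) (h2 _)).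
rewrite abs_subC in x1.
by have := abs_sub_lt x1 x2; rewrite ltxx.
Qed.

Lemma tends_unique u s t : tends u s -> tends u t -> s = t.
Proof. by move=> /tendsP us /tendsP ut; apply: cvg_abs_unique us ut. Qed.

(** In an ultrametric field it is enough that consecutive terms get close. *)
Lemma cauchy_tends (u : nat -> K) :
  (forall e, 0 < e -> exists N, forall n, (N <= n)%N -> abs (u n.+1 - u n) < e) ->
  exists s, tends u s.
Proof.
move=> h.
have h' e : 0 < e -> exists N, forall n, (N <= n)%N -> abs (u N - u n) < e.
  move=> e0; have [N hN] := h _ e0; exists N => n Nn.
  rewrite -(subnKC Nn); elim: (n - N)%N => [|d IH].
    by rewrite addn0 subrr abs0.
  rewrite addnS; apply: abs_sub_lt IH _; rewrite abs_subC hN //.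
  exact: leq_addr.
have [s us] : exists s, u @ \oo --> s.
  apply: abs_complete => V; rewrite entourage_abs => -[e e0 eV].
  have [N hN] := h' _ e0; exists ([set u n | n in [set n | (N <= n)%N]],
    [set u n | n in [set n | (N <= n)%N]]).
    by split; exists N => //= n Nn; exists n.
  move=> [_ _] [/= [n /= /hN n1 <-] [k /= /hN n2 <-]]; apply: eV => /=.
  by apply: abs_sub_lt n2; rewrite abs_subC.
by exists s; apply/tendsP.
Qed.

Lemma tends_abs_le u s c :
  (exists N, forall n, (N <= n)%N -> abs (u n) <= c) -> tends u s -> abs s <= c.
Proof.
move=> [M hM] us; rewrite leNgt; apply/negP => cs.
have s0 : 0 < abs s.
  by apply: le_lt_trans cs; apply: le_trans (hM M (leqnn _)); apply: abs_ge0.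
have [N /(_ (maxn M N) (leq_maxr _ _))] := us _ s0.
rewrite abs_subC => /abs_close_eq/(_ (lexx _)) E.
by move: cs; rewrite -E ltNge hM ?leq_maxl.
Qed.

Lemma tends_eq u v s : (forall n, u n = v n) -> tends u s -> tends v s.
Proof. by move=> /funext ->. Qed.

Lemma tends_cst s : tends (fun=> s) s.
Proof. by move=> e e0; exists 0%N => n _; rewrite subrr abs0. Qed.

Lemma tendsD u v s t : tends u s -> tends v t -> tends (fun n => u n + v n) (s + t).
Proof.
move=> us vt e e0; have [N hN] := us _ e0; have [M hM] := vt _ e0.
exists (maxn N M) => n; rewrite geq_max => /andP[/hN h1 /hM h2].
by rewrite opprD addrACA absD_lt.
Qed.

Lemma tendsN u s : tends u s -> tends (fun n => - u n) (- s).
Proof.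
move=> us e e0; have [N hN] := us _ e0; exists N => n /hN.
by rewrite -opprD absN.
Qed.

Lemma tendsB u v s t : tends u s -> tends v t -> tends (fun n => u n - v n) (s - t).
Proof. by move=> us /tendsN; apply: tendsD. Qed.

Lemma tends_bounded u s : tends u s ->
  exists2 c, 0 < c & exists N, forall n, (N <= n)%N -> abs (u n) <= c.
Proof.
move=> us; have [N hN] := us _ ltr01; exists (Num.max 1 (abs s)).
  by rewrite lt_max ltr01.
exists N => n /hN h; rewrite -(subrK s (u n)) absD_le // ?le_max ?lexx ?orbT //.
by rewrite (ltW h).
Qed.

Lemma tendsM u v s t : tends u s -> tends v t -> tends (fun n => u n * v n) (s * t).
Proof.
move=> us vt e e0; have [c c0 [N1 h1]] := tends_bounded us.
pose d := Num.max c (Num.max 1 (abs t)).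
have d0 : 0 < d by rewrite lt_max c0.
have td : abs t <= d by rewrite !le_max lexx !orbT.
have cd : c <= d by rewrite le_max lexx.
have ed : 0 < e / d by rewrite divr_gt0.
have [N2 h2] := us _ ed; have [N3 h3] := vt _ ed.
exists (maxn N1 (maxn N2 N3)) => n; rewrite !geq_max => /and3P[/h1 n1 /h2 n2 /h3 n3].
have -> : u n * v n - s * t = u n * (v n - t) + (u n - s) * t.
  by rewrite mulrBr mulrBl addrA subrK.
apply: absD_lt; rewrite absM.
  have un : abs (u n) <= d by apply: le_trans n1 cd.
  by apply: le_lt_trans (ler_wpM2r (abs_ge0 _) un) _; rewrite mulrC -ltr_pdivlMr.
apply: le_lt_trans (ler_wpM2l (abs_ge0 _) td) _; by rewrite -ltr_pdivlMr.
Qed.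

Lemma tendsX u s n : tends u s -> tends (fun k => u k ^+ n) (s ^+ n).
Proof.
move=> us; elim: n => [|n IH]; first exact: tends_cst.
by rewrite exprS; under [X in tends X]eq_fun do rewrite exprS; apply: tendsM.
Qed.

Lemma tends_sum (I : Type) (r : seq I) (F : I -> nat -> K) (S : I -> K) :
  (forall i, tends (F i) (S i)) ->
  tends (fun n => \sum_(i <- r) F i n) (\sum_(i <- r) S i).
Proof.
move=> h; elim: r => [|i r IH].
  by rewrite big_nil; apply: tends_eq (tends_cst 0) => n; rewrite big_nil.
rewrite big_cons; apply: tends_eq (tendsD (h i) IH) => n.
by rewrite big_cons.
Qed.

Lemma tends_shift u s k : tends u s -> tends (fun n => u (n + k)%N) s.
Proof.
move=> us e e0; have [N hN] := us _ e0; exists N => n Nn; apply: hN.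
exact: leq_trans Nn (leq_addr _ _).
Qed.

Lemma closure_absP (S : set K) x :
  closure S x <-> forall e, 0 < e -> exists2 y, S y & abs (x - y) < e.
Proof.
split=> [h e e0 | h U /nbhs_absP[e e0 eU]].
  have [|y [Sy xy]] := h [set y | abs (x - y) < e]; last by exists y.
  by apply/nbhs_absP; exists e.
by have [y Sy /eU Uy] := h _ e0; exists y.
Qed.

Lemma abs_exp_sub_le (x y : K) n e : abs x <= 1 -> abs y <= 1 ->
  abs (x - y) <= e -> abs (x ^+ n - y ^+ n) <= e.
Proof.
move=> x1 y1 xy; have e0 : 0 <= e by apply: le_trans xy; apply: abs_ge0.
rewrite subrXX mulrC; apply: absM_le1 => //.
by apply: abs_sum_le => [|i _]; rewrite ?ler01 // absM_le1 ?absX_le1.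
Qed.

(** In x^p - y^p = (x - y) (x^(p-1) + ... + y^(p-1)), the second factor is
    congruent to p y^(p-1) modulo x - y, hence divisible by p. *)
Lemma abs_expp_sub_le (x y : K) k : abs x <= 1 -> abs y <= 1 ->
  abs (x - y) <= ip ^+ k.+1 -> abs (x ^+ p - y ^+ p) <= ip ^+ k.+2.
Proof.
move=> x1 y1 xy; rewrite subrXX absM exprSr ler_pM ?abs_ge0 //.
have -> : \sum_(i < p) x ^+ (p.-1 - i) * y ^+ i =
    \sum_(i < p) (x ^+ (p.-1 - i) - y ^+ (p.-1 - i)) * y ^+ i + p%:R * y ^+ p.-1.
  rewrite mulr_natl -[X in _ *+ X]card_ord -sumr_const -big_split /=.
  apply: eq_bigr => i _; rewrite mulrBl -exprD subnK ?subrK //.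
  by rewrite -ltnS prednK ?prime_gt0.
have xy1 : abs (x - y) <= ip by apply: le_trans xy (ipX_le (_ : 1 <= _)%N).
apply: absD_le; last by rewrite mulrC absM_le1 ?absX_le1 ?abs_p.
apply: abs_sum_le => [|i _]; first exact: ip_ge0.
by rewrite mulrC absM_le1 ?absX_le1 ?abs_exp_sub_le.
Qed.

Lemma abs_exppX_sub_le (x y : K) k n : abs x <= 1 -> abs y <= 1 ->
  abs (x - y) <= ip ^+ k.+1 ->
  abs (x ^+ (p ^ n) - y ^+ (p ^ n)) <= ip ^+ (k + n).+1.
Proof.
move=> x1 y1 xy; elim: n => [|n IH]; first by rewrite addn0 !expr1.
by rewrite expnSr !exprM addnS abs_expp_sub_le ?absX_le1.
Qed.

End AbsoluteValue.

(** * Integer polynomials modulo p *)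

Section IntegerPolynomials.
Variables (p : nat).
Hypothesis p_prime : prime p.

Lemma Fp_expX (c : 'F_p) k : c ^+ (p ^ k) = c.
Proof.
elim: k => [|k IH]; first by rewrite expr1.
by rewrite expnSr exprM IH; have := expf_card c; rewrite card_Fp.
Qed.

Lemma Fp_poly_expX (f : {poly 'F_p}) k : f ^+ (p ^ k) = f \Po 'X^(p ^ k).
Proof.
have chp : p \in [pchar {poly 'F_p}] by rewrite pchar_poly pchar_Fp.
elim/poly_ind: f => [|f c IH].
  by rewrite comp_poly0 expr0n eqn0Ngt expn_gt0 prime_gt0.
rewrite comp_polyD comp_polyM comp_polyX comp_polyC -IH exprDn_pchar; last first.
  by rewrite pnatX (eq_pnat _ (pcharf_eq chp)) pnat_id.
by rewrite exprMn -polyC_exp Fp_expX.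
Qed.

Lemma Fp_intr_eq0 (n : int) : n%:~R = 0 :> 'F_p -> (p %| n)%Z.
Proof.
have chp : p \in [pchar 'F_p] by rewrite pchar_Fp.
case: n => n; rewrite ?NegzE ?mulrNz ?dvdzN -pmulrn.
  by move/eqP; rewrite -(dvdn_pcharf chp).
by move/eqP; rewrite oppr_eq0 -(dvdn_pcharf chp).
Qed.

Lemma polyZ_modp (f : {poly int}) :
  map_poly intr f = 0 :> {poly 'F_p} -> exists g : {poly int}, f = p%:Z *: g.
Proof.
move=> f0; exists (\poly_(i < size f) (f`_i %/ p)%Z); apply/polyP => i.
rewrite coefZ coef_poly; case: ltnP => [_|/leq_sizeP-> //]; last by rewrite mulr0.
rewrite mulrC divzK // Fp_intr_eq0 //.
by have := congr1 (fun q : {poly 'F_p} => q`_i) f0; rewrite coef_map coef0.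
Qed.

(** Over F_p, raising to the power p^k is a ring morphism that fixes the
    constants. *)
Lemma polyZ_frob (f : {poly int}) k :
  exists h : {poly int}, f ^+ (p ^ k) = (f \Po 'X^(p ^ k)) + p%:Z *: h.
Proof.
have [|h E] := @polyZ_modp (f ^+ (p ^ k) - (f \Po 'X^(p ^ k))).
  by rewrite rmorphB rmorphXn /= map_comp_poly map_polyXn Fp_poly_expX subrr.
by exists h; rewrite -E [RHS]addrC subrK.
Qed.

Lemma polyZ_Xp_sub_X : exists g : {poly int},
  'X^p - 'X = \prod_(x : 'F_p) ('X - (nat_of_ord x)%:Z%:P) + p%:Z *: g.
Proof.
have [|h E] := @polyZ_modp ('X^p - 'X - \prod_(x : 'F_p) ('X - (nat_of_ord x)%:Z%:P)).
  rewrite !rmorphB /= map_polyXn map_polyX rmorph_prod /=.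
  have := finField_genPoly 'F_p; rewrite card_Fp // => ->; apply/eqP; rewrite subr_eq0.
  apply/eqP/eq_bigr => x _; rewrite rmorphB /= map_polyX map_polyC /=.
  by rewrite -pmulrn natr_Zp.
by exists h; rewrite -E [RHS]addrC subrK.
Qed.

End IntegerPolynomials.

(** * Frobenius on the values of integer polynomials *)

Section Teichmuller.
Variables (R : realType) (p : nat) (K : cpType R p).
Hypothesis p_prime : prime p.
Implicit Types (x y z s t : K) (e : R) (f g h : {poly int}).
Notation ip := (p%:R^-1 : R).

Definition evz t f : K := (map_poly intr f).[t].

Lemma evzD t f g : evz t (f + g) = evz t f + evz t g.
Proof. by rewrite /evz rmorphD hornerD. Qed.
Lemma evzB t f g : evz t (f - g) = evz t f - evz t g.
Proof. by rewrite /evz rmorphB hornerD hornerN. Qed.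
Lemma evzM t f g : evz t (f * g) = evz t f * evz t g.
Proof. by rewrite /evz rmorphM hornerM. Qed.
Lemma evz_exp t f n : evz t (f ^+ n) = evz t f ^+ n.
Proof. by rewrite /evz rmorphXn /= horner_exp. Qed.
Lemma evzX t : evz t 'X = t.
Proof. by rewrite /evz map_polyX hornerX. Qed.
Lemma evzC t (n : int) : evz t n%:P = n%:~R.
Proof. by rewrite /evz map_polyC hornerC. Qed.
Lemma evzZ t (n : int) f : evz t (n *: f) = n%:~R * evz t f.
Proof. by rewrite -mul_polyC evzM evzC. Qed.
Lemma evz_comp t f n : evz t (f \Po 'X^n) = evz (t ^+ n) f.
Proof. by rewrite /evz map_comp_poly map_polyXn horner_comp hornerXn. Qed.
Lemma evz_sum t (I : Type) (r : seq I) (P : pred I) (F : I -> {poly int}) :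
  evz t (\sum_(i <- r | P i) F i) = \sum_(i <- r | P i) evz t (F i).
Proof. by rewrite /evz rmorph_sum horner_sum. Qed.

Lemma evz_le1 t f : abs t <= 1 -> abs (evz t f) <= 1.
Proof.
move=> t1; elim/poly_ind: f => [|f c IH].
  by rewrite /evz rmorph0 horner0 abs0 ler01.
by rewrite evzD evzM evzX evzC absD_le ?abs_int_le1 ?absM_le1.
Qed.

(** The polynomial h does not depend on the point of evaluation: the proofs below
    compare its values at t and at t^p. *)
Lemma evz_frob f k :
  exists h, forall t : K, evz t f ^+ (p ^ k) = evz (t ^+ (p ^ k)) f + p%:R * evz t h.
Proof.
have [h E] := polyZ_frob p_prime f k; exists h => s.
by rewrite -evz_exp E evzD evz_comp evzZ.
Qed.

Lemma abs_nat_sub_Fp (x y : 'F_p) : x != y ->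
  abs ((nat_of_ord x)%:R - (nat_of_ord y)%:R : K) = 1.
Proof.
wlog lt : x y / (x < y)%N => [hw xy|_].
  case: (ltngtP x y) => [h|h|/val_inj/eqP]; last by rewrite (negbTE xy).
    exact: hw.
  by rewrite abs_subC hw // eq_sym.
rewrite abs_subC -natrB ?(ltnW lt) // abs_nat_coprime //.
rewrite prime_coprime // gtnNdvd ?subn_gt0 //.
apply: leq_ltn_trans (leq_subr _ _) _.
by have := ltn_ord y; rewrite [X in (_ < X)%N]Fp_cast.
Qed.

(** X^p - X is congruent modulo p to the product of the X - x for 0 <= x < p, so
    one of the y - x is small; the other ones are then units. *)
Lemma near_int y : abs y <= 1 -> abs (y ^+ p - y) <= ip ->
  exists n : nat, abs (y - n%:R) <= ip.
Proof.
move=> y1 yp; have [g E] := polyZ_Xp_sub_X p_prime.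
have {E} : abs (\prod_(x : 'F_p) (y - (nat_of_ord x)%:R)) <= ip.
  have -> : \prod_(x : 'F_p) (y - (nat_of_ord x)%:R) = (y ^+ p - y) - p%:R * evz y g.
    move/(congr1 (evz y)): E; rewrite evzB evz_exp evzX evzD evzZ => ->.
    rewrite addrK /evz rmorph_prod horner_prod /=; apply: eq_bigr => x _.
    by rewrite rmorphB /= map_polyX map_polyC hornerXsubC.
  by apply: absB_le => //; rewrite mulrC absM_le1 ?abs_p ?evz_le1.
move=> P; have [x xy] : exists x : 'F_p, abs (y - (nat_of_ord x)%:R) < 1.
  apply: contrapT => /forallNP h; move: P.
  rewrite abs_prod big1 ?leNgt ?ip_lt1 // => x _; apply/le_anti.
  by rewrite absB_le ?abs_nat_le1 //= leNgt; apply/negP/h.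
exists x; move: P; rewrite (bigD1 x) //= absM abs_prod big1 ?mulr1 // => z zx.
have xz : abs ((nat_of_ord x)%:R - (nat_of_ord z)%:R : K) = 1.
  by rewrite abs_nat_sub_Fp // eq_sym.
have -> : y - (nat_of_ord z)%:R =
    (nat_of_ord x)%:R - (nat_of_ord z)%:R + (y - (nat_of_ord x)%:R).
  by rewrite [RHS]addrC addrA subrK.
by rewrite abs_dominant xz.
Qed.

Lemma exp_expX_fix t m N : t ^+ (p ^ m) = t -> t ^+ (p ^ (m * N)) = t.
Proof.
by move=> tm; elim: N => [|N IH]; rewrite ?muln0 ?expr1 // mulnS expnD exprM tm.
Qed.

Lemma le1_of_expX t m : (0 < m)%N -> t ^+ (p ^ m) = t -> abs t <= 1.
Proof.
move=> m0 tm; rewrite leNgt; apply/negP => t1.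
have: abs t < abs (t ^+ (p ^ m)).
  by rewrite absX -[ltLHS]expr1 ltr_eXn2l // -[1%N](expn0 p) ltn_exp2l ?prime_gt1.
by rewrite tm ltxx.
Qed.

(** Fixed points of Frobenius in Z[t] are p-adic integers. The integer n is found
    one p-adic digit at a time: g(t) = f(t) - n0 is divisible by p, and as
    g(t)^q is negligible for q a large power of p^m, the congruence
    g(X)^q = g(X^q) + p h(X) gives g(t) = - p h(t), where h(t) is again fixed by
    Frobenius but modulo a smaller power of p. *)
Lemma frob_fixed_near_int t m f k : (0 < m)%N -> t ^+ (p ^ m) = t -> abs t <= 1 ->
  abs (evz (t ^+ p) f - evz t f) <= ip ^+ k ->
  exists n : int, abs (evz t f - n%:~R) <= ip ^+ k.
Proof.
move=> m0 tm t1; elim: k f => [|k IH] f hf.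
  by exists 0; rewrite subr0 expr0 evz_le1.
have tp1 : abs (t ^+ p) <= 1 by rewrite absX_le1.
have [n0 hn0] : exists n : nat, abs (evz t f - n%:R) <= ip.
  apply: near_int; first exact: evz_le1.
  have [h Eh] := evz_frob f 1; rewrite expn1 in Eh.
  rewrite Eh addrAC absD_le //; first by apply: le_trans hf (ipX_le _ _ (_ : 1 <= _)%N).
  by rewrite mulrC absM_le1 ?abs_p ?evz_le1.
pose g := f - n0%:Z%:P.
have Eg s : evz s g = evz s f - n0%:R by rewrite evzB evzC.
have g1 : abs (evz t g) <= ip by rewrite Eg.
have g2 : abs (evz (t ^+ p) g) <= ip.
  rewrite Eg; apply: abs_sub_le hn0; apply: le_trans hf (ipX_le _ _ (_ : 1 <= _)%N) => //.
have [h Eh] := evz_frob g (m * k.+1).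
have big s : abs (evz s g) <= ip -> abs (evz s g ^+ (p ^ (m * k.+1))) <= ip ^+ k.+1.
  move=> sg; rewrite absX; apply: le_trans (lerXn2r _ _ _ sg) _; rewrite ?nnegrE ?abs_ge0 ?ip_ge0 //.
  apply: ipX_le => //; apply: leq_trans (ltnW (ltn_expl _ (prime_gt1 p_prime))).
  by rewrite leq_pmull.
have E1 : p%:R * evz t h = evz t g ^+ (p ^ (m * k.+1)) - evz t g.
  by rewrite Eh exp_expX_fix // [RHS]addrC addKr.
have E2 : p%:R * evz (t ^+ p) h = evz (t ^+ p) g ^+ (p ^ (m * k.+1)) - evz (t ^+ p) g.
  have tpm : (t ^+ p) ^+ (p ^ m) = t ^+ p by rewrite -exprM mulnC exprM tm.
  by rewrite Eh (exp_expX_fix _ tpm) [RHS]addrC addKr.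
have [|n1 hn1] := IH h.
  have: abs (p%:R * (evz (t ^+ p) h - evz t h)) <= ip ^+ k.+1.
    have -> : p%:R * (evz (t ^+ p) h - evz t h) =
      evz (t ^+ p) g ^+ (p ^ (m * k.+1)) - evz t g ^+ (p ^ (m * k.+1)) -
      (evz (t ^+ p) f - evz t f).
      rewrite mulrBr E1 E2 (Eg t) (Eg (t ^+ p)).
      generalize (evz (t ^+ p) f) (evz t f) => a b.
      generalize ((a - n0%:R) ^+ (p ^ (m * k.+1))) ((b - n0%:R) ^+ (p ^ (m * k.+1))).
      by move=> c d; ring.
    by apply: absB_le => //; apply: absB_le; apply: big.
  by rewrite absM abs_p exprS ler_pM2l ?ip_gt0.
exists (n0%:Z - p%:Z * n1).
have -> : evz t f - (n0%:Z - p%:Z * n1)%:~R =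
  evz t g ^+ (p ^ (m * k.+1)) - p%:R * (evz t h - n1%:~R).
  rewrite mulrBr E1 rmorphB rmorphM /= -!pmulrn.
  by move: (evz t g ^+ _) => c; rewrite Eg; ring.
apply: absB_le; first exact: big.
by rewrite absM abs_p exprS ler_pM2l ?ip_gt0.
Qed.

End Teichmuller.

(** * The unramified rings of integers *)

Section Unramified.
Variables (R : realType) (p : nat) (K : cpType R p).
Hypothesis p_prime : prime p.
Implicit Types (x y z s t : K) (e : R) (f g h : {poly int}) (L S : set K).
Notation ip := (p%:R^-1 : R).

Lemma subfieldP L : subfield L <->
  [/\ L 1, forall x y, L x -> L y -> L (x - y) &
      forall x y, L x -> L y -> L (x / y)].
Proof.
have E x : (x \in [in L]) <-> L x by split; [move/set_mem|move/mem_set].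
split=> [[L1 LB LV]|[L1 LB LV]]; split; try exact/E.
- by move=> x y /E hx /E hy; apply/E/LB.
- by move=> x y /E hx /E hy; apply/E/LV.
- by move=> x y /E hx /E hy; apply/E/LB.
- by move=> x y /E hx /E hy; apply/E/LV.
Qed.

Section Subfield.
Variable L : set K.
Hypothesis L_sub : subfield L.

Lemma subfield1 : L 1. Proof. by have [] := (subfieldP L).1 L_sub. Qed.
Lemma subfieldB x y : L x -> L y -> L (x - y).
Proof. by have [_ h _] := (subfieldP L).1 L_sub; apply: h. Qed.
Lemma subfield_div x y : L x -> L y -> L (x / y).
Proof. by have [_ _ h] := (subfieldP L).1 L_sub; apply: h. Qed.
Lemma subfield0 : L 0. Proof. by rewrite -(subrr 1); apply: subfieldB; apply: subfield1. Qed.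
Lemma subfieldN x : L x -> L (- x).
Proof. by rewrite -sub0r; apply: subfieldB subfield0. Qed.
Lemma subfieldD x y : L x -> L y -> L (x + y).
Proof. by move=> Lx /subfieldN; rewrite -{2}[y]opprK; apply: subfieldB. Qed.
Lemma subfieldV x : L x -> L x^-1.
Proof. by rewrite -div1r; apply: subfield_div subfield1. Qed.
Lemma subfieldM x y : L x -> L y -> L (x * y).
Proof. by move=> Lx /subfieldV; rewrite -{2}[y]invrK; apply: subfield_div. Qed.
Lemma subfieldX x n : L x -> L (x ^+ n).
Proof.
by move=> Lx; elim: n => [|n IH]; rewrite ?expr0 ?exprS; [exact: subfield1|exact: subfieldM].
Qed.
Lemma subfield_sum (I : Type) (r : seq I) (P : pred I) (F : I -> K) :
  (forall i, P i -> L (F i)) -> L (\sum_(i <- r | P i) F i).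
Proof. by move=> h; elim/big_rec: _ => [|i x Pi Lx]; [exact: subfield0|apply/subfieldD/Lx/h]. Qed.
Lemma subfield_prod (I : Type) (r : seq I) (P : pred I) (F : I -> K) :
  (forall i, P i -> L (F i)) -> L (\prod_(i <- r | P i) F i).
Proof. by move=> h; elim/big_rec: _ => [|i x Pi Lx]; [exact: subfield1|apply/subfieldM/Lx/h]. Qed.
Lemma subfield_nat n : L n%:R.
Proof. by elim: n => [|n IH]; rewrite ?mulr0n -?natr1; [exact: subfield0|apply/subfieldD/subfield1]. Qed.
Lemma subfield_int (n : int) : L n%:~R.
Proof.
by case: n => n; rewrite ?NegzE ?mulrNz -pmulrn; [exact: subfield_nat|apply/subfieldN/subfield_nat].
Qed.

End Subfield.

Lemma adjoin_subfield S : subfield (adjoin_Qp S).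
Proof.
apply/subfieldP; split=> [L [Lf _]|x y xS yS L LS|x y xS yS L LS].
- exact: subfield1.
- by apply: subfieldB LS.1 _ _ (xS _ LS) (yS _ LS).
- by apply: subfield_div LS.1 _ _ (xS _ LS) (yS _ LS).
Qed.

Lemma adjoin_Qp_sub S x : Qp K x -> adjoin_Qp S x.
Proof. by move=> Qx L [_ h]; apply: h; left. Qed.

Lemma adjoin_sub S x : S x -> adjoin_Qp S x.
Proof. by move=> Qx L [_ h]; apply: h; right. Qed.

Lemma adjoin_min S L x : subfield L -> (forall y, Qp K y -> L y) ->
  (forall y, S y -> L y) -> adjoin_Qp S x -> L x.
Proof. by move=> Lf LQ LS; apply; split=> // y []; [apply: LQ|apply: LS]. Qed.

(** The closure of Z[t]; it is the ring of integers of Q_p(t) when t is a root of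
    unity of order prime to p, or 0. *)
Definition Zclos t : set K :=
  [set y | forall e, 0 < e -> exists f, abs (y - evz t f) < e].

Lemma Zclos_evz t f : Zclos t (evz t f).
Proof. by move=> e e0; exists f; rewrite subrr abs0. Qed.

Lemma Zclos_closed t y :
  (forall e, 0 < e -> exists2 z, Zclos t z & abs (y - z) < e) -> Zclos t y.
Proof.
move=> h e e0; have [z /(_ _ e0)[f zf] yz] := h _ e0; exists f.
exact: abs_sub_lt yz zf.
Qed.

Lemma ZclosB t y z : Zclos t y -> Zclos t z -> Zclos t (y - z).
Proof.
move=> hy hz e e0; have [f hf] := hy _ e0; have [g hg] := hz _ e0.
exists (f - g); rewrite evzB.
have -> : y - z - (evz t f - evz t g) = (y - evz t f) - (z - evz t g) by ring.
exact: absB_lt.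
Qed.

Section Zt.
Variables (t : K) (m : nat).
Hypotheses (m_gt0 : (0 < m)%N) (tm : t ^+ (p ^ m) = t).

Let t_le1 : abs t <= 1. Proof. exact: le1_of_expX m_gt0 tm. Qed.

Lemma Zclos_le1 y : Zclos t y -> abs y <= 1.
Proof.
move=> /(_ _ ltr01)[f /ltW yf]; rewrite -(subrK (evz t f) y).
by rewrite absD_le ?evz_le1.
Qed.

Lemma ZclosM y z : Zclos t y -> Zclos t z -> Zclos t (y * z).
Proof.
move=> hy hz e e0; have [f hf] := hy _ e0; have [g hg] := hz _ e0.
exists (f * g); rewrite evzM.
have -> : y * z - evz t f * evz t g = z * (y - evz t f) + evz t f * (z - evz t g) by ring.
apply: absD_lt.
  exact: le_lt_trans (absM_le1 (Zclos_le1 hz) (lexx _)) hf.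
exact: le_lt_trans (absM_le1 (evz_le1 f t_le1) (lexx _)) hg.
Qed.

Lemma Zclos1 : Zclos t 1.
Proof. by have := Zclos_evz t 1; rewrite /evz rmorph1 hornerC. Qed.

Lemma ZclosX y n : Zclos t y -> Zclos t (y ^+ n).
Proof.
by move=> hy; elim: n => [|n IH]; rewrite ?expr0 ?exprS; [exact: Zclos1|exact: ZclosM].
Qed.

Lemma Zclos_int (n : int) : Zclos t n%:~R.
Proof. by rewrite -(evzC t); apply: Zclos_evz. Qed.

(** y is congruent to some f(t), and f(t)^q = f(t^q) = f(t) modulo p, for
    q = p^m. *)
Lemma Zclos_frob y : Zclos t y -> abs (y ^+ (p ^ m) - y) <= ip.
Proof.
move=> hy; have [f yf] := hy _ (ip_gt0 R p_prime).
have y1 := Zclos_le1 hy; have f1 := evz_le1 f t_le1.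
have [h Eh] := evz_frob K p_prime f m.
apply: (@abs_sub_le _ _ _ (evz t f)); last by rewrite abs_subC ltW.
apply: (@abs_sub_le _ _ _ (evz t f ^+ (p ^ m))).
  by apply: abs_exp_sub_le => //; apply: ltW.
by rewrite Eh tm addrAC subrr add0r mulrC absM_le1 ?evz_le1 ?abs_p.
Qed.

(** No element has absolute value strictly between |p| and 1, because
    f(t) = f(t)^q - p h(t) with f(t)^q arbitrarily small. *)
Lemma Zclos_divp y : Zclos t y -> abs y < 1 -> Zclos t (y / p%:R).
Proof.
move=> hy y1 e e0; pose e' := Num.min (ip * e) 1.
have e'0 : 0 < e' by rewrite lt_min ltr01 andbT mulr_gt0 ?ip_gt0.
have [f yf] := hy _ e'0.
have f1 : abs (evz t f) < 1.
  rewrite -(subKr y (evz t f)) absB_lt //.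
  by apply: lt_le_trans yf _; rewrite ge_min lexx orbT.
have [N hN] := expr_small (abs_ge0 _) f1 e'0.
(* y / p is close to f(t) / p = f(t)^q / p - h(t), for q = p^(m N) *)
have [h Eh] := evz_frob K p_prime f (m * N); exists (- h).
have pK : abs (p%:R : K) = ip by exact: abs_p.
rewrite -(ltr_pM2l (ip_gt0 R p_prime)) -{1}pK -absM.
have -> : p%:R * (y / p%:R - evz t (- h)) =
    (y - evz t f) + evz t f ^+ (p ^ (m * N)).
  rewrite Eh (exp_expX_fix _ tm) /evz rmorphN /= hornerN mulrBr mulrCA divff ?pK_neq0 //.
  by ring.
apply: lt_le_trans (_ : e' <= _); last by rewrite ge_min lexx.
apply: absD_lt => //; rewrite absX; apply: hN.
by apply: leq_trans (ltnW (ltn_expl _ (prime_gt1 p_prime))); rewrite leq_pmull.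
Qed.

(** The inverse is a limit of the powers of y of exponents (p^m - 1) p^N - 1,
    since y^(p^m - 1) is congruent to 1 modulo p. *)
Lemma Zclos_inv y : Zclos t y -> abs y = 1 -> Zclos t y^-1.
Proof.
move=> hy y1; apply: Zclos_closed => e e0.
have y0 : y != 0 by rewrite -abs_gt0 y1.
have := Zclos_frob hy.
have q1 : (1 < p ^ m)%N by rewrite -[1%N](expn0 p) ltn_exp2l ?prime_gt1.
have qE : (p ^ m)%N = (p ^ m).-1.+1 by rewrite prednK // ltnW.
have -> : y ^+ (p ^ m) - y = y * (y ^+ (p ^ m).-1 - 1).
  by rewrite mulrBr mulr1 -exprS -qE.
rewrite absM y1 mul1r => h.
have [N hN] := ipX_small p_prime e0.
have h' := abs_exppX_sub_le (k := 0) p_prime N (absX_le1 _ _) _ h.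
exists (y ^+ ((p ^ m).-1 * p ^ N).-1); first exact: ZclosX.
have Ep : ((p ^ m).-1 * p ^ N)%N = ((p ^ m).-1 * p ^ N).-1.+1.
  have q0 : (0 < (p ^ m).-1)%N by rewrite -ltnS -qE.
  by rewrite prednK // muln_gt0 q0 expn_gt0 prime_gt0.
rewrite -[abs _]mul1r -y1 -absM mulrBr divff // -exprS -Ep abs_subC exprM -[X in _ - X](expr1n _ (p ^ N)).
apply: le_lt_trans (h' _ _) (hN _ _); rewrite ?y1 ?abs1 ?add0n ?leqnSn //.
Qed.

Lemma Zclos_norm y : Zclos t y -> y != 0 ->
  exists j u, [/\ Zclos t u, abs u = 1 & y = p%:R ^+ j * u].
Proof.
move=> hy y0; have [N /(_ N (leqnn N)) hN] : exists N, forall n, (N <= n)%N -> ip ^+ n < abs y.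
  by apply: ipX_small; rewrite ?abs_gt0.
elim: N y hy y0 hN => [|N IH] y hy y0 yN.
  by move: yN; rewrite expr0 ltNge Zclos_le1.
have [y1|] := ltP (abs y) 1; last first.
  move=> y1; exists 0%N, y; rewrite expr0 mul1r; split=> //.
  by apply/le_anti; rewrite y1 Zclos_le1.
have p0 := pK_neq0 K p_prime.
have [||j [u [hu u1 E]]] := IH _ (Zclos_divp hy y1).
- by rewrite mulf_neq0 ?invr_eq0.
- by rewrite absM absV abs_p invrK -ltr_pdivrMr ?ltr0n ?prime_gt0 // mulrC -exprS.
exists j.+1, u; split=> //.
by rewrite exprS -mulrA -E mulrCA divff ?mulr1.
Qed.

(** The fraction field of the closure of Z[t]: by [Zclos_norm] it is enough to
    invert p. *)
Definition Zfrac : set K := [set x | exists k, Zclos t (p%:R ^+ k * x)].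

Lemma Zclos_pX k : Zclos t (p%:R ^+ k).
Proof. by rewrite pmulrn; apply/ZclosX/Zclos_int. Qed.

Lemma Zclos_pM k y : Zclos t y -> Zclos t (p%:R ^+ k * y).
Proof. by apply/ZclosM/Zclos_pX. Qed.

Lemma Zfrac_Zclos x : Zfrac x -> abs x <= 1 -> Zclos t x.
Proof.
move=> [k hk] x1; have [->|x0] := eqVneq x 0; first exact: (Zclos_int 0).
have pk0 : (p%:R ^+ k : K) != 0 by rewrite expf_neq0 ?pK_neq0.
have [|j [u [hu u1 E]]] := Zclos_norm hk; first by rewrite mulf_neq0.
have kj : (k <= j)%N.
  have : ip ^+ j <= ip ^+ k.
    by have := congr1 abs E; rewrite !absM u1 mulr1 !abs_pX => <-; rewrite ler_piMr ?ipX_ge0.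
  by rewrite ler_iXn2l ?ip_gt0 ?ip_lt1.
have -> : x = p%:R ^+ (j - k) * u.
  by apply: (mulfI pk0); rewrite mulrA -exprD subnKC.
exact: Zclos_pM.
Qed.

Lemma Zfrac_sub x : Zclos t x -> Zfrac x.
Proof. by exists 0%N; rewrite mul1r. Qed.

Lemma Zfrac_subfield : subfield Zfrac.
Proof.
have Zfrac_inv y : Zfrac y -> Zfrac y^-1.
  move=> [k hk]; have [->|y0] := eqVneq y 0.
    by rewrite invr0; apply/Zfrac_sub/(Zclos_int 0).
  have pk0 : (p%:R ^+ k : K) != 0 by rewrite expf_neq0 ?pK_neq0.
  have [|j [u [hu u1 E]]] := Zclos_norm hk; first by rewrite mulf_neq0.
  have pj0 : (p%:R ^+ j : K) != 0 by rewrite expf_neq0 ?pK_neq0.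
  exists j; have -> : p%:R ^+ j * y^-1 = p%:R ^+ k * u^-1.
    have u0 : u != 0 by rewrite -abs_gt0 u1.
    apply/eqP; rewrite eqr_div //; first by rewrite -E mulrC.
  exact/Zclos_pM/Zclos_inv.
have ZfracM y z : Zfrac y -> Zfrac z -> Zfrac (y * z).
  by move=> [k hk] [j hj]; exists (k + j)%N; rewrite exprD mulrACA; apply: ZclosM.
apply/subfieldP; split.
- exact/Zfrac_sub/Zclos1.
- move=> y z [k hk] [j hj]; exists (k + j)%N; rewrite mulrBr.
  apply: ZclosB; first by rewrite addnC exprD -mulrA; apply: Zclos_pM.
  by rewrite exprD -mulrA; apply: Zclos_pM.
- by move=> y z hy hz; apply/ZfracM/Zfrac_inv.
Qed.

Lemma Zfrac_closed x :
  (forall e, 0 < e -> exists2 z, Zfrac z & abs (x - z) < e) -> Zfrac x.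
Proof.
move=> h; have [k hk] : exists k, abs (p%:R ^+ k * x) <= 1.
  have [->|x0] := eqVneq x 0; first by exists 0%N; rewrite mulr0 abs0 ler01.
  have x1 : 0 < (abs x)^-1 by rewrite invr_gt0 abs_gt0.
  have [k /(_ k (leqnn k)) hk] := ipX_small p_prime x1; exists k.
  by rewrite absM abs_pX -ler_pdivlMr ?abs_gt0 // div1r ltW.
exists k; apply: Zclos_closed => e e0.
have [|z hz xz] := h (Num.min e 1); first by rewrite lt_min e0 ltr01.
move: xz; rewrite lt_min => /andP[xz1 xz2].
exists (p%:R ^+ k * z).
  apply: Zfrac_Zclos; first exact: subfieldM Zfrac_subfield _ _ (Zfrac_sub (Zclos_pX k)) hz.
  rewrite -(subKr (p%:R ^+ k * x) (_ * z)) absB_le // -mulrBr.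
  by rewrite absM_le1 ?absX_le1 ?abs_nat_le1 // ltW.
rewrite -mulrBr; apply: le_lt_trans (absM_le1 _ (lexx _)) xz1.
by rewrite absX_le1 ?abs_nat_le1.
Qed.

(** The rational numbers lie in the field [Zfrac], which is closed. *)
Lemma Zfrac_Qp x : Qp K x -> Zfrac x.
Proof.
move=> /closure_absP h; apply: Zfrac_closed => e /h[_ [q _ <-] xq].
exists (ratr q) => //; have Zf := Zfrac_subfield.
by apply: subfield_div; rewrite //; apply: subfield_int.
Qed.

End Zt.

Lemma Zclos1_int y : Zclos 1 y <->
  forall e, 0 < e -> exists n : int, abs (y - n%:~R) < e.
Proof.
have E f : evz 1 f = f.[1]%:~R by rewrite /evz -(rmorph1 intr) horner_map.
split=> h e e0.
  by have [f hf] := h _ e0; exists f.[1]; rewrite -E.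
by have [n hn] := h _ e0; exists n%:P; rewrite evzC.
Qed.

Let one_fix : (1 : K) ^+ (p ^ 1) = 1. Proof. exact: expr1n. Qed.

(** Both sides are the elements of absolute value at most 1 of a field: Q_p, and
    the fraction field of the closure of Z. *)
Lemma padic_intP y : padic_int K y <-> Zclos 1 y.
Proof.
split=> [[Qy y1]|hy].
  by apply: (Zfrac_Zclos _ one_fix) y1 => //; apply: (Zfrac_Qp _ one_fix).
split; last exact: (Zclos_le1 _ one_fix).
apply/closure_absP => e e0; have [n hn] := (Zclos1_int y).1 hy e e0.
by exists n%:~R => //; exists n%:~R => //; rewrite ratr_int.
Qed.

Lemma padic_int_nat n : padic_int K n%:R.
Proof. by rewrite pmulrn; apply/padic_intP/Zclos_int. Qed.

(** The Teichmueller representative is the limit of the y^(p^(m N)), a Cauchy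
    sequence because raising to the power p improves congruences. *)
Lemma teich_exists y m : (0 < m)%N -> abs y <= 1 -> abs (y ^+ (p ^ m) - y) <= ip ->
  exists2 s, s ^+ (p ^ m) = s & abs (y - s) <= ip.
Proof.
move=> m0 y1 hy; pose u N := y ^+ (p ^ (m * N)).
have u1 N : abs (u N) <= 1 by apply: absX_le1.
have uS N : u N.+1 = u N ^+ (p ^ m) by rewrite /u mulnS addnC expnD exprM.
have du N : abs (u N.+1 - u N) <= ip ^+ N.+1.
  have -> : u N.+1 = (y ^+ (p ^ m)) ^+ (p ^ (m * N)) by rewrite /u mulnS expnD exprM.
  apply: le_trans (abs_exppX_sub_le (k := 0) p_prime _ (absX_le1 _ y1) y1 _) _ => //.
  by rewrite ipX_le // ltnS leq_pmull.
have [s us] : exists s, tends u s.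
  apply: cauchy_tends => e e0; have [N hN] := ipX_small p_prime e0.
  by exists N => n Nn; apply: le_lt_trans (du n) (hN _ _); apply: leqW.
exists s.
  apply: tends_unique (tends_eq _ (tendsX (p ^ m) us)) (tends_shift 1 us) => n.
  by rewrite addn1 uS.
have u_y N : abs (u N - y) <= ip.
  elim: N => [|N IH]; first by rewrite /u muln0 subrr abs0 ip_ge0.
  apply: abs_sub_le IH; apply: le_trans (du N) _.
  by rewrite -[leRHS]expr1 ipX_le.
rewrite abs_subC; apply: tends_abs_le (tendsB us (tends_cst y)).
by exists 0%N => N _; apply: u_y.
Qed.

(** The trace to Q_p of t when t^(p^m) = t: Frobenius maps t to t^p. *)
Definition teich_trace (m : nat) t : K := \sum_(i < m) t ^+ (p ^ i).

Lemma teich_trace_expX m t k : (0 < m)%N -> t ^+ (p ^ m) = t ->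
  teich_trace m (t ^+ (p ^ k)) = teich_trace m t.
Proof.
move=> m0 tm; elim: k => [|k IH]; first by rewrite expr1.
rewrite -IH expnSr exprM /teich_trace.
set u := t ^+ _; have um : u ^+ (p ^ m) = u by rewrite -exprM mulnC exprM tm.
case: m m0 um {IH tm} => // m' _ um; rewrite big_ord_recr [RHS]big_ord_recl /= addrC.
congr (_ + _); first by rewrite -exprM -expnS um expr1.
by apply: eq_bigr => i _; rewrite -exprM -expnS.
Qed.

(** The trace is the value at t of the sum f of the X^(p^i), and f(t^p) = f(t). *)
Lemma trace_padic_int t m : (0 < m)%N -> t ^+ (p ^ m) = t ->
  padic_int K (teich_trace m t).
Proof.
move=> m0 tm; apply/padic_intP/Zclos1_int => e e0.
have [k /(_ k (leqnn k)) ke] := ipX_small p_prime e0.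
pose f : {poly int} := \sum_(i < m) 'X^(p ^ i).
have E u : evz u f = teich_trace m u.
  by rewrite evz_sum; apply: eq_bigr => i _; rewrite evz_exp evzX.
have [|n hn] := frob_fixed_near_int p_prime (f := f) (k := k) m0 tm
    (le1_of_expX p_prime m0 tm); last first.
  by exists n; rewrite -E; apply: le_lt_trans hn ke.
by have := teich_trace_expX 1 m0 tm; rewrite expn1 !E => ->; rewrite subrr abs0 ipX_ge0.
Qed.

Lemma fix_padic_int s : s ^+ p = s -> padic_int K s.
Proof.
move=> sp; have := @trace_padic_int s 1 isT; rewrite /teich_trace big_ord1 expr1; apply.
by rewrite expn1.
Qed.

Lemma fix_expX s m : s ^+ p = s -> s ^+ (p ^ m) = s.
Proof. by move=> sp; elim: m => [|m IH]; rewrite ?expr1 // expnSr exprM IH. Qed.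

(** What the arguments about Witt vectors use of the ring of integers of
    Q_p(zeta_(p^m-1)). The last field says that the Teichmueller representatives
    of O represent all its residue classes modulo p. *)
Record unramified_ring (m : nat) (O : set K) : Prop := {
  unr_1 : O 1;
  unr_B : forall x y, O x -> O y -> O (x - y);
  unr_M : forall x y, O x -> O y -> O (x * y);
  unr_le1 : forall x, O x -> abs x <= 1;
  unr_teich : forall x, O x -> exists s, [/\ O s, s ^+ (p ^ m) = s & abs (x - s) <= ip]
}.

Lemma padic_int_unramified m : unramified_ring m (padic_int K).
Proof.
split.
- exact/padic_intP/Zclos1.
- by move=> x y /padic_intP hx /padic_intP hy; apply/padic_intP/ZclosB.
- move=> x y /padic_intP hx /padic_intP hy; apply/padic_intP.
  exact: (@ZclosM 1 1 isT one_fix).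
- by move=> x [].
- move=> x /padic_intP hx; have x1 := @Zclos_le1 1 1 isT one_fix _ hx.
  have := @Zclos_frob 1 1 isT one_fix _ hx.
  move=> /(@teich_exists _ 1 isT x1)[s]; rewrite expn1 => sp xs.
  by exists s; split=> //; [exact: fix_padic_int|exact: fix_expX].
Qed.

(** Let t be a primitive root of unity of order p^m - 1. The field is contained in
    the fraction field of the closure of Z[t], so a Teichmueller representative s
    exists as a limit; being a root of X^(p^m) - X it is 0 or a power of t, and so
    lies in the field. If there were no such t the field would be Q_p, whose
    Teichmueller representatives are fixed by x |-> x^p. *)
Lemma Ou_unramified m : (0 < m)%N -> unramified_ring m (Ou K m).
Proof.
move=> m0; set L := adjoin_Qp [set z : K | (p ^ m - 1).-primitive_root z].
have Lf : subfield L by apply: adjoin_subfield.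
have LQ x : Qp K x -> L x by apply: adjoin_Qp_sub.
have q0 : (0 < p ^ m - 1)%N.
  by rewrite subn_gt0 -[1%N](expn0 p) ltn_exp2l ?prime_gt1.
suff LT x : Ou K m x -> exists s, [/\ L s, s ^+ (p ^ m) = s & abs (x - s) <= ip].
  split.
  - by split; [exact: (subfield1 Lf)|rewrite abs1].
  - by move=> x y [Lx x1] [Ly y1]; split; [exact: (subfieldB Lf)|exact: absB_le].
  - by move=> x y [Lx x1] [Ly y1]; split; [exact: (subfieldM Lf)|exact: absM_le1].
  - by move=> x [].
  - move=> x /LT[s [Ls sm xs]]; exists s; split=> //; split=> //.
    exact: le1_of_expX m0 sm.
move=> [Lx x1]; have [[t tprim]|noprim] := pselect (exists t : K, (p ^ m - 1).-primitive_root t).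
- have tm : t ^+ (p ^ m) = t.
    rewrite -[(p ^ m)%N](subnK (_ : 0 < _)%N) ?expn_gt0 ?prime_gt0 //.
    by rewrite addn1 exprS (prim_expr_order tprim) mulr1.
  have hx : Zclos t x.
    apply: (Zfrac_Zclos m0 tm) x1; apply: adjoin_min Lx.
    - exact: Zfrac_subfield m0 tm.
    - exact: Zfrac_Qp m0 tm.
    move=> y /= /prim_expr_order/(prim_rootP tprim)[i ->].
    have -> : t ^+ i = evz t ('X ^+ i) by rewrite evz_exp evzX.
    exact/Zfrac_sub/Zclos_evz.
  have [s sm xs] := teich_exists m0 x1 (Zclos_frob m0 tm hx).
  exists s; split=> //; have [->|s0] := eqVneq s 0; first exact: (subfield0 Lf).
  have : s ^+ (p ^ m - 1) = 1.
    apply: (mulfI s0); rewrite -exprS mulr1 -[in RHS]sm; congr (s ^+ _).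
    by rewrite -addn1 subnK // expn_gt0 prime_gt0.
  by move=> /(prim_rootP tprim)[i ->]; apply: (subfieldX Lf); apply: adjoin_sub.
- have hx : padic_int K x.
    apply/padic_intP; apply: (@Zfrac_Zclos 1 1 isT one_fix) x1; apply: adjoin_min Lx.
    - exact: (@Zfrac_subfield 1 1 isT one_fix).
    - exact: (@Zfrac_Qp 1 1 isT one_fix).
    by move=> y yprim; case: noprim; exists y.
  have [s [[Qs _] sm xs]] := unr_teich (padic_int_unramified m) hx.
  by exists s; split=> //; apply: LQ.
Qed.

End Unramified.

(** * Witt vectors over an unramified ring *)

Section UnramifiedRing.
Variables (R : realType) (p : nat) (K : cpType R p) (m : nat) (O : set K).
Hypothesis O_unr : unramified_ring m O.
Implicit Types x y : K.

Lemma unr_0 : O 0.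
Proof. by rewrite -(subrr 1); apply: (unr_B O_unr); apply: (unr_1 O_unr). Qed.
Lemma unr_D x y : O x -> O y -> O (x + y).
Proof.
move=> hx hy; rewrite -[y]opprK -[- y]sub0r; apply: (unr_B O_unr) => //.
exact: (unr_B O_unr unr_0 hy).
Qed.
Lemma unr_X x k : O x -> O (x ^+ k).
Proof.
move=> hx; elim: k => [|k IH]; first exact: (unr_1 O_unr).
by rewrite exprS; apply: (unr_M O_unr hx IH).
Qed.
Lemma unr_sum (I : Type) (r : seq I) (P : pred I) (F : I -> K) :
  (forall i, P i -> O (F i)) -> O (\sum_(i <- r | P i) F i).
Proof. by move=> h; elim/big_rec: _ => [|i x Pi Lx]; [exact: unr_0|apply/unr_D/Lx/h]. Qed.
Lemma unr_Mn x k : O x -> O (x *+ k).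
Proof. by move=> hx; rewrite -[k]card_ord -sumr_const; apply: unr_sum. Qed.

End UnramifiedRing.

Section WittVectors.
Variables (R : realType) (p : nat) (K : cpType R p) (l m : nat).
Hypotheses (p_prime : prime p) (m_gt0 : (0 < m)%N).
Variables (O : set K) (phi : K -> 'I_l -> K).
Hypotheses (O_unr : unramified_ring m O) (phi_iso : canonical_iso O phi).
Implicit Types (x y z s t : K) (a b c : 'I_l -> K) (n i j : 'I_l).
Notation ip := (p%:R^-1 : R).

Lemma ghost_le1 n a : (forall i, abs (a i) <= 1) -> abs (ghost n a) <= 1.
Proof.
move=> a1; apply: abs_sum_le => [|i _]; first exact: ler01.
by rewrite absM_le1 ?absX_le1 ?abs_nat_le1.
Qed.

Lemma ghost_term_congr n i a b : (forall i, abs (a i) <= 1) -> (forall i, abs (b i) <= 1) ->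
  (i <= n)%N -> abs (a i - b i) <= ip ->
  abs (p%:R ^+ i * a i ^+ (p ^ (n - i)) - p%:R ^+ i * b i ^+ (p ^ (n - i))) <= ip ^+ n.+1.
Proof.
move=> a1 b1 le_in ab; rewrite -mulrBr absM abs_pX.
have -> : n.+1 = (i + (n - i).+1)%N by rewrite addnS subnKC.
rewrite exprD ler_pM2l ?ipX_gt0 //.
exact: (abs_exppX_sub_le (k := 0) p_prime).
Qed.

(** Raising to the power p^(n-i) turns a congruence modulo p into one modulo
    p^(n-i+1), and the factor p^i makes it a congruence modulo p^(n+1). *)
Lemma ghost_congr n a b : (forall i, abs (a i) <= 1) -> (forall i, abs (b i) <= 1) ->
  (forall i, abs (a i - b i) <= ip) -> abs (ghost n a - ghost n b) <= ip ^+ n.+1.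
Proof.
move=> a1 b1 ab; rewrite /ghost -sumrB.
by apply: abs_sum_le => [|i le_in]; rewrite ?ipX_ge0 ?ghost_term_congr.
Qed.

(** In the n-th ghost component the terms of index less than n agree modulo
    p^(n+1) by induction, and what remains is p^n (a_n - b_n). *)
Lemma congr_of_ghost a b : (forall i, abs (a i) <= 1) -> (forall i, abs (b i) <= 1) ->
  (forall n, abs (ghost n a - ghost n b) <= ip ^+ n.+1) ->
  forall i, abs (a i - b i) <= ip.
Proof.
move=> a1 b1 h [k kl]; elim/ltn_ind: k kl => k IH kl; set i := Ordinal kl.
have := h i; rewrite /ghost (bigD1 i) //= (bigD1 (P := fun j : 'I_l => (j <= i)%N) i) //=.
rewrite subnn !expr1 opprD addrACA -mulrBr -sumrB.
set S := \sum_(_ < l | _) _ => hS.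
have S1 : abs S <= ip ^+ i.+1.
  apply: abs_sum_le => [|j /andP[ji jni]]; first exact: ipX_ge0.
  apply: (@ghost_term_congr i) => //; case: j ji jni => j jl /= ji jni.
  by apply: IH; rewrite ltn_neqAle ji andbT; apply: contra jni => /eqP E; apply/eqP/val_inj.
have : abs (p%:R ^+ i * (a i - b i)) <= ip ^+ i.+1.
  by rewrite -[p%:R ^+ i * _](addrK S) absB_le.
by rewrite absM abs_pX exprSr ler_pM2l ?ipX_gt0.
Qed.

Let phi_le1 x i : O x -> abs (phi x i) <= 1.
Proof. by move=> hx; apply: (unr_le1 O_unr); apply: (iso_int phi_iso hx i). Qed.

(** Modulo p^(n+1), the n-th ghost component of the Witt vector of x is a ring
    morphism in x: phi (x + y) is congruent modulo p to the vector whose ghost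
    components are the sums of those of phi x and phi y, and congruent vectors have
    congruent ghost components; likewise for products. *)
Notation w n x := (ghost n (phi x)).

Let w_op op x y z n : O x -> O y -> O z -> witt_op op (phi x) (phi y) (phi z) ->
  abs (w n z - op (w n x) (w n y)) <= ip ^+ n.+1.
Proof.
move=> hx hy hz [s hs hc]; rewrite -hs.
have sc i : abs (phi z i - s i) <= ip by apply/congv_p.
apply: ghost_congr => // i; first exact: phi_le1.
rewrite -(subKr (phi z i) (s i)) absB_le ?phi_le1 //.
by apply: le_trans (sc i) (ip_le1 R p_prime).
Qed.

Lemma wittD n x y : O x -> O y -> abs (w n (x + y) - (w n x + w n y)) <= ip ^+ n.+1.
Proof.
by move=> hx hy; apply: w_op (iso_add phi_iso hx hy) => //; apply: (unr_D O_unr).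
Qed.

Lemma wittM n x y : O x -> O y -> abs (w n (x * y) - (w n x * w n y)) <= ip ^+ n.+1.
Proof.
by move=> hx hy; apply: w_op (iso_mul phi_iso hx hy) => //; apply: (unr_M O_unr hx hy).
Qed.

Lemma witt1 n : abs (w n 1 - 1) <= ip ^+ n.+1.
Proof.
have E : ghost n (fun i : 'I_l => (val i == 0%N)%:R) = 1 :> K.
  have l0 : (0 < l)%N by apply: leq_ltn_trans (ltn_ord n).
  rewrite /ghost (bigD1 (Ordinal l0)) //= expr1n mulr1 big1 ?addr0 // => i /andP[_ i0].
  rewrite (negbTE (_ : val i != 0%N)); last first.
    by apply: contra i0 => /eqP E; apply/eqP/val_inj.
  by rewrite expr0n eqn0Ngt expn_gt0 prime_gt0 // mulr0.
rewrite -[X in _ - X]E; apply: ghost_congr => i.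
- by apply: phi_le1; apply: (unr_1 O_unr).
- exact: abs_nat_le1.
- by apply/congv_p => //; apply: (iso_one phi_iso).
Qed.

Lemma wittX n x k : O x -> abs (w n (x ^+ k) - w n x ^+ k) <= ip ^+ n.+1.
Proof.
move=> hx; elim: k => [|k IH]; first exact: witt1.
have wx : abs (w n x) <= 1 by apply: ghost_le1 => i; apply: phi_le1.
rewrite (exprS x) (exprS (w n x)); apply: abs_sub_le (wittM n hx (unr_X O_unr k hx)) _.
by rewrite -mulrBr absM_le1.
Qed.

Lemma witt0 n : abs (w n 0) <= ip ^+ n.+1.
Proof.
have := wittD n (unr_0 O_unr) (unr_0 O_unr); rewrite addr0 opprD addrA subrr add0r absN.
exact.
Qed.

Lemma wittMn n x k : O x -> abs (w n (x *+ k) - w n x *+ k) <= ip ^+ n.+1.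
Proof.
move=> hx; elim: k => [|k IH]; first by rewrite !mulr0n subr0 witt0.
rewrite !mulrS; apply: abs_sub_le (wittD n hx (unr_Mn O_unr k hx)) _.
by rewrite opprD addrACA subrr add0r.
Qed.

Lemma witt_sum n (I : Type) (r : seq I) (F : I -> K) : (forall u, O (F u)) ->
  abs (w n (\sum_(u <- r) F u) - \sum_(u <- r) w n (F u)) <= ip ^+ n.+1.
Proof.
move=> hF; elim: r => [|u r IH]; first by rewrite !big_nil subr0 witt0.
rewrite !big_cons; apply: abs_sub_le (wittD n (hF u) (unr_sum O_unr _ _)) _ => //.
by rewrite opprD addrACA subrr add0r.
Qed.

Lemma witt_residue n x : O x -> abs (w n x - x ^+ (p ^ n)) <= ip.
Proof.
move=> hx; have l0 : (0 < l)%N by apply: leq_ltn_trans (ltn_ord n).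
have x1 := unr_le1 O_unr hx.
rewrite /ghost (bigD1 (Ordinal l0)) //= mul1r subn0 addrAC absD_le //.
  apply: abs_exp_sub_le; rewrite ?phi_le1 //.
  by apply/congv_p => //; apply: (iso_residue phi_iso hx).
apply: abs_sum_le => [|i /andP[_ i0]]; first exact: ip_ge0.
have [k E] : exists k, val i = k.+1.
  case E : (val i) => [|k]; last by exists k.
  by move: i0; rewrite -(inj_eq val_inj) /= E.
rewrite /= in E; rewrite E exprS -mulrA mulrC absM_le1 ?abs_p //.
by rewrite absM_le1 ?absX_le1 ?abs_nat_le1 ?phi_le1.
Qed.

(** On a Teichmueller representative this ring morphism is the n-th power of
    Frobenius: it is so modulo p, and the two values are fixed by x |-> x^(p^m),
    the first one modulo p^(n+1), so raising them to the power p^(m n) improves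
    the congruence. *)
Lemma witt_teich n s : O s -> s ^+ (p ^ m) = s ->
  abs (w n s - s ^+ (p ^ n)) <= ip ^+ n.+1.
Proof.
move=> hs sm; have s1 := unr_le1 O_unr hs.
have wX := wittX n (p ^ (m * n)) hs; rewrite (exp_expX_fix _ sm) in wX.
apply: abs_sub_le wX _.
have E : s ^+ (p ^ n) = (s ^+ (p ^ n)) ^+ (p ^ (m * n)).
  by rewrite -exprM mulnC exprM (exp_expX_fix _ sm).
rewrite E; apply: le_trans (abs_exppX_sub_le (k := 0) p_prime _ _ _ _) _.
- by apply: ghost_le1 => i; apply: phi_le1.
- exact: absX_le1.
- exact: witt_residue.
- by rewrite ipX_le // ltnS add0n leq_pmull.
Qed.

(** The p^j-th root of s when s^(p^m) = s. *)
Definition teich_root (j : nat) s := s ^+ (p ^ (j * m.-1)).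

Lemma teich_rootK (j : nat) s : s ^+ (p ^ m) = s -> teich_root j s ^+ (p ^ j) = s.
Proof.
move=> sm; rewrite -exprM -expnD -mulnSr prednK //.
by rewrite mulnC exp_expX_fix.
Qed.

Definition teich_sum (a : 'I_l -> K) : K := \sum_(j < l) p%:R ^+ j * teich_root j (a j).

Section Teichmullers.
Variable a : 'I_l -> K.
Hypotheses (aO : forall j, O (a j)) (am : forall j, a j ^+ (p ^ m) = a j).

Let rootO j : O (teich_root j (a j)). Proof. exact: (unr_X O_unr). Qed.

Let rootm j : teich_root j (a j) ^+ (p ^ m) = teich_root j (a j).
Proof. by rewrite -exprM mulnC exprM am. Qed.

Lemma teich_sumO : O (teich_sum a).
Proof.
apply: (unr_sum O_unr) => j _; rewrite -natrX mulr_natl; exact: (unr_Mn O_unr).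
Qed.

(** The n-th ghost component of the left side is the image of a sum under a ring
    morphism known on each term, and equals that of the vector a. *)
Lemma phi_teich_sum i : abs (phi (teich_sum a) i - a i) <= ip.
Proof.
move: i; apply: congr_of_ghost => [i|i|n].
- exact/phi_le1/teich_sumO.
- exact: (unr_le1 O_unr (aO i)).
rewrite /teich_sum; have O1 (j : 'I_l) : O (p%:R ^+ j * teich_root j (a j)).
  by rewrite -natrX mulr_natl; exact: (unr_Mn O_unr).
apply: abs_sub_le (witt_sum n _ O1) _.
rewrite {2}/ghost [X in _ - X]big_mkcond -sumrB.
apply: abs_sum_le => [|j _]; first exact: ipX_ge0.
have h : abs (w n (p%:R ^+ j * teich_root j (a j)) -
   p%:R ^+ j * teich_root j (a j) ^+ (p ^ n)) <= ip ^+ n.+1.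
  rewrite -natrX !mulr_natl; apply: abs_sub_le (wittMn n _ (rootO j)) _.
  rewrite -mulrnBl -[_ *+ (p ^ j)]mulr_natl absM_le1 ?abs_nat_le1 //.
  exact: witt_teich.
case: leqP => [jn|nj].
  have -> : a j ^+ (p ^ (n - j)) = teich_root j (a j) ^+ (p ^ n).
    by rewrite -{1}(teich_rootK j (am j)) -exprM -expnD subnKC.
  exact: h.
rewrite subr0 -(subrK (p%:R ^+ j * teich_root j (a j) ^+ (p ^ n)) (w n _)).
apply: absD_le h _; rewrite mulrC absM_le1 //.
  by apply: absX_le1; apply: (unr_le1 O_unr (rootO j)).
by rewrite abs_pX ipX_le.
Qed.

(** By injectivity of phi, x is congruent to the sum of the p^j a_j^(p^(-j)) when
    the a_j represent its Witt components. *)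
Lemma teich_sum_congr x : O x -> (forall i, abs (phi x i - a i) <= ip) ->
  abs (x - teich_sum a) <= ip ^+ l.
Proof.
move=> hx h; apply/(congv_pX p_prime)/(iso_inj phi_iso hx teich_sumO) => i.
apply/congv_p => //; apply: abs_sub_le (h i) _.
by rewrite abs_subC phi_teich_sum.
Qed.

End Teichmullers.

Lemma teich_spec x : O x ->
  [/\ O (teich m O x), teich m O x ^+ (p ^ m) = teich m O x & abs (x - teich m O x) <= ip].
Proof.
move=> hx; have [s [hs sm xs]] := unr_teich O_unr hx.
have ex : exists t, [/\ O t, t ^+ (p ^ m) = t & t == x %[vmod p%:R]].
  by exists s; split=> //; apply/congv_p => //; rewrite abs_subC.
have [h1 h2 /(congv_p p_prime) h3] := xgetPex 0 ex.
by split=> //; rewrite abs_subC.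
Qed.

Section Frobenius.
Variable x : K.
Hypothesis xO : O x.
Notation xh := (hat m O phi x).

Lemma hat_spec j : [/\ O (xh j), xh j ^+ (p ^ m) = xh j & abs (phi x j - xh j) <= ip].
Proof. by apply: teich_spec; apply: (iso_int phi_iso xO j). Qed.

Lemma hatX_spec j k : O (xh j ^+ k) /\ (xh j ^+ k) ^+ (p ^ m) = xh j ^+ k.
Proof.
have [h1 h2 _] := hat_spec j; split; first exact: (unr_X O_unr).
by rewrite -exprM mulnC exprM h2.
Qed.

End Frobenius.

Lemma frob_spec x : O x ->
  O (frob O phi x) /\ forall i, abs (phi (frob O phi x) i - phi x i ^+ p) <= ip.
Proof.
move=> hx; have h j := hatX_spec hx j p.
have ex : exists y, O y /\ forall i, phi y i == phi x i ^+ p %[vmod p%:R].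
  exists (teich_sum (fun j => hat m O phi x j ^+ p)); split.
    by apply: teich_sumO => j; have [] := h j.
  move=> i; apply/congv_p => //.
  apply: abs_sub_le (phi_teich_sum (fun j => (h j).1) (fun j => (h j).2) i) _.
  have [h1 _ h3] := hat_spec hx i.
  by rewrite abs_subC abs_exp_sub_le ?phi_le1 // (unr_le1 O_unr).
have [h1 h2] := xgetPex 0 ex; split=> // i; exact/congv_p.
Qed.

Lemma iter_frob_spec x k : O x -> O (iter k (frob O phi) x) /\
  forall i, abs (phi (iter k (frob O phi) x) i - hat m O phi x i ^+ (p ^ k)) <= ip.
Proof.
move=> hx; elim: k => [|k [IH1 IH2]] /=.
  by split=> // i; rewrite expr1; have [] := hat_spec hx i.
have [h1 h2] := frob_spec IH1; split=> // i; apply: abs_sub_le (h2 i) _.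
rewrite expnSr exprM abs_exp_sub_le ?phi_le1 //.
by apply: (unr_le1 O_unr); have [] := hatX_spec hx i (p ^ k).
Qed.

Lemma teich_trace_root (j : nat) s : s ^+ (p ^ m) = s ->
  teich_trace m (teich_root j s) = teich_trace m s.
Proof. exact: teich_trace_expX. Qed.

(** Frobenius raises the Teichmueller representatives of the Witt components to
    the power p, so the trace of the sum of the p^j a_j^(p^(-j)) is the sum of the
    p^j Tr(a_j), an element of Z_p. *)
Lemma trace_spec x : O x -> padic_int K (trace m O phi x) /\
  abs (trace m O phi x - \sum_(j < l) p%:R ^+ j * teich_trace m (hat m O phi x j)) <= ip ^+ l.
Proof.
move=> hx; set S := \sum_(j < l) _.
have h k j := hatX_spec hx j (p ^ k).
have hS : abs (S - \sum_(i < m) iter i (frob O phi) x) <= ip ^+ l.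
  have -> : S = \sum_(i < m) teich_sum (fun j => hat m O phi x j ^+ (p ^ i)).
    rewrite exchange_big; apply: eq_bigr => j _; rewrite -mulr_sumr; congr (_ * _).
    have [_ hj _] := hat_spec hx j.
    rewrite -(teich_trace_root j hj); apply: eq_bigr => i _.
    by rewrite /teich_root -!exprM mulnC.
  rewrite -sumrB; apply: abs_sum_le => [|i _]; first exact: ipX_ge0.
  have [h1 h2] := iter_frob_spec i hx.
  by rewrite abs_subC; apply: teich_sum_congr => // j; have [] := h i j.
have Zp := padic_int_unramified K p_prime 1.
have ex : exists y, padic_int K y /\
    y == \sum_(i < m) iter i (frob O phi) x %[vmod p%:R ^+ l].
  exists S; split; last exact/congv_pX.
  apply: (unr_sum Zp) => j _; have [_ hj _] := hat_spec hx j.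
  apply: (unr_M Zp); last exact: trace_padic_int hj.
  exact/(unr_X Zp)/padic_int_nat.
have [h1 /(congv_pX p_prime) h2] := xgetPex 0 ex; split=> //.
by apply: abs_sub_le h2 _; rewrite abs_subC.
Qed.

End WittVectors.

(** * The ring of formal power series *)

(** A name of its own for nat -> A, where the product is the product of series
    and not the pointwise one. *)
Definition fps (A : comNzRingType) : Type := nat -> A.

Section PowerSeriesRing.
Variable A : comNzRingType.

HB.instance Definition _ := GRing.Zmodule.copy (fps A) (nat -> A).

Implicit Types (f g h : fps A) (P Q : {poly A}) (n k N : nat).

Definition fpsM f g : fps A := fun n => \sum_(i < n.+1) f i * g (n - i)%N.
Definition fps1 : fps A := fun n => (n == 0%N)%:R.

(** The ring laws are inherited from polynomials, as they involve finitely many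
    coefficients at a time. *)
Definition agree N f P := forall i, (i < N)%N -> f i = P`_i.

Definition trunc N f := \poly_(i < N) f i.

Lemma agree_trunc N f : agree N f (trunc N f).
Proof. by move=> i iN; rewrite coef_poly iN. Qed.

Lemma agreeM N f g P Q : agree N f P -> agree N g Q -> agree N (fpsM f g) (P * Q).
Proof.
move=> fP gQ i iN; rewrite coefM; apply: eq_bigr => j _.
rewrite fP ?gQ //; last by apply: leq_ltn_trans iN; rewrite -ltnS.
exact: leq_ltn_trans (leq_subr _ _) iN.
Qed.

Lemma agree_eq f g : (forall N, exists2 P, agree N f P & agree N g P) -> f = g.
Proof. by move=> h; apply/funext => n; have [P -> // ->] := h n.+1. Qed.

Lemma fpsMA : associative fpsM.
Proof.
move=> f g h; apply: agree_eq => N.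
exists (trunc N f * (trunc N g * trunc N h)).
  by do 2?apply: agreeM; apply: agree_trunc.
by rewrite mulrA; do 2?apply: agreeM; apply: agree_trunc.
Qed.

Lemma fpsMC : commutative fpsM.
Proof.
move=> f g; apply: agree_eq => N; exists (trunc N f * trunc N g).
  by apply: agreeM; apply: agree_trunc.
by rewrite mulrC; apply: agreeM; apply: agree_trunc.
Qed.

Lemma fpsM1 : left_id fps1 fpsM.
Proof.
move=> f; apply: agree_eq => N; exists (1 * trunc N f); last first.
  by rewrite mul1r; apply: agree_trunc.
by apply: agreeM; [move=> i _; rewrite coef1|apply: agree_trunc].
Qed.

Lemma fpsMD : left_distributive fpsM +%R.
Proof.
move=> f g h; apply/funext => n.
transitivity (fpsM f h n + fpsM g h n); last by [].
rewrite /fpsM -big_split /=.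
by apply: eq_bigr => i _; rewrite -mulrDl.
Qed.

Lemma fps1_neq0 : fps1 != 0.
Proof.
by apply/eqP => /(congr1 (fun f : fps A => f 0%N))/eqP; rewrite /fps1 eqxx oner_eq0.
Qed.

HB.instance Definition _ :=
  GRing.Zmodule_isComNzRing.Build (fps A) fpsMA fpsMC fpsM1 fpsMD fps1_neq0.

Lemma fpsME f g n : (f * g) n = \sum_(i < n.+1) f i * g (n - i)%N.
Proof. by []. Qed.

Lemma fps1E n : (1 : fps A) n = (n == 0%N)%:R.
Proof. by []. Qed.

Lemma fpsDE f g n : (f + g) n = f n + g n.
Proof. by []. Qed.

Lemma fpsBE f g n : (f - g) n = f n - g n.
Proof. by []. Qed.

Lemma fps_sumE (I : Type) (r : seq I) (P : pred I) (F : I -> fps A) n :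
  (\sum_(i <- r | P i) F i) n = \sum_(i <- r | P i) F i n.
Proof. by elim/big_rec2: _ => // i x y _ <-. Qed.

Lemma fpsMnE f k n : (f *+ k) n = f n *+ k.
Proof. by elim: k => [|k IH]; rewrite ?mulr0n // !mulrS fpsDE IH. Qed.

Lemma fps_coef0M f g : (f * g) 0%N = f 0%N * g 0%N.
Proof. by rewrite fpsME big_ord1. Qed.

Lemma fps_coef0X f k : (f ^+ k) 0%N = f 0%N ^+ k.
Proof. by elim: k => [|k IH]; rewrite ?expr0 // !exprS fps_coef0M IH. Qed.

Lemma agree_exp N f P k : agree N f P -> agree N (f ^+ k) (P ^+ k).
Proof.
move=> fP; elim: k => [|k IH]; first by move=> i _; rewrite expr0 coef1.
by rewrite !exprS; apply: agreeM.
Qed.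

Lemma fps_exp_low f k n : f 0%N = 0 -> (n < k)%N -> (f ^+ k) n = 0.
Proof.
move=> f0; elim: k n => // k IH n nk; rewrite exprS fpsME big1 // => i _.
have [->|i0] := eqVneq (i : nat) 0%N; first by rewrite f0 mul0r.
rewrite IH ?mulr0 // -ltnS; apply: leq_trans nk.
rewrite ltnS; case: n i i0 => [|n] i i0; last by rewrite ltn_subrL lt0n i0.
by have := ltn_ord i; case: (i : nat) i0.
Qed.

(** The substitution of tX for X. *)
Definition fps_scale (t : A) f : fps A := fun n => t ^+ n * f n.

Lemma fps_scaleM t f g : fps_scale t (f * g) = fps_scale t f * fps_scale t g.
Proof.
apply/funext => n; rewrite /fps_scale !fpsME mulr_sumr; apply: eq_bigr => i _.
by rewrite mulrACA -exprD subnKC // -ltnS.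
Qed.

Lemma fps_scaleX t f k : fps_scale t (f ^+ k) = fps_scale t f ^+ k.
Proof.
elim: k => [|k IH]; last by rewrite !exprS fps_scaleM IH.
apply/funext => n; rewrite /fps_scale expr0 fps1E.
by case: n => [|n]; rewrite ?mulr0 // mul1r.
Qed.

(** The substitution of X^d for X. *)
Definition fps_subX (d : nat) f : fps A :=
  fun n => if (d %| n)%N then f (n %/ d)%N else 0.

Lemma agree_subX d N f P : (0 < d)%N -> agree N f P -> agree N (fps_subX d f) (P \Po 'X^d).
Proof.
move=> d0 fP i iN; rewrite /fps_subX coef_comp_poly_Xn //; case: ifP => // _.
by rewrite fP // (leq_ltn_trans (leq_div _ _)).
Qed.

Lemma fps_subXM d f g : (0 < d)%N -> fps_subX d (f * g) = fps_subX d f * fps_subX d g.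
Proof.
move=> d0; apply: agree_eq => N; exists ((trunc N f * trunc N g) \Po 'X^d).
  by apply: agree_subX => //; apply: agreeM; apply: agree_trunc.
by rewrite comp_polyM; apply: agreeM; apply: agree_subX => //; apply: agree_trunc.
Qed.

Lemma fps_subXX d f k : (0 < d)%N -> fps_subX d (f ^+ k) = fps_subX d f ^+ k.
Proof.
move=> d0; elim: k => [|k IH]; last by rewrite !exprS fps_subXM // IH.
apply/funext => n; rewrite !expr0 /fps_subX !fps1E; case: ifP => dn; last first.
  by case: n dn => //; rewrite dvdn0.
by rewrite -[in RHS](divnK dn) muln_eq0 (gtn_eqF d0) orbF.
Qed.

Definition fps_deriv f : fps A := fun n => f n.+1 *+ n.+1.

Lemma fps_derivM f g : fps_deriv (f * g) = fps_deriv f * g + f * fps_deriv g.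
Proof.
have agD N h : agree N (fps_deriv h) (trunc N.+1 h)^`().
  by move=> i iN; rewrite coef_deriv coef_poly ltnS iN.
have agT N h : agree N h (trunc N.+1 h).
  by move=> i iN; apply: agree_trunc; apply: ltnW.
apply: agree_eq => N; exists (trunc N.+1 f * trunc N.+1 g)^`().
  move=> i iN; rewrite coef_deriv /fps_deriv; congr (_ *+ _).
  by apply: (agreeM (N := N.+1)) => //; apply: agree_trunc.
move=> i iN; rewrite derivM coefD fpsDE; congr (_ + _).
  exact: (agreeM (agD N f) (agT N g)) iN.
exact: (agreeM (agT N f) (agD N g)) iN.
Qed.

Lemma fps_derivX f k : fps_deriv (f ^+ k.+1) = (f ^+ k * fps_deriv f) *+ k.+1.
Proof.
elim: k => [|k IH]; first by rewrite mul1r.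
rewrite exprS fps_derivM IH mulrnAr mulrA -exprS [X in X + _]mulrC.
by rewrite -mulrS.
Qed.

End PowerSeriesRing.

(** * The exponential of a power series *)

Section Exponential.
Variables (R : realType) (p : nat) (K : cpType R p).
Hypothesis p_prime : prime p.
Implicit Types (f g : fps K) (z t : K) (n k N : nat).
Notation ip := (p%:R^-1 : R).

Lemma fps_exprnE f k : fps_exprn f k = f ^+ k.
Proof. by elim: k => [|k IH] //=; rewrite exprS -IH. Qed.

(** The powers of f of exponents larger than n do not contribute in degree n, so
    the exponential can be truncated at any order N >= n. *)
Lemma fps_exp_coef f n N : f 0%N = 0 -> (n <= N)%N ->
  fps_exp f n = \sum_(k < N.+1) (f ^+ k) n / k`!%:R.
Proof.
move=> f0 nN; rewrite -(subnKC nN) -addSn big_split_ord /= [X in _ + X]big1 ?addr0.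
  by apply: eq_bigr => k _; rewrite fps_exprnE.
by move=> k _; rewrite fps_exp_low ?mul0r // addSn ltnS leq_addr.
Qed.

Lemma fps_exp0 f : f 0%N = 0 -> fps_exp f 0%N = 1.
Proof. by move=> f0; rewrite /fps_exp big_ord1 /= fact0 divr1. Qed.

(** The exponential is characterised by a first-order linear differential
    equation, which makes its functional equations formal. *)
Lemma fps_deriv_exp f : f 0%N = 0 ->
  fps_deriv (fps_exp f : fps K) = fps_deriv f * (fps_exp f : fps K).
Proof.
move=> f0; apply/funext => n; rewrite fpsME /fps_deriv.
rewrite (fps_exp_coef (N := n.+1)) // big_ord_recl expr0 fps1E mul0r add0r -sumrMnl.
transitivity (\sum_(k < n.+1) (fps_deriv f * f ^+ k) n / k`!%:R).
  apply: eq_bigr => k _; rewrite lift0 -mulrnAl.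
  have -> : (f ^+ k.+1) n.+1 *+ n.+1 = (fps_deriv f * f ^+ k) n *+ k.+1.
    by rewrite -[RHS]fpsMnE [X in X *+ k.+1]mulrC -fps_derivX.
  rewrite factS natrM invfM mulrA; congr (_ / _).
  by rewrite -(mulr_natr ((fps_deriv f * f ^+ k) n)) mulfK // natK_neq0.
under eq_bigr do rewrite fpsME mulr_suml.
rewrite exchange_big; apply: eq_bigr => i _ /=.
rewrite (fps_exp_coef (N := n)) // ?leq_subr // mulr_sumr.
by apply: eq_bigr => k _; rewrite mulrA.
Qed.

Lemma fps_ode_unique (a f g : fps K) : f 0%N = g 0%N ->
  fps_deriv f = a * f -> fps_deriv g = a * g -> f = g.
Proof.
move=> fg0 hf hg; apply/funext => n; elim/ltn_ind: n => -[|n] IH //.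
have n0 : (n.+1%:R : K) != 0 by apply: natK_neq0.
apply: (mulIf n0); rewrite !mulr_natr.
have -> : f n.+1 *+ n.+1 = (a * f) n by rewrite -hf.
have -> : g n.+1 *+ n.+1 = (a * g) n by rewrite -hg.
by rewrite !fpsME; apply: eq_bigr => i _; rewrite IH // ltnS leq_subr.
Qed.

Lemma fps_expD f g : f 0%N = 0 -> g 0%N = 0 ->
  fps_exp (f + g) = (fps_exp f : fps K) * (fps_exp g : fps K).
Proof.
move=> f0 g0; have fg0 : (f + g) 0%N = 0 by rewrite fpsDE f0 g0 addr0.
apply: (fps_ode_unique (a := fps_deriv (f + g))).
- by rewrite fps_coef0M !fps_exp0 // mulr1.
- exact: fps_deriv_exp.
have -> : fps_deriv (f + g) = fps_deriv f + fps_deriv g.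
  by apply/funext => n; rewrite fpsDE /fps_deriv fpsDE mulrnDl.
rewrite fps_derivM !fps_deriv_exp //.
set a := (fps_exp f : fps K); set b := (fps_exp g : fps K). ring.
Qed.

Lemma fps_exp_zero : fps_exp (0 : fps K) = (1 : fps K).
Proof.
apply/funext => n; rewrite (fps_exp_coef (N := n)) // big_ord_recl.
rewrite expr0 fact0 divr1 big1 ?addr0 // => k _.
by rewrite expr0n mul0r.
Qed.

Lemma fps_exp_sum (I : Type) (r : seq I) (F : I -> fps K) :
  (forall i, F i 0%N = 0) ->
  fps_exp (\sum_(i <- r) F i) = \prod_(i <- r) (fps_exp (F i) : fps K).
Proof.
move=> F0; elim: r => [|i r IH]; first by rewrite !big_nil fps_exp_zero.
by rewrite !big_cons fps_expD ?IH // fps_sumE big1.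
Qed.

Lemma fps_expMn f k : f 0%N = 0 -> fps_exp (f *+ k) = (fps_exp f : fps K) ^+ k.
Proof.
by move=> f0; rewrite -[k]card_ord -sumr_const fps_exp_sum // prodr_const.
Qed.

Lemma fps_exp_scale t f : fps_exp (fps_scale t f) = fps_scale t (fps_exp f).
Proof.
apply/funext => n; rewrite /fps_scale /fps_exp mulr_sumr; apply: eq_bigr => k _.
by rewrite (fps_exprnE (fps_scale t f)) -fps_scaleX -fps_exprnE mulrA.
Qed.

Lemma fps_exp_subX d f : (0 < d)%N -> f 0%N = 0 ->
  fps_exp (fps_subX d f) = fps_subX d (fps_exp f).
Proof.
move=> d0 f0; apply/funext => n; rewrite (fps_exp_coef (N := n)) //; last first.
  by rewrite /fps_subX dvdn0 div0n.
under eq_bigr do rewrite -fps_subXX //.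
rewrite /fps_subX; case: ifP => _; last by rewrite big1 // => k _; rewrite mul0r.
by rewrite [RHS](fps_exp_coef (N := n)) // leq_div.
Qed.

Definition fps_cmul z f : fps K := fun n => z * f n.

Lemma fps_cmulX z f k n : (fps_cmul z f ^+ k) n = z ^+ k * (f ^+ k) n.
Proof.
elim: k n => [|k IH] n; first by rewrite !expr0 mul1r.
rewrite !exprS !fpsME mulr_sumr; apply: eq_bigr => i _.
by rewrite IH mulrACA.
Qed.

Lemma fps_cmul_nat k f : fps_cmul k%:R f = f *+ k.
Proof. by apply/funext => n; rewrite fpsMnE /fps_cmul mulr_natl. Qed.

(** * Integrality of the Artin-Hasse exponential *)

(** By Legendre's formula, as the sum of the floors of n/p^k for 0 < k <= N is at
    most n minus the floor of n/p^N, here with p^N <= n < p^(N+1). *)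
Lemma logn_fact_lt n : (0 < n)%N -> (logn p n`! < n)%N.
Proof.
move=> n0; rewrite logn_fact //.
have p2 := prime_gt1 p_prime.
have h N : (\sum_(1 <= k < N.+1) n %/ p ^ k + n %/ p ^ N <= n)%N.
  elim: N => [|N IH]; first by rewrite big_geq // expn0 divn1.
  rewrite big_nat_recr //= -addnA; apply: leq_trans IH.
  rewrite leq_add2l addnn -muln2 expnSr divnMA.
  by apply: leq_trans (leq_trunc_div _ p); rewrite leq_mul2l p2 orbT.
set N := trunc_log p n.
have Nn : (N <= n)%N.
  by apply: ltnW; apply: leq_trans (ltn_expl N p2) _; apply: trunc_logP.
rewrite (big_cat_nat _ (n := N.+1)) //= [X in (_ + X)%N]big1_seq ?addn0; last first.
  move=> k; rewrite mem_index_iota => /andP[_ /andP[Nk _]]; apply: divn_small.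
  by apply: leq_trans (trunc_log_ltn n p2) _; rewrite leq_exp2l.
apply: leq_trans (h N); rewrite -addn1 leq_add2l divn_gt0 ?expn_gt0 ?prime_gt0 //.
exact: trunc_logP.
Qed.

Lemma abs_fact k : abs (k`!%:R : K) = ip ^+ logn p k`!.
Proof. exact/abs_nat/fact_gt0. Qed.

Lemma abs_pX_fact k : (0 < k)%N -> abs (p%:R ^+ k / k`!%:R : K) <= ip.
Proof.
move=> k0; rewrite absM absV abs_fact abs_pX ler_pdivrMr ?ipX_gt0 //.
by rewrite -exprS ipX_le // logn_fact_lt.
Qed.

Definition fps_pX : fps K := fun n => if n == 1%N then p%:R else 0.

Lemma exp_pX_coef n : fps_exp fps_pX n = p%:R ^+ n / n`!%:R.
Proof.
have E k : (fps_pX ^+ k) n = if n == k then p%:R ^+ k else 0.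
  elim: k n => [|k IH] n; first by rewrite !expr0 fps1E; case: n.
  rewrite exprS fpsME; case: n => [|n].
    by rewrite big_ord1 /fps_pX /= mul0r.
  rewrite 2!big_ord_recl /= {1 2}/fps_pX /= mul0r add0r subSS subn0 IH big1 ?addr0 //.
    by rewrite eqSS exprS; case: ifP => _; rewrite ?mulr0.
  by move=> i _; rewrite /fps_pX mul0r.
rewrite (fps_exp_coef (N := n)) // big_ord_recr /= E eqxx big1 ?add0r // => k _.
by rewrite E gtn_eqF ?mul0r.
Qed.

Lemma AHE n : (AH n : K) = if n == (p ^ logn p n)%N then n%:R^-1 else 0.
Proof.
rewrite /AH; case: eqP => [E|nE]; last first.
  by apply: big1 => i /eqP E; case: nE; rewrite -E pfactorK.
have ln : (logn p n < n.+1)%N.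
  by rewrite ltnS {2}E; apply/ltnW/ltn_expl/prime_gt1.
rewrite (big_pred1 (Ordinal ln)) => [|i /=]; first by rewrite /= -E.
apply/eqP/eqP => [E'|-> //]; apply/val_inj => /=.
by move/(congr1 (logn p)): E'; rewrite pfactorK.
Qed.

Lemma AH_coef0 : (AH 0%N : K) = 0.
Proof. by rewrite AHE logn0. Qed.

Lemma AH_pX i : (AH (p ^ i)%N : K) = (p ^ i)%:R^-1.
Proof. by rewrite AHE pfactorK ?eqxx. Qed.

(** Both sides have the coefficient p / p^j in degree p^j; for j = 0 it comes from
    the term pX. *)
Lemma AH_functional : (AH : fps K) *+ p = fps_subX p (AH : fps K) + fps_pX.
Proof.
have p0 := prime_gt0 p_prime.
apply/funext => n; rewrite fpsMnE fpsDE /fps_subX /fps_pX.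
case: (posnP n) => [->|n0]; first by rewrite dvdn0 div0n AH_coef0 mul0rn addr0.
case: ifP => [/dvdnP[k E]|pn].
  move: n0; rewrite E muln_gt0 => /andP[k0 _]; rewrite mulnK // !AHE.
  have -> : logn p (k * p) = (logn p k).+1.
    by have := pfactorK 1 p_prime; rewrite lognM // expn1 => ->; rewrite addn1.
  rewrite expnSr eqn_pmul2r //.
  have -> : (k * p == 1)%N = false by rewrite muln_eq1 (gtn_eqF (prime_gt1 p_prime)) andbF.
  rewrite addr0; case: ifP => _; last by rewrite mul0rn.
  by rewrite natrM invfM -(mulr_natr (_ / p%:R)) divfK // pK_neq0.
rewrite add0r AHE lognE p_prime n0 pn expn0 /=.
by case: eqP => [->|_]; rewrite ?mul0rn // invr1.
Qed.

Lemma E_functional : (E : fps K) ^+ p = fps_subX p (E : fps K) * (fps_exp fps_pX : fps K).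
Proof.
rewrite -fps_expMn ?AH_coef0 // AH_functional fps_expD //.
  by rewrite fps_exp_subX ?prime_gt0 // AH_coef0.
by rewrite /fps_subX dvdn0 div0n AH_coef0.
Qed.

Lemma fps_exp_subfield (L : set K) f : subfield L -> (forall n, L (f n)) ->
  forall n, L (fps_exp f n).
Proof.
move=> Lf Lfn n; have h j i : L (fps_exprn f j i).
  elim: j i => [|j IH] i; first exact: subfield_nat.
  by apply: subfield_sum => // u _; apply: (subfieldM Lf).
by apply: subfield_sum => // k _; apply: (subfield_div Lf) => //; apply: subfield_nat.
Qed.

Lemma E_subfield (L : set K) : subfield L -> forall n, L (E n).
Proof.
move=> Lf; apply: fps_exp_subfield => // n.
by apply: subfield_sum => // i _; apply: (subfieldV Lf); apply: subfield_nat.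
Qed.

Lemma fpsM_bound f g (a b : R) n : 0 <= a -> 0 <= b ->
  (forall i, (i <= n)%N -> abs (f i) <= a) -> (forall i, (i <= n)%N -> abs (g i) <= b) ->
  abs ((f * g) n) <= a * b.
Proof.
move=> a0 b0 fa gb; rewrite fpsME; apply: abs_sum_le => [|i _]; first exact: mulr_ge0.
by rewrite absM ler_pM ?abs_ge0 ?fa ?gb ?leq_subr // -ltnS.
Qed.

Lemma fpsX_le1 f k : (forall i, abs (f i) <= 1) -> forall n, abs ((f ^+ k) n) <= 1.
Proof.
move=> f1; elim: k => [|k IH] n; first by rewrite expr0 fps1E abs_nat_le1.
by rewrite exprS -(mulr1 1); apply: fpsM_bound.
Qed.

Lemma fpsX_congr f g k : (forall i, abs (f i) <= 1) -> (forall i, abs (g i) <= 1) ->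
  (forall i, abs (f i - g i) <= ip) -> forall n, abs ((f ^+ k) n - (g ^+ k) n) <= ip.
Proof.
move=> f1 g1 fg n; rewrite -fpsBE subrXX -(mulr1 ip).
apply: fpsM_bound => [||i _|i _]; rewrite ?ip_ge0 ?ler01 //; first exact: fg.
rewrite fps_sumE; apply: abs_sum_le => // j _.
by rewrite -(mulr1 1); apply: fpsM_bound => // u _; apply: fpsX_le1.
Qed.

Definition fps_of_poly (P : {poly int}) : fps K := fun n => (P`_n)%:~R.

Lemma fps_of_polyX P k : fps_of_poly P ^+ k = fps_of_poly (P ^+ k).
Proof.
apply: agree_eq => N; exists (map_poly intr (P ^+ k)).
  rewrite rmorphXn /=; apply: agree_exp => i _; by rewrite coef_map.
by move=> i _; rewrite coef_map.
Qed.

Lemma padic_near_int y : padic_int K y -> exists n : int, abs (y - n%:~R) <= ip.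
Proof.
move=> /(padic_intP p_prime)/Zclos1_int/(_ _ (ip_gt0 R p_prime))[n /ltW hn].
by exists n.
Qed.

(** Replacing the coefficients by integers congruent to them modulo p reduces the
    congruence to polynomials with integer coefficients. *)
Lemma fps_frob f : (forall i, padic_int K (f i)) ->
  forall n, abs ((f ^+ p) n - fps_subX p f n) <= ip.
Proof.
move=> fZ n; have p0 := prime_gt0 p_prime.
have [a fa] : {a : nat -> int & forall i, abs (f i - (a i)%:~R) <= ip}.
  apply: (@boolp.choice nat int (fun i u => abs (f i - u%:~R) <= ip)) => i.
  exact: padic_near_int.
pose P := \poly_(i < n.+1) a i.
pose f' : fps K := fun i => if (i < n.+1)%N then f i else 0.
have f1 i : abs (f' i) <= 1 by rewrite /f'; case: ifP => _; [case: (fZ i)|rewrite abs0 ler01].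
have P1 i : abs (fps_of_poly P i) <= 1 by apply: abs_int_le1.
have f'P i : abs (f' i - fps_of_poly P i) <= ip.
  rewrite /f' /fps_of_poly coef_poly; case: ifP => _ //.
  by rewrite subr0 abs0 ip_ge0.
have [h hP] := polyZ_frob p_prime P 1; rewrite !expn1 in hP.
have E1 : (f ^+ p) n = (f' ^+ p) n.
  have h1 : agree n.+1 f (trunc n.+1 f) by apply: agree_trunc.
  have h2 : agree n.+1 f' (trunc n.+1 f) by move=> i ni; rewrite /f' ni h1.
  by rewrite (agree_exp p h1) // (agree_exp p h2).
rewrite E1; apply: (abs_sub_le (y := (fps_of_poly P ^+ p) n)).
  exact: fpsX_congr.
rewrite fps_of_polyX hP /fps_of_poly coefD coefZ coef_comp_poly_Xn // rmorphD rmorphM /=.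
rewrite addrAC absD_le // -?pmulrn.
  rewrite /fps_subX; case: ifP => _; last by rewrite subr0 abs0 ip_ge0.
  rewrite coef_poly ltnS leq_div; rewrite abs_subC; exact: fa.
by rewrite mulrC absM_le1 ?abs_int_le1 ?abs_p.
Qed.

Lemma E_coef0 : (E 0%N : K) = 1.
Proof. by rewrite /E fps_exp0 ?AH_coef0. Qed.

(** Dwork's congruence. Let P be E truncated before the degree n. In degree n,
    E^p exceeds P^p by p E_n, and P^p agrees modulo p with P(X^p), that is, with
    E(X^p); on the other hand E^p = E(X^p) exp(pX) agrees with E(X^p) modulo p. Hence p E_n is
    divisible by p. *)
Lemma E_padic_int n : padic_int K (E n).
Proof.
have p0 := prime_gt0 p_prime.
have one_fix : (1 : K) ^+ (p ^ 1) = 1 by apply: expr1n.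
suff E1 : abs (E n : K) <= 1.
  apply/(padic_intP p_prime)/(Zfrac_Zclos p_prime _ one_fix) => //.
  by apply: E_subfield; apply: (Zfrac_subfield p_prime _ one_fix).
elim/ltn_ind: n => -[|n] IH; first by rewrite E_coef0 abs1.
have IHZ i : (i < n.+1)%N -> padic_int K (E i).
  move=> /IH E1; apply/(padic_intP p_prime)/(Zfrac_Zclos p_prime _ one_fix) => //.
  by apply: E_subfield; apply: (Zfrac_subfield p_prime _ one_fix).
pose P : fps K := fun i => if (i < n.+1)%N then E i else 0.
have PZ i : padic_int K (P i).
  by rewrite /P; case: ifP => [/IHZ|_] //; apply: (padic_int_nat _ p_prime 0).
have Psub : fps_subX p P n.+1 = fps_subX p (E : fps K) n.+1.
  rewrite /fps_subX /P; case: ifP => // _; rewrite ifT //.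
  by rewrite ltn_Pdiv // prime_gt1.
have h1 := fps_frob PZ n.+1; rewrite Psub in h1.
have h2 : abs (((E : fps K) ^+ p) n.+1 - fps_subX p (E : fps K) n.+1) <= ip.
  rewrite E_functional fpsME big_ord_recr /= subnn exp_pX_coef expr0 fact0 divr1 mulr1 addrK.
  apply: abs_sum_le => [|i _]; first exact: ip_ge0.
  rewrite mulrC mulrC absM_le1 //.
    rewrite /fps_subX; case: ifP => _; last by rewrite abs0 ler01.
    by apply: IH; rewrite (leq_ltn_trans (leq_div _ _)).
  by rewrite exp_pX_coef abs_pX_fact // subn_gt0.
have E3 : ((E : fps K) ^+ p) n.+1 - (P ^+ p) n.+1 = E n.+1 * p%:R.
  rewrite -fpsBE subrXX fpsME big_ord_recr /= big1 ?add0r => [|i _]; last first.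
    by rewrite fpsBE /P ltn_ord subrr mul0r.
  rewrite fpsBE {1}/P ltnn subr0 subnn fps_sumE; congr (_ * _).
  transitivity (\sum_(i < p) (1 : K)); last by rewrite sumr_const card_ord.
  apply: eq_bigr => i _.
  by rewrite fps_coef0M !fps_coef0X /P /= E_coef0 !expr1n mulr1.
have : abs (E n.+1 * p%:R : K) <= ip.
  by rewrite -E3; apply: abs_sub_le h2 _; rewrite abs_subC.
by rewrite absM abs_p ger_pMl ?ip_gt0.
Qed.

End Exponential.

(** * Values of power series *)

Section Evaluation.
Variables (R : realType) (p : nat) (K : cpType R p).
Hypothesis p_prime : prime p.
Implicit Types (f g : fps K) (x z s t : K) (n k N : nat) (e : R).
Notation ip := (p%:R^-1 : R).

(** The value at 1. The value of f at x is the value at 1 of f(xX), which keeps x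
    out of the statements; f |-> f(xX) is a ring morphism. *)
Definition tsum f s := tends (fun N => \sum_(i < N) f i) s.

Lemma fps_sumsP f x s : fps_sums f x s <-> tsum (fps_scale x f) s.
Proof.
rewrite /fps_sums tendsP /tsum; split; apply: tends_eq => N.
  by rewrite /series /= big_mkord; apply: eq_bigr => i _; rewrite mulrC.
by rewrite /series /= big_mkord; apply: eq_bigr => i _; rewrite mulrC.
Qed.

Lemma tsum_unique f s t : tsum f s -> tsum f t -> s = t.
Proof. exact: tends_unique. Qed.

Lemma tsum_null f s : tsum f s ->
  forall e, 0 < e -> exists N, forall n, (N <= n)%N -> abs (f n) < e.
Proof.
move=> h e e0; have [N hN] := h _ e0; exists N => n Nn.
have := abs_sub_lt (hN n.+1 (leqW Nn)) (_ : abs (s - \sum_(i < n) f i) < e).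
by rewrite big_ord_recr /= addrAC subrr add0r; apply; rewrite abs_subC hN.
Qed.

Lemma null_tsum f : (forall e, 0 < e -> exists N, forall n, (N <= n)%N -> abs (f n) < e) ->
  exists s, tsum f s.
Proof.
move=> h; apply: cauchy_tends => e /h[N hN]; exists N => n Nn.
by rewrite big_ord_recr /= addrAC subrr add0r hN.
Qed.

Lemma tsum_bounded f s : tsum f s -> exists2 c, 0 < c & forall n, abs (f n) <= c.
Proof.
move=> /tsum_null/(_ _ ltr01)[N hN]; exists (1 + \sum_(i < N) abs (f i)).
  by rewrite ltr_wpDr // sumr_ge0 // => i _; apply: abs_ge0.
move=> n; case: (ltnP n N) => [nN|/hN/ltW h].
  rewrite (bigD1 (Ordinal nN)) //= addrCA lerDl addr_ge0 // sumr_ge0 // => i _.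
  exact: abs_ge0.
by apply: le_trans h _; rewrite lerDl sumr_ge0 // => i _; apply: abs_ge0.
Qed.

Lemma tsum_le f s e : 0 <= e -> (forall n, abs (f n) <= e) -> tsum f s -> abs s <= e.
Proof.
by move=> e0 fe; apply: tends_abs_le; exists 0%N => n _; apply: abs_sum_le.
Qed.

Lemma tsumD f g s t : tsum f s -> tsum g t -> tsum (f + g) (s + t).
Proof.
move=> fs gt; apply: tends_eq (tendsD fs gt) => N.
by rewrite -big_split.
Qed.

Lemma tsumB f g s t : tsum f s -> tsum g t -> tsum (f - g) (s - t).
Proof.
move=> fs gt; apply: tends_eq (tendsB fs gt) => N.
by rewrite -sumrB.
Qed.

Lemma tsumZ c f s : tsum f s -> tsum (fps_cmul c f) (c * s).
Proof.
move=> fs; apply: tends_eq (tendsM (tends_cst c) fs) => N.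
by rewrite mulr_sumr.
Qed.

Lemma tsum_sum (I : Type) (r : seq I) (F : I -> fps K) (u : I -> K) :
  (forall i, tsum (F i) (u i)) -> tsum (\sum_(i <- r) F i) (\sum_(i <- r) u i).
Proof.
move=> h; elim: r => [|i r IH]; last by rewrite !big_cons; apply: tsumD.
by rewrite !big_nil; apply: tends_eq (tends_cst 0) => N; rewrite big1.
Qed.

Lemma tsum1 : tsum 1 1.
Proof.
move=> e e0; exists 1%N => -[//|n] _.
by rewrite big_ord_recl fps1E big1 ?addr0 ?subrr ?abs0.
Qed.

(** The difference between the product of the partial sums F_N G_N and the
    partial sum of the product is the sum of the f_i (G_N - G_(N-i)), in which i
    is large or N - i is large. *)
Lemma tsumM f g s t : tsum f s -> tsum g t -> tsum (f * g) (s * t).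
Proof.
move=> fs gt; have [a a0 fa] := tsum_bounded fs.
pose G N := \sum_(i < N) g i.
have [b b0 Gb] : exists2 b, 0 < b & forall N, abs (G N) <= b.
  have [b b0 gb] := tsum_bounded gt; exists b => // N.
  by apply: abs_sum_le => // ; apply: ltW.
have E N : \sum_(n < N) (f * g) n = \sum_(i < N) f i * G (N - i)%N.
  elim: N => [|N IH]; first by rewrite !big_ord0.
  rewrite big_ord_recr /= IH fpsME !big_ord_recr /= subSnn subnn.
  rewrite {3}/G big_ord1 addrA -big_split /=; congr (_ + _); apply: eq_bigr => i _.
  by rewrite -mulrDr subSn 1?ltnW // /G big_ord_recr.
apply: tends_eq (_ : tends (fun N => (\sum_(i < N) f i) * G N -
    \sum_(i < N) f i * (G N - G (N - i)%N)) _) => [N|].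
  rewrite E mulr_suml -sumrB; apply: eq_bigr => i _.
  by rewrite mulrBr subKr.
rewrite -[s * t]subr0; apply: tendsB; first exact: tendsM.
move=> e e0.
have [N1 h1] := tsum_null fs (divr_gt0 e0 b0).
have [N2 h2] := gt _ (divr_gt0 e0 a0).
exists (N1 + N2)%N => n hn; rewrite subr0.
elim/big_ind: _ => [|u v|i _]; [by rewrite abs0|exact: absD_lt|].
rewrite absM; case: (leqP N1 i) => [/h1 fi|iN1].
  have Gd : abs (G n - G (n - i)%N) <= b by apply: absB_le.
  by apply: le_lt_trans (ler_wpM2l (abs_ge0 _) Gd) _; rewrite -ltr_pdivlMr.
have Gd : abs (G n - G (n - i)%N) < e / a.
  apply: (abs_sub_lt (y := t)); first by apply: h2; apply: leq_trans hn; apply: leq_addl.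
  rewrite abs_subC; apply: h2; rewrite leq_subRL ?(ltnW (ltn_ord i)) //.
  by apply: leq_trans hn; rewrite leq_add2r ltnW.
by apply: le_lt_trans (ler_wpM2r (abs_ge0 _) (fa i)) _; rewrite mulrC -ltr_pdivlMr.
Qed.

Lemma tsumX f s k : tsum f s -> tsum (f ^+ k) (s ^+ k).
Proof.
by move=> fs; elim: k => [|k IH]; [exact: tsum1|rewrite !exprS; apply: tsumM].
Qed.

Lemma tsum_prod (I : Type) (r : seq I) (F : I -> fps K) (u : I -> K) :
  (forall i, tsum (F i) (u i)) -> tsum (\prod_(i <- r) F i) (\prod_(i <- r) u i).
Proof.
move=> h; elim: r => [|i r IH]; last by rewrite !big_cons; apply: tsumM.
by rewrite !big_nil; apply: tsum1.
Qed.

Lemma tsum_subX d f s : (0 < d)%N -> tsum f s -> tsum (fps_subX d f) s.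
Proof.
move=> d0 fs e e0; have [N hN] := fs _ e0; exists (N * d).+1 => -[//|n].
rewrite ltnS => hn.
have -> : \sum_(i < n.+1) fps_subX d f i = \sum_(i < (n %/ d).+1) f i.
  elim: n {hn} => [|n IH]; first by rewrite div0n !big_ord1 /fps_subX dvdn0 div0n.
  rewrite big_ord_recr IH /= /fps_subX divnS //; case: (d %| n.+1)%N; last by rewrite addr0.
  by rewrite add1n [RHS]big_ord_recr.
by apply: hN; apply: leqW; rewrite leq_divRL.
Qed.

Lemma fps_scale_subX x d f : fps_scale x (fps_subX d f) = fps_subX d (fps_scale (x ^+ d) f).
Proof.
apply/funext => n; rewrite /fps_scale /fps_subX; case: ifP => [dn|_]; last by rewrite mulr0.
by rewrite -exprM mulnC divnK.
Qed.

Lemma fps_scale_scale x t f : fps_scale x (fps_scale t f) = fps_scale (t * x) f.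
Proof. by apply/funext => n; rewrite /fps_scale exprMn mulrA [_ ^+ n * _]mulrC. Qed.

Lemma integral_tsum f x : (forall n, abs (f n) <= 1) -> abs x < 1 ->
  exists s, tsum (fps_scale x f) s.
Proof.
move=> f1 x1; apply: null_tsum => e e0.
have [N hN] := expr_small (abs_ge0 _) x1 e0; exists N => n /hN.
by apply: le_lt_trans; rewrite /fps_scale absM absX ler_piMr ?exprn_ge0 ?abs_ge0.
Qed.

(** For N large, the series g = p^N AH(xX) is so small that g^k / k! is divisible
    by p^k; then exp(g) is, up to p^(k+1), a polynomial in g, whose value at 1 is
    the value of exp at the sum 0 of g. *)
Lemma E_root_unity x s : tsum (fps_scale x AH) 0 -> tsum (fps_scale x E) s ->
  exists N, s ^+ (p ^ N) = 1.
Proof.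
move=> hA hE; have [c c0 Ac] := tsum_bounded hA.
(* N is such that p^N AH(xX) has its coefficients bounded by |p|^2 *)
have [N /(_ N (leqnn N)) hN] := ipX_small p_prime (divr_gt0 (ipX_gt0 R p_prime 2) c0).
exists N; pose g : fps K := fps_scale x (AH : fps K) *+ p ^ N.
have g0 : g 0%N = 0 by rewrite /g fpsMnE /fps_scale AH_coef0 // mulr0 mul0rn.
have gs : tsum g 0.
  by have := tsumZ (p ^ N)%:R hA; rewrite mulr0 fps_cmul_nat.
have expg : fps_exp g = fps_scale x (E : fps K) ^+ (p ^ N).
  rewrite /g fps_expMn //; last by rewrite /fps_scale AH_coef0 // mulr0.
  by rewrite fps_exp_scale.
have g1 n : abs (g n) <= ip ^+ 2.
  rewrite /g fpsMnE -(mulr_natl _ (p ^ N)) natrX absM abs_pX.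
  apply: le_trans (ler_wpM2l (ipX_ge0 _ p_prime _) (Ac n)) _.
  by rewrite -ler_pdivlMr // ltW.
have gk k n : abs ((g ^+ k) n) <= ip ^+ (2 * k).
  elim: k n => [|k IH] n; first by rewrite expr0 fps1E muln0 expr0 abs_nat_le1.
  by rewrite exprS mulnS exprD; apply: fpsM_bound; rewrite ?ipX_ge0.
have gk' k n : abs ((g ^+ k) n / k`!%:R) <= ip ^+ k.
  rewrite absM absV abs_fact // ler_pdivrMr ?ipX_gt0 // -exprD.
  apply: le_trans (gk k n) _; rewrite ipX_le // mul2n -addnn leq_add2l.
  by case: k => [|k]; [rewrite fact0 logn1|apply/ltnW/logn_fact_lt].
apply/eqP; rewrite -subr_eq0; apply/eqP/(abs_eq0_small p_prime) => k.
apply: le_trans (ipX_le R p_prime (leqnSn k)) .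
pose H : fps K := \sum_(j < k.+1) fps_cmul (j`!%:R^-1) (g ^+ j).
have Hs : tsum H 1.
  have -> : 1 = \sum_(j < k.+1) (j`!%:R^-1 * 0 ^+ j) :> K.
    rewrite big_ord_recl fact0 invr1 mulr1 big1 ?addr0 // => i _.
    by rewrite expr0n mulr0.
  by apply: tsum_sum => j; apply/tsumZ/tsumX.
have Es : tsum (fps_exp g : fps K) (s ^+ (p ^ N)) by rewrite expg; apply: tsumX.
apply: tsum_le (tsumB Es Hs) => [|n]; first exact: ipX_ge0.
rewrite fpsBE (fps_exp_coef (N := n + k)) ?leq_addr //.
have -> : H n = \sum_(j < k.+1) (g ^+ j) n / j`!%:R.
  by rewrite /H fps_sumE; apply: eq_bigr => j _; rewrite /fps_cmul mulrC.
rewrite addnC -addSn big_split_ord /= addrAC subrr add0r.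
apply: abs_sum_le => [|j _]; first exact: ipX_ge0.
by apply: le_trans (gk' _ _) _; rewrite ipX_le // leq_addr.
Qed.

Lemma abs_nat_dvd n k : abs (n%:R : K) <= ip ^+ k -> (p ^ k %| n)%N.
Proof.
case: n => [|n]; first by rewrite dvdn0.
by rewrite abs_nat // ler_iXn2l ?ip_gt0 ?ip_lt1 // pfactor_dvdn.
Qed.

Lemma padic_nat_approx z k : padic_int K z -> exists n, abs (z - n%:R) <= ip ^+ k.
Proof.
move=> /(padic_intP p_prime)/Zclos1_int/(_ _ (ipX_gt0 R p_prime k))[[n|n] /ltW hn].
  by exists n.
(* modulo p^k, this natural number is congruent to - (n + 1) *)
exists (n.+1 * (p ^ k - 1))%N; rewrite natrM natrB ?expn_gt0 ?prime_gt0 // natrX.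
rewrite NegzE mulrNz opprK -pmulrn in hn.
have -> : z - n.+1%:R * (p%:R ^+ k - 1) = (z + n.+1%:R) - n.+1%:R * p%:R ^+ k by ring.
by apply: absB_le => //; rewrite absM_le1 ?abs_nat_le1 ?abs_pX.
Qed.

Lemma expr_congr (s : K) k m n : s ^+ (p ^ k) = 1 -> abs (m%:R - n%:R : K) <= ip ^+ k ->
  s ^+ m = s ^+ n.
Proof.
wlog mn : m n / (m <= n)%N => [hw sk mn|sk].
  by case/orP: (leq_total m n) => h; [|apply/esym]; apply: hw => //; rewrite abs_subC.
rewrite abs_subC -natrB // => /abs_nat_dvd/dvdnP[q E].
by rewrite -(subnKC mn) exprD E mulnC exprM sk expr1n mulr1.
Qed.

(** Compare z with a natural number n' very close to it: the coefficients of
    exp(z AH) are polynomials in z, so those of degree less than M change little,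
    and the integrality of the coefficients controls the other terms. *)
Lemma exp_Zp_value x s z v k n : abs x < 1 -> tsum (fps_scale x E) s ->
  s ^+ (p ^ k) = 1 -> padic_int K z -> abs (z - n%:R) <= ip ^+ k ->
  (forall i, abs (fps_exp (fps_cmul z AH) i) <= 1) ->
  tsum (fps_scale x (fps_exp (fps_cmul z AH))) v -> v = s ^+ n.
Proof.
move=> x1 Es sk zZ zn c1 cv; apply/eqP; rewrite -subr_eq0; apply/eqP.
apply: (abs_eq0_small p_prime) => j.
have [M hM] := expr_small (abs_ge0 x) x1 (ipX_gt0 R p_prime j).
pose b i : R := \sum_(u < i.+1) abs (((AH : fps K) ^+ u) i / u`!%:R).
have b0 i : 0 <= b i by apply: sumr_ge0 => u _; apply: abs_ge0.
pose B := 1 + \sum_(i < M) b i.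
have B0 : 0 < B by rewrite ltr_wpDr // sumr_ge0.
have bB i : (i < M)%N -> b i <= B.
  move=> iM; rewrite /B (bigD1 (Ordinal iM)) //= addrCA lerDl addr_ge0 // sumr_ge0 //.
(* B bounds the coefficients of the polynomials in z that occur in degree < M *)
have [J hJ] := ipX_small p_prime (divr_gt0 (ipX_gt0 R p_prime j) B0).
have [n' zn'] := padic_nat_approx (maxn J k) zZ.
have nn' : s ^+ n = s ^+ n'.
  apply: (expr_congr sk); apply: abs_sub_le (_ : abs (z - _) <= _).
    by rewrite abs_subC.
  by apply: le_trans zn' _; rewrite ipX_le // leq_maxr.
have zn'' : abs (z - n'%:R) * B <= ip ^+ j.
  rewrite -ler_pdivlMr //; apply: le_trans zn' (ltW (hJ _ _)); exact: leq_maxl.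
have AH00 : (AH : fps K) 0%N = 0 by apply: AH_coef0.
have cE (w : K) i : fps_exp (fps_cmul w AH) i =
    \sum_(u < i.+1) w ^+ u * (((AH : fps K) ^+ u) i / u`!%:R).
  rewrite (fps_exp_coef (N := i)) // ?/fps_cmul ?AH00 ?mulr0 //.
  by apply: eq_bigr => u _; rewrite fps_cmulX mulrA.
have En' : fps_exp (fps_cmul n'%:R AH) = (E : fps K) ^+ n'.
  by rewrite fps_cmul_nat fps_expMn.
have Es' : tsum (fps_scale x ((E : fps K) ^+ n')) (s ^+ n').
  by rewrite fps_scaleX; apply: tsumX.
rewrite nn'; apply: tsum_le (tsumB cv Es') => [|i]; first exact: ipX_ge0.
rewrite fpsBE /fps_scale -mulrBr; case: (ltnP i M) => [iM|/hM/ltW hi].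
  rewrite absM_le1 ?absX_le1 ?(ltW x1) // -En' !cE -sumrB.
  apply: le_trans zn''; apply: le_trans (ler_wpM2l (abs_ge0 _) (bB i iM)).
  apply: abs_sum_le => [|u _]; first by rewrite mulr_ge0 ?abs_ge0.
  rewrite -mulrBl absM ler_pM ?abs_ge0 //.
    by apply: abs_exp_sub_le; rewrite ?abs_nat_le1 //; case: zZ.
  by rewrite /b (bigD1 u) //= lerDl sumr_ge0 // => *; apply: abs_ge0.
rewrite mulrC absM_le1 ?absX // absB_le //.
by apply: fpsX_le1 => u; case: (E_padic_int K p_prime u).
Qed.

(** The sum of the AH(t^(p^i) X) has in degree p^j the coefficient
    Tr(t^(p^j)) / p^j = Tr(t) / p^j. *)
Lemma E_orbit_prod (m : nat) t : (0 < m)%N -> t ^+ (p ^ m) = t ->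
  \prod_(i < m) fps_scale (t ^+ (p ^ i)) (E : fps K) =
  fps_exp (fps_cmul (teich_trace m t) AH).
Proof.
move=> m0 tm; rewrite (eq_bigr (fun i : 'I_m =>
    (fps_exp (fps_scale (t ^+ (p ^ i)) AH) : fps K))); last first.
  by move=> i _; rewrite fps_exp_scale.
rewrite -fps_exp_sum //; last by move=> i; rewrite /fps_scale AH_coef0 // mulr0.
congr (fps_exp _); apply/funext => n; rewrite fps_sumE /fps_scale /fps_cmul -mulr_suml.
rewrite AHE //; case: eqP => [En|_]; last by rewrite !mulr0.
congr (_ * _); rewrite -(teich_trace_expX (logn p n) m0 tm); apply: eq_bigr => i _.
by rewrite -!exprM {1}En mulnC.
Qed.

(** The case of a single Witt component of the trace formula. The product
    is the value at x of exp(Tr(t) AH), whose exponent Tr(t) lies in Z_p. *)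
Lemma E_teich_prod x s (m : nat) t (v : 'I_m -> K) k n : (0 < m)%N ->
  abs x < 1 -> tsum (fps_scale x E) s -> s ^+ (p ^ k) = 1 ->
  t ^+ (p ^ m) = t -> (forall i : 'I_m, tsum (fps_scale (t ^+ (p ^ i) * x) E) (v i)) ->
  abs (teich_trace m t - n%:R) <= ip ^+ k ->
  \prod_(i < m) v i = s ^+ n.
Proof.
move=> m0 x1 Es sk tm hv hn.
have t1 := le1_of_expX p_prime m0 tm.
have hprod := E_orbit_prod m0 tm.
apply: (exp_Zp_value x1 Es sk _ hn); first exact: trace_padic_int m0 tm.
  move=> i; rewrite -hprod.
  elim/big_ind: _ i => [i|f g hf hg i|j _ i].
  - exact: abs_nat_le1.
  - by rewrite -(mulr1 1); apply: fpsM_bound.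
  - by rewrite /fps_scale absM_le1 ?absX_le1 //; case: (E_padic_int K p_prime i).
rewrite -hprod.
have -> : fps_scale x (\prod_(i < m) fps_scale (t ^+ (p ^ i)) (E : fps K)) =
    \prod_(i < m) fps_scale (t ^+ (p ^ i) * x) (E : fps K).
  elim/big_rec2: _ => [|i f g _ <-]; last by rewrite fps_scaleM fps_scale_scale.
  by rewrite -[1](expr0 (1 : fps K)) fps_scaleX expr0.
exact: tsum_prod.
Qed.

End Evaluation.

(** * Roots of unity of p-power order *)

Section RootsOfUnity.
Variables (R : realType) (p : nat) (K : cpType R p).
Hypothesis p_prime : prime p.
Implicit Types (x y z s t u v w : K) (n k N : nat) (e r : R).
Notation ip := (p%:R^-1 : R).

Let p1_gt0 : (0 < p.-1)%N.
Proof. by rewrite -ltnS prednK ?prime_gt1 ?prime_gt0. Qed.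

(** The binomial coefficients other than the first and the last are divisible
    by p. *)
Lemma expp_1D v : abs v <= 1 -> exists2 c, abs c <= 1 &
  (1 + v) ^+ p - 1 = p%:R * v * (1 + v * c) + v ^+ p.
Proof.
move=> v1; have [q pE] : exists q, p = q.+2.
  by case: p (prime_gt1 p_prime) => // -[|q] // _; exists q.
have [b bE] : {b : 'I_q -> nat & forall i : 'I_q, 'C(p, i.+2) = (p * b i)%N}.
  apply: (@boolp.choice _ _ (fun (i : 'I_q) b => 'C(p, i.+2) = (p * b)%N)) => i.
  have /dvdnP[b ->] : (p %| 'C(p, i.+2))%N.
    by apply: prime_dvd_bin; rewrite //= pE !ltnS.
  by exists b; rewrite mulnC.
exists (\sum_(i < q) v ^+ i * (b i)%:R).
  apply: abs_sum_le => [|i _]; first exact: ler01.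
  by rewrite absM_le1 ?absX_le1 ?abs_nat_le1.
rewrite exprDn.
have -> : \sum_(i < p.+1) 1 ^+ (p - i) * v ^+ i *+ 'C(p, i) =
   1 + (p%:R * v + \sum_(i < q) v ^+ i.+2 * (p * b i)%:R) + v ^+ p.
  rewrite big_ord_recr /= subnn expr0 mul1r binn mulr1n; congr (_ + _).
  transitivity (\sum_(i < q.+2) 1 ^+ (p - i) * v ^+ i *+ 'C(p, i)).
    by rewrite -[in RHS]pE.
  rewrite 2!big_ord_recl /= expr1n bin0 expr0 mul1r mulr1n; congr (_ + (_ + _)).
    by rewrite /= expr1n mul1r expr1 /bump /= addn0 bin1 mulr_natl.
  apply: eq_bigr => i _; rewrite expr1n mul1r /bump /= !add1n.
  by rewrite -mulr_natr bE.
have -> : \sum_(i < q) v ^+ i.+2 * (p * b i)%:R =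
    p%:R * v * v * \sum_(i < q) v ^+ i * (b i)%:R.
  rewrite mulr_sumr; apply: eq_bigr => i _; rewrite natrM !exprS.
  by move: (v ^+ i) => a; ring.
by move: (\sum_(i < q) _) (v ^+ p) => a b'; ring.
Qed.

Lemma expp_sub1 w : abs (w - 1) <= 1 -> exists2 c, abs c <= 1 &
  w ^+ p - 1 = p%:R * (w - 1) * (1 + (w - 1) * c) + (w - 1) ^+ p.
Proof.
by move=> /expp_1D[c c1 E]; exists c; rewrite // -E [1 + _]addrC subrK.
Qed.

Lemma abs_lt1_of_exp r : 0 <= r -> r ^+ p.-1 <= ip -> r < 1.
Proof.
move=> r0 h; rewrite ltNge; apply/negP => r1.
by move: (ip_lt1 R p_prime); rewrite ltNge (le_trans _ h) // exprn_ege1.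
Qed.

Lemma abs_pM_unit v c : abs v < 1 -> abs c <= 1 ->
  abs (p%:R * v * (1 + v * c)) = ip * abs v.
Proof.
move=> v1 c1; rewrite !absM abs_p abs_dominant ?abs1 ?mulr1 //.
by rewrite mulrC; apply: le_lt_trans (absM_le1 c1 (lexx _)) v1.
Qed.

Lemma exprp_split r : r ^+ p = r ^+ p.-1 * r.
Proof. by rewrite -exprSr prednK ?prime_gt0. Qed.

(** For v = w - 1 not 0, the terms p v and v^p of w^p - 1 have the same absolute value
    exactly when |v|^(p-1) = |p|; on either side of this threshold one of them
    dominates. *)
Lemma abs_expp_near1 w : abs (w - 1) ^+ p.-1 < ip ->
  abs (w ^+ p - 1) = ip * abs (w - 1).
Proof.
move=> h; have v1 := abs_lt1_of_exp (abs_ge0 _) (ltW h).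
have [c c1 ->] := expp_sub1 (ltW v1).
have [->|w1] := eqVneq (w - 1) 0.
  by rewrite mulr0 mul0r add0r expr0n eqn0Ngt prime_gt0 // abs0 mulr0.
rewrite [LHS]abs_dominant; first exact: abs_pM_unit.
by rewrite abs_pM_unit // absX exprp_split ltr_pM2r // abs_gt0.
Qed.

Lemma abs_expp_far1 w : abs (w - 1) < 1 -> ip < abs (w - 1) ^+ p.-1 ->
  abs (w ^+ p - 1) = abs (w - 1) ^+ p.
Proof.
move=> v1 h; have [c c1 ->] := expp_sub1 (ltW v1).
rewrite [X in abs X]addrC [LHS]abs_dominant absX // abs_pM_unit // exprp_split ltr_pM2r //.
rewrite lt_neqAle abs_ge0 andbT eq_sym; apply: contraTneq h => ->.
by rewrite expr0n eqn0Ngt p1_gt0 /= ltNge ip_ge0.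
Qed.

Lemma abs_expp_le w : abs (w - 1) ^+ p.-1 <= ip ->
  abs (w ^+ p - 1) <= ip * abs (w - 1).
Proof.
move=> h; have v1 := abs_lt1_of_exp (abs_ge0 _) h.
have [c c1 ->] := expp_sub1 (ltW v1).
rewrite absD_le ?abs_pM_unit // absX exprp_split ler_wpM2r ?abs_ge0 //.
Qed.

(** Near 1, raising to the power p divides the distance to 1 by p, so the powers
    w^(p^N) do not reach 1 unless w = 1. *)
Lemma root_unity_near1 w N : w ^+ (p ^ N) = 1 -> abs (w - 1) ^+ p.-1 < ip -> w = 1.
Proof.
elim: N w => [|N IH] w; first by rewrite expr1.
rewrite expnS exprM => wN h; have hp := abs_expp_near1 h.
have /eqP : w ^+ p = 1.
  apply: IH wN _; apply: le_lt_trans h; rewrite lerXn2r ?nnegrE ?abs_ge0 //.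
  by rewrite hp ler_piMl ?abs_ge0 ?ip_le1.
rewrite -subr_eq0 -abs_neq0 hp mulf_eq0 (gt_eqF (ip_gt0 _ p_prime)) abs_neq0 subr_eq0.
by move/eqP.
Qed.

(** Under the p-th power map the distance r to 1 becomes r^p as long as it stays
    above the threshold, which is reached after exactly k steps; the next power
    is below the threshold, hence equal to 1. *)
Lemma root_unity_primitive s N k : s ^+ (p ^ N) = 1 ->
  abs (s - 1) ^+ (p ^ k * p.-1) = ip -> (p ^ k.+1).-primitive_root s.
Proof.
move=> sN sr; set r := abs (s - 1) in sr.
have r0 : 0 < r.
  rewrite /r lt_neqAle abs_ge0 andbT eq_sym; apply/eqP => r0; move: sr.
  rewrite /r r0 expr0n eqn0Ngt muln_gt0 expn_gt0 prime_gt0 // p1_gt0 /= => /esym/eqP.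
  by rewrite gt_eqF ?ip_gt0.
have r1 : r < 1.
  rewrite ltNge; apply/negP => r1; have := ip_lt1 R p_prime.
  by rewrite -sr ltNge exprn_ege1.
have far i : (i <= k)%N -> abs (s ^+ (p ^ i) - 1) = r ^+ (p ^ i).
  elim: i => [|i IH] ik; first by rewrite !expr1.
  rewrite expnSr !exprM -IH ?(ltnW ik) //; apply: abs_expp_far1.
    by rewrite IH ?(ltnW ik) // exprn_ilt1 ?ltW // -lt0n expn_gt0 prime_gt0.
  rewrite IH ?(ltnW ik) // -exprM -sr ltr_iXn2l // ltn_mul2r p1_gt0.
  by rewrite ltn_exp2l ?prime_gt1.
have rk : (r ^+ (p ^ k)) ^+ p.-1 = ip by rewrite -exprM.
have sk : s ^+ (p ^ k.+1) = 1.
  apply: (@root_unity_near1 _ N); first by rewrite -exprM mulnC exprM sN expr1n.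
  have : abs (s ^+ (p ^ k.+1) - 1) <= ip * r ^+ (p ^ k).
    by rewrite expnSr exprM -far // abs_expp_le // far // rk.
  move=> h; apply: le_lt_trans (_ : (ip * r ^+ (p ^ k)) ^+ p.-1 < _).
    by rewrite lerXn2r ?nnegrE ?abs_ge0 // mulr_ge0 ?ip_ge0 // exprn_ge0 // ltW.
  rewrite exprMn rk gtr_pMl ?ip_gt0 //.
  by rewrite exprn_ilt1 ?ip_ge0 ?ip_lt1 // -lt0n.
have pk_gt0 : (0 < p ^ k.+1)%N by rewrite expn_gt0 prime_gt0.
have [m mprim mdvd] := prim_order_exists pk_gt0 sk.
have /(dvdn_pfactor _ _ p_prime)[j jk Ej] := mdvd.
move: jk; rewrite leq_eqVlt ltnS => /orP[/eqP <-|jk]; first by rewrite -Ej.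
have := far k (leqnn k).
have -> : s ^+ (p ^ k) = 1.
  by rewrite -(subnKC jk) expnD exprM -Ej (prim_expr_order mprim) expr1n.
by rewrite subrr abs0 => /esym/eqP; rewrite gt_eqF // exprn_gt0.
Qed.

Lemma E_coef1 : (E 1%N : K) = 1.
Proof.
rewrite /E (fps_exp_coef (N := 1)) ?AH_coef0 // big_ord_recl big_ord1 expr0 fps1E.
by rewrite mul0r add0r expr1 divr1 /= -[1%N](expn0 p) AH_pX // invr1.
Qed.

Lemma tsum_delta k c : tsum (fun n => if n == k then c else 0 : K) c.
Proof.
move=> e e0; exists k.+1 => n kn.
by rewrite (bigD1 (Ordinal kn)) //= eqxx big1 ?addr0 ?subrr ?abs0 // => i /negbTE; rewrite -val_eqE /= => ->.
Qed.

(** Since E(X) = 1 + X + ... has integral coefficients, each term of degree at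
    least 2 contributes at most r |x - y|. *)
Lemma E_near_translation x y s t r : r < 1 -> abs x <= r -> abs y <= r ->
  tsum (fps_scale x E) s -> tsum (fps_scale y E) t ->
  abs (s - t - (x - y)) <= r * abs (x - y).
Proof.
move=> r1 xr yr hs ht; have r0 : 0 <= r by apply: le_trans xr; apply: abs_ge0.
apply: tsum_le (tsumB (tsumB hs ht) (tsum_delta 1 (x - y))) => [|n].
  by rewrite mulr_ge0 ?abs_ge0.
rewrite !fpsBE /fps_scale; case: n => [|[|n]] /=.
- by rewrite !expr0 !subrr abs0 mulr_ge0 ?abs_ge0.
- by rewrite !expr1 E_coef1 !mulr1 subrr abs0 mulr_ge0 ?abs_ge0.
rewrite subr0 -mulrBl subrXX -mulrA absM [leRHS]mulrC ler_wpM2l ?abs_ge0 //.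
rewrite mulrC absM_le1 //; first by case: (E_padic_int K p_prime n.+2).
apply: abs_sum_le => // i _; rewrite absM !absX.
apply: le_trans (_ : r ^+ (n.+2.-1 - i + i) <= r).
  by rewrite exprD ler_pM ?exprn_ge0 ?abs_ge0 // lerXn2r ?nnegrE ?abs_ge0.
rewrite subnK; last by have := ltn_ord i; rewrite ltnS.
by rewrite /= exprS ler_piMr // exprn_ile1 // ltW.
Qed.

Lemma E_lipschitz x y s t r : r < 1 -> abs x <= r -> abs y <= r ->
  tsum (fps_scale x E) s -> tsum (fps_scale y E) t -> abs (s - t) <= abs (x - y).
Proof.
move=> r1 xr yr hs ht; rewrite -(subrK (x - y) (s - t)) absD_le //.
apply: le_trans (E_near_translation r1 xr yr hs ht) _.
by rewrite ler_piMl ?abs_ge0 // ltW.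
Qed.

Lemma E_at0 : tsum (fps_scale 0 E) (1 : K).
Proof.
apply: tends_eq (@tsum1 R p K) => N; apply: eq_bigr => i _; rewrite fps1E /fps_scale expr0n.
by case: (i : nat) => [|j]; rewrite ?mul0r // E_coef0 // mulr1.
Qed.

(** The quotient exp(px) of E(x)^p by E(x^p) is congruent to 1 modulo px. *)
Lemma E_expp_sub_le x s t : abs x < 1 ->
  tsum (fps_scale x E) s -> tsum (fps_scale (x ^+ p) E) t ->
  abs (s ^+ p - t) <= ip * abs x.
Proof.
move=> x1 hs ht.
have e1 n : abs (fps_exp (fps_pX K) n) <= (if n == 0%N then 1 else ip).
  rewrite exp_pX_coef //; case: n => [|n]; last by rewrite abs_pX_fact.
  by rewrite fact0 divr1 abs1.
have [u hu] : exists u, tsum (fps_scale x (fps_exp (fps_pX K))) u.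
  apply: integral_tsum => // n; apply: le_trans (e1 n) _.
  by case: eqP => _; rewrite ?ip_le1.
have t1 : abs t <= 1.
  apply: tsum_le ht => [|n]; first exact: ler01.
  rewrite /fps_scale absM_le1 //; first by rewrite !absX_le1 // ltW.
  by case: (E_padic_int K p_prime n).
have su : s ^+ p = t * u.
  apply: tsum_unique (tsumX p hs) _.
  rewrite -fps_scaleX E_functional // fps_scaleM fps_scale_subX.
  by apply: tsumM => //; apply: tsum_subX => //; apply: prime_gt0.
rewrite su -{2}[t]mulr1 -mulrBr absM_le1 //.
apply: tsum_le (tsumB hu (@tsum1 R p K)) => [|n]; first by rewrite mulr_ge0 ?ip_ge0 ?abs_ge0.
rewrite fpsBE fps1E /fps_scale; case: n => [|n].
  by rewrite expr0 mul1r exp_pX_coef // fact0 divr1 expr0 subrr abs0 mulr_ge0 ?ip_ge0 ?abs_ge0.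
rewrite subr0 absM absX mulrC ler_pM ?exprn_ge0 ?abs_ge0 //.
by rewrite exprS ler_piMr ?abs_ge0 // exprn_ile1 ?abs_ge0 // ltW.
Qed.

End RootsOfUnity.

(** * The ring generated by a root of unity of p-power order *)

Section ClosedSpan.
Variables (R : realType) (p : nat) (K : cpType R p).
Hypothesis p_prime : prime p.
Notation ip := (p%:R^-1 : R).
Variables (s : K) (k : nat).
Hypothesis s_prim : (p ^ k.+1).-primitive_root s.
Hypothesis s_abs : abs (s - 1) ^+ (p ^ k * p.-1) = ip.
Implicit Types (x y z : K) (a b : nat -> K).
Notation d := (p ^ k * p.-1)%N.
Notation lam := (s - 1).

Let d_gt0 : (0 < d)%N.
Proof. by rewrite muln_gt0 expn_gt0 prime_gt0 // -ltnS prednK ?prime_gt1 ?prime_gt0. Qed.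

Let r_gt0 : 0 < abs lam.
Proof.
rewrite lt_neqAle abs_ge0 andbT eq_sym; apply/eqP => r0; move: s_abs.
rewrite r0 expr0n eqn0Ngt d_gt0 /= => /esym/eqP.
by rewrite gt_eqF ?ip_gt0.
Qed.

Let r_lt1 : abs lam < 1.
Proof.
rewrite ltNge; apply/negP => r1; have := ip_lt1 R p_prime.
by rewrite -s_abs ltNge exprn_ege1.
Qed.

Let Zp := padic_int_unramified K p_prime 1.

(** The ring Z_p[s], with coordinates in the powers of lam = s - 1. As d is the
    degree of s over Q_p and |lam|^d = |p|, these coordinates can be bounded by the
    absolute value. *)
Definition lam_sum a : K := \sum_(i < d) a i * lam ^+ i.
Definition lamspan : set K := [set x | exists2 a, forall i, padic_int K (a i) & x = lam_sum a].

Lemma lamspanD x y : lamspan x -> lamspan y -> lamspan (x + y).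
Proof.
move=> [a aZ ->] [b bZ ->]; exists (fun i => a i + b i).
  by move=> i; apply: unr_D Zp _ _ (aZ i) (bZ i).
by rewrite /lam_sum -big_split /=; apply: eq_bigr => i _; rewrite mulrDl.
Qed.

Lemma lamspanZ c x : padic_int K c -> lamspan x -> lamspan (c * x).
Proof.
move=> cZ [a aZ ->]; exists (fun i => c * a i).
  by move=> i; apply: (unr_M Zp cZ (aZ i)).
by rewrite /lam_sum mulr_sumr; apply: eq_bigr => i _; rewrite mulrA.
Qed.

Let Zp1 : padic_int K 1. Proof. exact: unr_1 Zp. Qed.
Let ZpN1 : padic_int K (-1).
Proof. by rewrite -sub0r; apply: (unr_B Zp) => //; apply: unr_0 Zp. Qed.

Lemma lamspanN x : lamspan x -> lamspan (- x).
Proof. by rewrite -mulN1r; apply: lamspanZ. Qed.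

Lemma lamspanB x y : lamspan x -> lamspan y -> lamspan (x - y).
Proof. by move=> hx /lamspanN; apply: lamspanD. Qed.

Lemma lamspan0 : lamspan 0.
Proof.
exists (fun=> 0) => [i|]; first exact: unr_0 Zp.
by rewrite /lam_sum big1 // => i _; rewrite mul0r.
Qed.

Lemma lamspan_sum (I : Type) (r : seq I) (P : pred I) (F : I -> K) :
  (forall i, P i -> lamspan (F i)) -> lamspan (\sum_(i <- r | P i) F i).
Proof. by move=> h; elim/big_rec: _ => [|i x Pi Lx]; [exact: lamspan0|apply/lamspanD/Lx/h]. Qed.

Lemma lamspan_lamX_lt i : (i < d)%N -> lamspan (lam ^+ i).
Proof.
move=> id; exists (fun j => (j == i)%:R) => [j|].
  exact: padic_int_nat.
rewrite /lam_sum (bigD1 (Ordinal id)) //= eqxx mul1r big1 ?addr0 // => j.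
by rewrite -val_eqE /= => /negbTE ->; rewrite mul0r.
Qed.

(** Expand (1 + lam)^e. *)
Lemma lamspan_binomial e : (e <= d)%N ->
  lamspan (s ^+ e - lam ^+ e) /\ ((e < d)%N -> lamspan (s ^+ e)).
Proof.
move=> ed; have h : lamspan (s ^+ e - lam ^+ e).
  have -> : s ^+ e = (1 + lam) ^+ e by rewrite addrC subrK.
  rewrite exprDn big_ord_recr /= subnn expr0 mul1r binn mulr1n addrK.
  apply: lamspan_sum => i _; rewrite expr1n mul1r -mulr_natl; apply: lamspanZ.
    exact: padic_int_nat.
  by apply: lamspan_lamX_lt; apply: leq_trans ed.
split=> // ed'; rewrite -(subrK (lam ^+ e) (s ^+ e)).
by apply: lamspanD => //; apply: lamspan_lamX_lt.
Qed.

(** The cyclotomic relation writes s^d, hence lam^d, in terms of lower powers. *)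
Lemma lamspan_lam_d : lamspan (lam ^+ d).
Proof.
have [h _] := lamspan_binomial (leqnn d).
rewrite -(subKr (s ^+ d) (lam ^+ d)); apply: lamspanB h.
have s1 : s ^+ (p ^ k) != 1.
  rewrite -(prim_order_dvd s_prim) gtnNdvd ?expn_gt0 ?prime_gt0 //.
  by rewrite ltn_exp2l ?prime_gt1.
have /eqP : (s ^+ (p ^ k)) ^+ p - 1 = 0.
  by rewrite -exprM -expnSr (prim_expr_order s_prim) subrr.
rewrite subrX1 mulf_eq0 subr_eq0 (negbTE s1) /= => /eqP.
have pE : p = p.-1.+1 by rewrite prednK ?prime_gt0.
have -> : \sum_(i < p) (s ^+ (p ^ k)) ^+ i = \sum_(i < p.-1.+1) (s ^+ (p ^ k)) ^+ i.
  by rewrite -pE.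
rewrite big_ord_recr /= -exprM => /eqP; rewrite addrC addr_eq0 => /eqP ->.
apply/lamspanN/lamspan_sum => i _; rewrite -exprM.
have id : (p ^ k * i < d)%N by rewrite ltn_mul2l expn_gt0 prime_gt0 //=.
by have [_] := lamspan_binomial (ltnW id); apply.
Qed.

Lemma lamspan_lamM x : lamspan x -> lamspan (lam * x).
Proof.
move=> [a aZ ->]; rewrite /lam_sum mulr_sumr; apply: lamspan_sum => i _.
rewrite mulrCA -exprS; apply: lamspanZ => //.
have := ltn_ord i; rewrite leq_eqVlt => /orP[/eqP ->|]; first exact: lamspan_lam_d.
exact: lamspan_lamX_lt.
Qed.

Lemma lamspanM x y : lamspan x -> lamspan y -> lamspan (x * y).
Proof.
move=> [a aZ ->] hy; rewrite mulr_suml; apply: lamspan_sum => i _.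
rewrite -mulrA; apply: lamspanZ => //.
elim: (i : nat) => [|j IH]; first by rewrite mul1r.
by rewrite exprS -mulrA; apply: lamspan_lamM.
Qed.

Lemma lamspan1 : lamspan 1.
Proof. exact: (lamspan_lamX_lt d_gt0). Qed.

Lemma lamspanX x n : lamspan x -> lamspan (x ^+ n).
Proof. by move=> hx; elim: n => [|n IH]; [exact: lamspan1|rewrite exprS; apply: lamspanM]. Qed.

Lemma lamspan_s : lamspan s.
Proof.
rewrite -(subrK 1 s); apply: lamspanD lamspan1.
have := lamspan_lamM lamspan1; by rewrite mulr1.
Qed.

(** |x| is a power of |p| = |lam|^d, so i is determined modulo d by the absolute
    value of x lam^i. *)
Lemma lam_term_inj x y (i j : 'I_d) : padic_int K x -> padic_int K y ->
  x != 0 -> abs (x * lam ^+ i) = abs (y * lam ^+ j) -> i = j.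
Proof.
move=> xZ yZ x0 E.
have y0 : y != 0.
  apply: contra x0 => /eqP y0; move/eqP: E.
  by rewrite y0 mul0r abs0 absM absX mulf_eq0 expf_eq0 (gt_eqF r_gt0) andbF orbF abs_neq0.
have one_fix : (1 : K) ^+ (p ^ 1) = 1 by apply: expr1n.
have val z : padic_int K z -> z != 0 -> exists c, abs z = abs lam ^+ (d * c).
  move=> /(padic_intP p_prime) zZ z0.
  have [c [u [_ u1 ->]]] := Zclos_norm p_prime (isT : (0 < 1)%N) one_fix zZ z0.
  by exists c; rewrite absM u1 mulr1 abs_pX exprM s_abs.
have [c1 E1] := val x xZ x0; have [c2 E2] := val y yZ y0.
move: E; rewrite !absM !absX E1 E2 -!exprD => /(ieexprIn r_gt0).
rewrite lt_eqF // => /(_ isT)/(congr1 (modn^~ d)).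
by rewrite ![(d * _)%N]mulnC !modnMDl !modn_small // => /val_inj.
Qed.

(** The nonzero terms have distinct absolute values, so the sum has the largest one. *)
Lemma lam_sum_abs a : (forall i, padic_int K (a i)) ->
  forall i : 'I_d, abs (a i) * ip <= abs (lam_sum a).
Proof.
move=> aZ i; pose w (j : 'I_d) := abs (a j * lam ^+ j).
have [j _ jmax] := @Order.TotalTheory.arg_maxP _ _ _ (Ordinal d_gt0) predT w isT.
have wi : abs (a i) * ip <= w i.
  rewrite /w absM absX ler_wpM2l ?abs_ge0 // -s_abs.
  by apply: ler_wiXn2l; rewrite ?abs_ge0 ?(ltW r_lt1) ?(ltnW (ltn_ord i)).
apply: le_trans (le_trans wi (jmax i isT)) _.
have [aj0|aj0] := eqVneq (a j) 0; first by rewrite /w aj0 mul0r abs0 abs_ge0.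
rewrite /lam_sum (bigD1 j) //= abs_dominant //.
have wj : 0 < w j by rewrite /w abs_gt0 mulf_neq0 // expf_neq0 // -abs_gt0.
elim/big_ind: _ => [|x y|u uj]; [by rewrite abs0|exact: absD_lt|].
rewrite lt_neqAle [_ <= _](jmax u isT) andbT.
apply: contra uj => /eqP E; apply/eqP/esym.
exact: (lam_term_inj (aZ j) (aZ u) aj0 (esym E)).
Qed.

Lemma padic_int_tends (u : nat -> K) x : (forall n, padic_int K (u n)) -> tends u x ->
  padic_int K x.
Proof.
move=> uZ ux; apply/(padic_intP p_prime)/Zclos_closed => e /ux[N hN].
exists (u N); first exact/(padic_intP p_prime).
by rewrite abs_subC hN.
Qed.

(** The coordinates of a convergent sequence are Cauchy sequences of Z_p. *)
Lemma lamspan_tends (u : nat -> K) x : (forall n, lamspan (u n)) -> tends u x -> lamspan x.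
Proof.
move=> uS ux.
have [a ha] : {a : nat -> nat -> K & forall n,
    (forall i, padic_int K (a n i)) /\ u n = lam_sum (a n)}.
  apply: (@boolp.choice _ _ (fun n b => (forall i, padic_int K (b i)) /\ u n = lam_sum b)) => n.
  by have [b bZ E] := uS n; exists b.
have [b hb] : {b : 'I_d -> K & forall i : 'I_d, tends (fun n => a n i) (b i)}.
  apply: (@boolp.choice _ _ (fun (i : 'I_d) c => tends (fun n => a n i) c)) => i.
  apply: cauchy_tends => e e0.
  have [N hN] := ux _ (mulr_gt0 e0 (ip_gt0 R p_prime)); exists N => n Nn.
  rewrite -(ltr_pM2r (ip_gt0 R p_prime)).
  have dZ j : padic_int K (a n.+1 j - a n j).
    by apply: (unr_B Zp); [case: (ha n.+1)|case: (ha n)].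
  apply: le_lt_trans (lam_sum_abs dZ i) _.
  have -> : lam_sum (fun j => a n.+1 j - a n j) = u n.+1 - u n.
    rewrite (ha n.+1).2 (ha n).2 /lam_sum -sumrB.
    by apply: eq_bigr => j _; rewrite mulrBl.
  by apply: (abs_sub_lt (y := x)); [apply/hN/leqW|rewrite abs_subC hN].
pose c j := if insub j is Some i then b i else 0.
have cE (i : 'I_d) : c i = b i by rewrite /c valK.
exists c => [j|].
  rewrite /c; case: insubP => [i _ _|_]; last exact: unr_0 Zp.
  by apply: padic_int_tends (hb i) => n; case: (ha n).
apply: tends_unique ux _.
have E n : \sum_(i < d) a n i * lam ^+ i = u n by rewrite (ha n).2.
apply: tends_eq E _; apply: tends_sum => i.
by rewrite cE; apply: tendsM (hb i) (tends_cst _).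
Qed.

Lemma lamspan_subfield (L : set K) x : subfield L -> (forall y, Qp K y -> L y) -> L s ->
  lamspan x -> L x.
Proof.
move=> Lf LQ Ls [a aZ ->]; apply: subfield_sum => // i _; apply: (subfieldM Lf).
  by apply: LQ; case: (aZ i).
by apply: subfieldX => //; apply: (subfieldB Lf) => //; apply: subfield1.
Qed.

End ClosedSpan.

(** * The roots of AH and the roots of unity E(pi_k) *)

Section ArtinHasseRoots.
Variables (R : realType) (p : nat) (K : cpType R p) (pi : nat -> K).
Hypotheses (p_prime : prime p) (pi_roots : compatible_roots pi).
Notation ip := (p%:R^-1 : R).
Implicit Types (k j : nat).

Lemma pi_lt1 k : abs (pi k) < 1.
Proof.
case: k => [|k]; first by rewrite (root_0 pi_roots) abs0 ltr01.
exact: root_disk pi_roots _ _.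
Qed.

Lemma pi_abs k : abs (pi k.+1) ^+ (p ^ k * p.-1) = ip.
Proof.
have p1 : 1 < p%:R :> R by rewrite ltr1n prime_gt1.
have p0 : 0 < p%:R :> R by apply: lt_trans p1.
have lp : 0 < ln (p%:R : R) by rewrite ln_gt0.
have := root_vp pi_roots (isT : (1 <= k.+1)%N); rewrite /vp /=.
have -> : (p ^ k.+1 - p ^ k = p ^ k * p.-1)%N.
  by rewrite expnSr -{2}[(p ^ k)%N]muln1 -mulnBr subn1.
set n := (p ^ k * p.-1)%N; case: eqVneq => // x0 [h].
have n0 : (n%:R : R) != 0.
  by rewrite pnatr_eq0 -lt0n muln_gt0 expn_gt0 prime_gt0 //= -ltnS prednK ?prime_gt1 ?prime_gt0.
have a0 : 0 < abs (pi k.+1) by rewrite abs_gt0.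
apply: ln_inj; rewrite ?posrE ?exprn_gt0 ?invr_gt0 //.
rewrite lnXn // lnV ?posrE //.
move/eqP: h; rewrite eqr_oppLR => /eqP h.
have -> : ln (abs (pi k.+1)) = - n%:R^-1 * ln p%:R by rewrite -h divfK // gt_eqF.
by rewrite mulNr mulNrn -(mulr_natr (n%:R^-1 * _)) mulrAC mulVf // mul1r.
Qed.

Lemma pi_neq0 k : pi k.+1 != 0.
Proof.
rewrite -abs_neq0; apply/eqP => h; have := pi_abs k.
rewrite h expr0n; case: eqP => _ /=; last by move=> /esym/eqP; rewrite gt_eqF ?ip_gt0.
by move=> /eqP; rewrite gt_eqF // ip_lt1.
Qed.

Variable zeta : nat -> K.
Hypothesis zetaE : forall k, tsum (fps_scale (pi k) E) (zeta k).

Lemma zeta0 : zeta 0 = 1.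
Proof.
by apply: tsum_unique (zetaE 0) _; rewrite (root_0 pi_roots); apply: E_at0.
Qed.

(** E(pi_k) = 1 + pi_k up to terms of order 2. *)
Lemma zeta_abs k : abs (zeta k - 1) = abs (pi k).
Proof.
case: k => [|k]; first by rewrite zeta0 subrr (root_0 pi_roots) abs0.
have := E_near_translation p_prime (pi_lt1 k.+1) (lexx _) _ (zetaE k.+1) (E_at0 K p_prime).
rewrite abs0 subr0 => /(_ (abs_ge0 _)) h.
rewrite -(subrK (pi k.+1) (zeta k.+1 - 1)) addrC abs_dominant //.
by apply: le_lt_trans h _; rewrite gtr_pMl ?pi_lt1 // abs_gt0 pi_neq0.
Qed.

Lemma zeta_root_unity k : exists N, zeta k ^+ (p ^ N) = 1.
Proof.
case: k => [|k]; first by exists 0%N; rewrite zeta0 expr1n.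
apply: E_root_unity (zetaE k.+1) => //; apply/fps_sumsP.
exact: root_AH pi_roots _ _.
Qed.

Lemma zeta_prim k : (p ^ k).-primitive_root (zeta k).
Proof.
case: k => [|k].
  rewrite zeta0 expn0 /primitive_root_of_unity /=; apply/forallP => i.
  by rewrite ord1 unity_rootE expr1 !eqxx.
have [N hN] := zeta_root_unity k.+1.
by apply: (root_unity_primitive p_prime hN); rewrite zeta_abs pi_abs.
Qed.

(** Both sides are congruent to E(pi_(k+1)^p) modulo p pi_(k+1), and distinct roots
    of unity of p-power order are never that close. *)
Lemma zeta_compat k : zeta k.+1 ^+ p = zeta k.
Proof.
have z0 : zeta k != 0.
  rewrite -abs_gt0; have := prim_expr_order (zeta_prim k) => h.
  rewrite lt_neqAle abs_ge0 andbT eq_sym abs_neq0; apply: contra_eq_neq h => ->.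
  by rewrite expr0n eqn0Ngt expn_gt0 prime_gt0 // eq_sym oner_eq0.
have z1 : abs (zeta k) = 1.
  apply/eqP; rewrite -(@pexpr_eq1 _ _ (p ^ k)) ?abs_ge0 ?expn_gt0 ?prime_gt0 //.
  by rewrite -absX (prim_expr_order (zeta_prim k)) abs1.
have xp1 : abs (pi k.+1 ^+ p) < 1.
  by rewrite absX exprn_ilt1 ?abs_ge0 ?pi_lt1 // -lt0n prime_gt0.
have [t ht] : exists t, tsum (fps_scale (pi k.+1 ^+ p) E) t.
  by apply: integral_tsum => // n; case: (E_padic_int K p_prime n).
have h1 := E_expp_sub_le p_prime (pi_lt1 k.+1) (zetaE k.+1) ht.
have h2 : abs (t - zeta k) <= ip * abs (pi k.+1).
  have r1 : Num.max (abs (pi k.+1 ^+ p)) (abs (pi k)) < 1 by rewrite gt_max xp1 pi_lt1.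
  apply: le_trans (E_lipschitz p_prime r1 _ _ ht (zetaE k)) _.
  - by rewrite le_max lexx.
  - by rewrite le_max lexx orbT.
  have /(congvP p_prime) := root_compat pi_roots (isT : (1 <= k.+1)%N).
  by rewrite absM abs_p abs_subC.
have h := abs_sub_le h1 h2.
suff /(congr1 (fun w => w * zeta k)) : zeta k.+1 ^+ p / zeta k = 1.
  by rewrite divfK // mul1r.
have [N hN] := zeta_root_unity k.+1.
apply: (@root_unity_near1 _ _ _ p_prime _ (N + k)).
  rewrite expr_div_n -exprM mulnC exprM expnD exprM hN !expr1n.
  by rewrite mulnC exprM (prim_expr_order (zeta_prim k)) expr1n divr1.
have -> : zeta k.+1 ^+ p / zeta k - 1 = (zeta k.+1 ^+ p - zeta k) / zeta k.
  by rewrite mulrBl divff.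
rewrite absM absV z1 invr1 mulr1.
have p1 : (0 < p.-1)%N by rewrite -ltnS prednK ?prime_gt1 ?prime_gt0.
apply: le_lt_trans (_ : (ip * abs (pi k.+1)) ^+ p.-1 < _).
  by rewrite lerXn2r ?nnegrE ?mulr_ge0 ?abs_ge0 ?ip_ge0.
rewrite exprMn -[ltRHS]mulr1.
apply: le_lt_trans (_ : ip * abs (pi k.+1) ^+ p.-1 < _).
  rewrite ler_wpM2r ?exprn_ge0 ?abs_ge0 // -[leRHS]expr1; exact: ipX_le.
by rewrite ltr_pM2l ?ip_gt0 // exprn_ilt1 ?abs_ge0 ?pi_lt1 // -lt0n.
Qed.

Lemma zeta_expX k j : zeta (k + j) ^+ (p ^ j) = zeta k.
Proof.
elim: j => [|j IH]; first by rewrite addn0 expr1.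
by rewrite addnS expnS exprM zeta_compat.
Qed.

(** pi_k is the limit of the sequence u_(n+1) = u_n - E(u_n) + zeta_k, where E may
    be truncated at the order of the error, so that the u_n are polynomials in
    zeta_k. By [E_near_translation] each step multiplies the distance to pi_k by at
    most |pi_k|. *)
Lemma pi_span k : lamspan (zeta k.+1) k (pi k.+1).
Proof.
set z := zeta k.+1; set x := pi k.+1; set r := abs x.
have r1 : r < 1 by apply: pi_lt1.
have r0 : 0 <= r by apply: abs_ge0.
have zprim : (p ^ k.+1).-primitive_root z by apply: zeta_prim.
have zabs : abs (z - 1) ^+ (p ^ k * p.-1) = ip by rewrite zeta_abs pi_abs.
pose P N (y : K) := \sum_(i < N) E i * y ^+ i.
have Pspan N y : lamspan z k y -> lamspan z k (P N y).
  move=> hy; apply: lamspan_sum => // i _; apply: lamspanZ => //; first exact: E_padic_int.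
  exact: lamspanX.
pose u := fix u n := if n is n'.+1 then u n' - P n (u n') + z else 0.
have uspan n : lamspan z k (u n).
  elim: n => [|n IH] /=; first exact: lamspan0.
  apply: lamspanD => //; last exact: lamspan_s.
  by apply: lamspanB => //; apply: Pspan.
have E_1 n : abs (E n : K) <= 1 by case: (E_padic_int K p_prime n).
have ur n : abs (u n) <= r /\ abs (u n - x) <= r ^+ n.
  elim: n => [|n [IH1 IH2]].
    by rewrite /= abs0 r0 sub0r absN; split=> //; apply: ltW.
  have [t ht] : exists t, tsum (fps_scale (u n) E) t.
    by apply: integral_tsum => //; apply: le_lt_trans IH1 r1.
  have tail : abs (t - P n.+1 (u n)) <= r ^+ n.+1.
    apply: (@tends_abs_le _ _ _ (fun N => \sum_(i < N) fps_scale (u n) E i - P n.+1 (u n))).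
      exists n.+1 => N nN; rewrite -(subnKC nN) big_split_ord /= addrAC.
      rewrite [X in X - _](_ : _ = P n.+1 (u n)).
        rewrite subrr add0r; apply: abs_sum_le => [|i _]; first exact: exprn_ge0.
        rewrite /fps_scale mulrC absM_le1 // absX.
        apply: le_trans (_ : r ^+ (n.+1 + i) <= _).
          by rewrite lerXn2r ?nnegrE ?abs_ge0.
        by apply: ler_wiXn2l; rewrite ?leq_addr // ltW.
      by apply: eq_bigr => i _; rewrite mulrC.
    by apply: tendsB; [exact: ht|exact: tends_cst].
  have h : abs (u n.+1 - x) <= r ^+ n.+1.
    have -> : u n.+1 - x = (t - P n.+1 (u n)) - (t - z - (u n - x)).
      by rewrite [u n.+1]/=; move: (P _ _) => q; ring.
    apply: absB_le => //; apply: le_trans (E_near_translation p_prime r1 IH1 (lexx _) ht (zetaE k.+1)) _.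
    by rewrite exprS ler_wpM2l.
  split=> //; rewrite -(subrK x (u n.+1)) absD_le //.
  by apply: le_trans h _; rewrite exprS ler_piMr // exprn_ile1 // ltW.
apply: (lamspan_tends p_prime zabs uspan) => e e0.
have [N hN] := expr_small r0 r1 e0; exists N => n /hN.
by apply: le_lt_trans; case: (ur n).
Qed.

Lemma Omega_subfield l : subfield (Omega K l).
Proof. exact: adjoin_subfield. Qed.

Lemma zeta_Omega l k : (k <= l)%N -> Omega K l (zeta k).
Proof.
move=> kl; rewrite -(zeta_expX k (l - k)) subnKC //.
apply: (subfieldX (Omega_subfield l)).
by apply: adjoin_sub; apply: zeta_prim.
Qed.

Lemma pi_Omega l k : (k <= l)%N -> Omega K l (pi k).
Proof.
case: k => [|k] kl; first by rewrite (root_0 pi_roots); apply: (subfield0 (Omega_subfield l)).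
apply: (lamspan_subfield (Omega_subfield l)) (pi_span k) => [y|].
  exact: adjoin_Qp_sub.
exact: zeta_Omega.
Qed.

Lemma theta_Omega l k n : (k <= l)%N -> Omega K l (theta pi k n).
Proof.
move=> kl; apply: (subfieldM (Omega_subfield l)).
  by apply: adjoin_Qp_sub; case: (E_padic_int K p_prime n).
by apply: (subfieldX (Omega_subfield l)); apply: pi_Omega.
Qed.

End ArtinHasseRoots.

(** * Products of series in several variables *)

Section SeveralVariablesSums.
Variables (R : realType) (p : nat) (K : cpType R p) (l : nat).
Hypothesis p_prime : prime p.
Implicit Types (e : R).

Lemma tends_prod (I : Type) (r : seq I) (F : I -> nat -> K) (S : I -> K) :
  (forall i, tends (F i) (S i)) ->
  tends (fun n => \prod_(i <- r) F i n) (\prod_(i <- r) S i).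
Proof.
move=> h; elim: r => [|i r IH].
  by rewrite big_nil; apply: tends_eq (tends_cst 1) => n; rewrite big_nil.
rewrite big_cons; apply: tends_eq (tendsM (h i) IH) => n.
by rewrite big_cons.
Qed.

(** Outside of the box of side N one of the factors is small; over the box the sum
    is the product of the partial sums. *)
Lemma partial_sum_prod (u : 'I_l -> fps K) (t : 'I_l -> K) :
  (forall j n, abs (u j n) <= 1) -> (forall j, tsum (u j) (t j)) ->
  partial_sum (fun a : {ffun 'I_l -> nat} => \prod_(j < l) u j (a j)) @ totally -->
  \prod_(j < l) t j.
Proof.
have FF : Filter (@totally {ffun 'I_l -> nat}) by exact: totally_filter.
move=> u1 ut; apply/cvg_absP => e e0.
have [N1 h1] := tends_prod (index_enum 'I_l) ut e0.
have [N2 h2] : {N : 'I_l -> nat & forall j n, (N j <= n)%N -> abs (u j n) < e}.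
  apply: (@boolp.choice _ _ (fun j N => forall n, (N <= n)%N -> abs (u j n) < e)) => j.
  exact: tsum_null (ut j) _ e0.
pose N := maxn N1 (\max_j N2 j).
(* inc identifies the box of side N with a finite type of functions *)
pose inc (f : {ffun 'I_l -> 'I_N}) : {ffun 'I_l -> nat} := [ffun j => f j : nat].
have inc_inj : injective inc.
  by move=> f g /ffunP fg; apply/ffunP => j; apply/val_inj; have := fg j; rewrite !ffunE.
pose box := [seq inc f | f : {ffun 'I_l -> 'I_N}].
exists (seq_fset tt box) => // B subfieldB.
have boxB a : a \in box -> a \in B.
  by move=> abox; apply: (fsubsetP (subfieldB : (seq_fset tt box `<=` B)%fset)); rewrite seq_fsetE.
rewrite /=.
pose F (a : {ffun 'I_l -> nat}) := \prod_(j < l) u j (a j).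
have -> : partial_sum F B = \sum_(a <- B) F a by rewrite (big_seq_fsetE _ B predT F).
rewrite (bigID (fun a : {ffun 'I_l -> nat} => [forall j, (a j < N)%N])) /=.
rewrite -big_filter (perm_big box); last first.
  apply: uniq_perm.
  - by rewrite filter_uniq // fset_uniq.
  - by rewrite map_inj_uniq ?enum_uniq.
  move=> a; rewrite mem_filter; apply/andP/idP => [[/forallP aN _]|].
    apply/mapP; exists [ffun j => Ordinal (aN j)]; first by rewrite mem_enum.
    by apply/ffunP => j; rewrite !ffunE.
  move=> abox; split; last exact: boxB.
  by have /mapP[f _ ->] := abox; apply/forallP => j; rewrite ffunE.
rewrite big_map big_enum /= addrAC.
have -> : \sum_(f : {ffun 'I_l -> 'I_N}) \prod_(j < l) u j (inc f j) =
    \prod_(j < l) \sum_(n < N) u j n.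
  by rewrite bigA_distr_bigA; apply: eq_bigr => f _; apply: eq_bigr => j _; rewrite ffunE.
apply: absD_lt; first by apply: h1; apply: leq_maxl.
elim/big_ind: _ => [|x y|a /forallPn[j]]; [by rewrite abs0|exact: absD_lt|].
rewrite -leqNgt => Nj; rewrite /F (bigD1 j) //= mulrC.
apply: le_lt_trans (h2 j (a j) _); last first.
  apply: leq_trans Nj; apply: leq_trans (leq_maxr _ _).
  exact: (leq_bigmax (F := N2)).
rewrite absM_le1 // abs_prod; apply: prodr_ile1 => i _.
by rewrite abs_ge0 u1.
Qed.

Lemma mfps_evalE (c : mfps K l) (x : 'I_l -> K) s : mfps_sums c x s -> mfps_eval c x = s.
Proof.
move=> cs; have := xgetPex 0 (ex_intro (fun s => mfps_sums c x s) s cs) => h.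
exact: (cvg_abs_unique totally_filter h cs).
Qed.

End SeveralVariablesSums.

(** * The splitting function *)

Section SplittingFunction.
Variables (R : realType) (p : nat) (K : cpType R p) (l : nat) (pi : nat -> K).
Hypotheses (p_prime : prime p) (pi_roots : compatible_roots pi).
Notation ip := (p%:R^-1 : R).
Implicit Types (x : 'I_l -> K).

Lemma scale_theta k (y : K) : fps_scale y (theta pi k) = fps_scale (pi k * y) E.
Proof. by apply/funext => n; rewrite /fps_scale /theta exprMn; ring. Qed.

Lemma Theta_sums x (t : 'I_l -> K) : (forall j : 'I_l, abs (pi (l - j) * x j) < 1) ->
  (forall j : 'I_l, tsum (fps_scale (pi (l - j) * x j) E) (t j)) ->
  mfps_sums (Theta pi) x (\prod_(j < l) t j).
Proof.
move=> x1 ht; pose u (j : 'I_l) := fps_scale (pi (l - j) * x j) (E : fps K).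
rewrite /mfps_sums.
have -> : (fun a => Theta pi a * \prod_(j < l) x j ^+ a j) =
    (fun a : {ffun 'I_l -> nat} => \prod_(j < l) u j (a j)); last first.
  apply: partial_sum_prod ht => // j n; rewrite /u /fps_scale absM_le1 //.
    by rewrite absX_le1 // ltW.
  by case: (E_padic_int K p_prime n).
apply/funext => a.
rewrite /Theta -big_split /=; apply: eq_bigr => j _.
by rewrite /u -scale_theta /fps_scale mulrC.
Qed.

Lemma Theta_radius_exp (j : 'I_l) :
  Theta_radius (R := R) (p := p) j ^+ (p ^ (l - j - 1) * (p - 1)) = p%:R.
Proof.
have n0 : ((p ^ (l - j - 1) * (p - 1))%:R : R) != 0.
  by rewrite pnatr_eq0 -lt0n muln_gt0 expn_gt0 subn_gt0 prime_gt0 ?prime_gt1.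
by rewrite -powR_mulrn ?powR_ge0 // -powRrM mulVf // powRr1.
Qed.

Lemma Theta_radius_gt1 (j : 'I_l) : 1 < Theta_radius (R := R) (p := p) j.
Proof.
rewrite ltNge; apply/negP => h; have := Theta_radius_exp j.
have : Theta_radius (R := R) (p := p) j ^+ (p ^ (l - j - 1) * (p - 1)) <= 1.
  by rewrite exprn_ile1 ?powR_ge0.
by move=> /[swap] ->; rewrite leNgt ltr1n prime_gt1.
Qed.

Lemma polydisk_lt1 x (j : 'I_l) : polydisk (Theta_radius (p := p)) x ->
  abs (pi (l - j) * x j) < 1.
Proof.
move=> /(_ j) xr; rewrite ltNge; apply/negP => h.
have jl : (l - j = (l - j - 1).+1)%N by rewrite subn1 prednK // subn_gt0.
have n0 : (0 < p ^ (l - j - 1) * (p - 1))%N.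
  by rewrite muln_gt0 expn_gt0 subn_gt0 prime_gt0 ?prime_gt1.
have := exprn_ege1 (p ^ (l - j - 1) * (p - 1)) h; rewrite leNgt => /negP; apply.
rewrite absM exprMn; have := pi_abs p_prime pi_roots (l - j - 1).
rewrite -jl -subn1 => ->; rewrite mulrC ltr_pdivrMr ?ltr0n ?prime_gt0 // mul1r.
rewrite -(Theta_radius_exp j) ltrXn2r -?lt0n // ?nnegrE ?abs_ge0 ?powR_ge0 //.
Qed.

Lemma pi_lt1_of_le1 x (j : 'I_l) : abs (x j) <= 1 -> abs (pi (l - j) * x j) < 1.
Proof.
move=> xj; rewrite mulrC; apply: le_lt_trans (absM_le1 xj (lexx _)) _.
exact: pi_lt1.
Qed.

Lemma E_value (y : K) : abs y < 1 -> exists s, tsum (fps_scale y E) s.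
Proof. by apply: integral_tsum => // n; case: (E_padic_int K p_prime n). Qed.

Variable zeta : nat -> K.
Hypothesis zetaE : forall k, tsum (fps_scale (pi k) E) (zeta k).

(** The product over the orbit is, component by component, zeta_(l-j)^Tr(a_j), and
    zeta_(l-j) = zeta_l^(p^j): the exponent of zeta_l is the trace of the element
    whose Witt components are represented by the a_j. *)
Lemma Theta_orbit_prod (m : nat) (a : 'I_l -> K) (n : nat) : (0 < m)%N ->
  (forall j, a j ^+ (p ^ m) = a j) ->
  abs (\sum_(j < l) p%:R ^+ j * teich_trace m (a j) - n%:R) <= ip ^+ l ->
  \prod_(i < m) mfps_eval (Theta pi) (fun j => a j ^+ (p ^ i)) = zeta l ^+ n.
Proof.
move=> m0 am hn.
have aX1 j k : abs (a j ^+ k) <= 1 by rewrite absX_le1 ?(le1_of_expX p_prime m0 (am j)).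
have [t ht] : {t : 'I_m -> 'I_l -> K & forall (i : 'I_m) (j : 'I_l),
    tsum (fps_scale (pi (l - j) * a j ^+ (p ^ i)) E) (t i j)}.
  apply: (@boolp.choice _ _ (fun (i : 'I_m) t => forall j : 'I_l,
    tsum (fps_scale (pi (l - j) * a j ^+ (p ^ i)) E) (t j))) => i.
  suff [t ht] : {t : 'I_l -> K & forall j : 'I_l,
    tsum (fps_scale (pi (l - j) * a j ^+ (p ^ i)) E) (t j)} by exists t.
  apply: (@boolp.choice _ _ (fun (j : 'I_l) t =>
    tsum (fps_scale (pi (l - j) * a j ^+ (p ^ i)) E) t)) => j.
  by apply: E_value; apply: (pi_lt1_of_le1 (x := fun j => a j ^+ (p ^ i))).
have [b hb] : {b : 'I_l -> nat & forall j, abs (teich_trace m (a j) - (b j)%:R) <= ip ^+ l}.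
  apply: (@boolp.choice _ _ (fun j b => abs (teich_trace m (a j) - b%:R) <= ip ^+ l)) => j.
  by apply: padic_nat_approx => //; apply: trace_padic_int.
transitivity (\prod_(i < m) \prod_(j < l) t i j).
  apply: eq_bigr => i _; apply: mfps_evalE; apply: Theta_sums => // j.
  by apply: (pi_lt1_of_le1 (x := fun j => a j ^+ (p ^ i))).
rewrite exchange_big /=; transitivity (\prod_(j < l) zeta l ^+ (p ^ j * b j)).
  apply: eq_bigr => j _; have jl := ltnW (ltn_ord j).
  rewrite exprM -{1}(subnK jl) (zeta_expX p_prime pi_roots zetaE).
  apply: (E_teich_prod p_prime m0 _ (zetaE (l - j)) (k := l - j) _ (am j)).
  - exact: pi_lt1.
  - exact: prim_expr_order (zeta_prim p_prime pi_roots zetaE _).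
  - by move=> i; rewrite mulrC.
  - by apply: le_trans (hb j) _; rewrite ipX_le // leq_subr.
rewrite -expr_sum.
apply: (expr_congr p_prime (prim_expr_order (zeta_prim p_prime pi_roots zetaE _))).
apply: abs_sub_le hn; rewrite natr_sum -sumrB; apply: abs_sum_le => [|j _].
  exact: ipX_ge0.
by rewrite natrM natrX -mulrBr absM_le1 ?absX_le1 ?abs_nat_le1 // abs_subC.
Qed.

Section Character.
Variable phiR : K -> 'I_l -> K.
Hypothesis phiR_iso : canonical_iso (padic_int K) phiR.
Notation psi := (fun x : K => mfps_eval (Theta pi) (hat 1 (padic_int K) phiR x)).

(** The case m = 1, where the trace is the identity. *)
Lemma psi_value (x : K) (n : nat) : padic_int K x -> abs (x - n%:R) <= ip ^+ l ->
  psi x = zeta l ^+ n.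
Proof.
move=> xZ xn; have unr := padic_int_unramified K p_prime 1.
have h j := hat_spec p_prime unr phiR_iso xZ j.
have am j : hat 1 (padic_int K) phiR x j ^+ (p ^ 1) = hat 1 (padic_int K) phiR x j.
  by case: (h j).
have <- : \prod_(i < 1) mfps_eval (Theta pi)
   (fun j => hat 1 (padic_int K) phiR x j ^+ (p ^ i)) = psi x.
  by rewrite big_ord1; congr mfps_eval; apply/funext => j; rewrite expr1.
apply: Theta_orbit_prod am _ => //.
apply: abs_sub_le xn; rewrite abs_subC.
have -> : \sum_(j < l) p%:R ^+ j * teich_trace 1 (hat 1 (padic_int K) phiR x j) =
    teich_sum 1 (hat 1 (padic_int K) phiR x).
  apply: eq_bigr => j _; rewrite /teich_trace big_ord1 /teich_root muln0 //.
by apply: (teich_sum_congr p_prime _ unr phiR_iso) => // j; case: (h j).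
Qed.

Lemma psi_character : additive_character (l := l) psi.
Proof.
split.
- move=> x y xZ yZ /(congv_pX p_prime) xy.
  have [n hn] := padic_nat_approx p_prime l xZ.
  rewrite (psi_value xZ hn) (psi_value yZ (n := n)) //.
  by apply: abs_sub_le hn; rewrite abs_subC.
- rewrite (psi_value (n := 0)) ?expr0 ?subrr ?abs0 ?ipX_ge0 //.
  exact: (padic_int_nat K p_prime 0).
- move=> x y xZ yZ.
  have [n hn] := padic_nat_approx p_prime l xZ; have [k hk] := padic_nat_approx p_prime l yZ.
  rewrite (psi_value xZ hn) (psi_value yZ hk) -exprD.
  apply: psi_value; first exact: unr_D (padic_int_unramified K p_prime 1) _ _ xZ yZ.
  by rewrite natrD opprD addrACA absD_le.
Qed.

Lemma psi_order : has_order psi (p ^ l).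
Proof.
have zprim := zeta_prim p_prime pi_roots zetaE l.
move=> n; split=> [h|/dvdnP[q ->] x xZ].
  have one : padic_int K 1 by apply: (padic_int_nat K p_prime 1).
  have := h _ one; rewrite (psi_value one (n := 1)) ?subrr ?abs0 ?ipX_ge0 // expr1.
  by move/eqP; rewrite -(prim_order_dvd zprim).
have [k hk] := padic_nat_approx p_prime l xZ.
by rewrite (psi_value xZ hk) -exprM mulnA mulnC exprM (prim_expr_order zprim) expr1n.
Qed.

Lemma psi_Omega (x : K) : padic_int K x -> Omega K l (psi x).
Proof.
move=> xZ; have [k hk] := padic_nat_approx p_prime l xZ.
rewrite (psi_value xZ hk); apply: (subfieldX (Omega_subfield K l)).
exact: (zeta_Omega p_prime pi_roots zetaE).
Qed.

Lemma psi_trace m (O : set K) (phi : K -> 'I_l -> K) (x : K) : (0 < m)%N ->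
  unramified_ring m O -> canonical_iso O phi -> O x ->
  psi (trace m O phi x) =
  \prod_(i < m) mfps_eval (Theta pi) (fun j => hat m O phi x j ^+ (p ^ i)).
Proof.
move=> m0 unr iso xO; have [yZ hy] := trace_spec p_prime m0 unr iso xO.
have [n hn] := padic_nat_approx p_prime l yZ.
rewrite (psi_value yZ hn); apply/esym; apply: Theta_orbit_prod => // [j|].
  by case: (hat_spec p_prime unr iso xO j).
by apply: abs_sub_le hn; rewrite abs_subC.
Qed.

End Character.
End SplittingFunction.

Theorem theorem1p10 (R : realType) (p : nat) (Cp : cpType R p) (l : nat)
    (pi : nat -> Cp)
    (phiR : Cp -> 'I_l -> Cp) (phi : nat -> Cp -> 'I_l -> Cp)
    (p_prime : prime p) (l_ge1 : (1 <= l)%N)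
    (pi_roots : compatible_roots pi)
    (phiR_iso : canonical_iso (padic_int Cp) phiR)
    (phi_iso : forall m, (1 <= m)%N -> canonical_iso (Ou Cp m) (phi m)) :
  (forall x : 'I_l -> Cp, polydisk (Theta_radius (p := p)) x ->
     exists2 t : 'I_l -> Cp,
       forall j : 'I_l, fps_sums (theta pi (l - j)) (x j) (t j) &
       mfps_sums (Theta pi) x (\prod_(j < l) t j)) /\
  splitting_function phiR phi (Theta pi).
Proof.
have sums (x : 'I_l -> Cp) : polydisk (Theta_radius (p := p)) x ->
     exists2 t : 'I_l -> Cp,
       forall j : 'I_l, fps_sums (theta pi (l - j)) (x j) (t j) &
       mfps_sums (Theta pi) x (\prod_(j < l) t j).
  move=> xr; have x1 j := polydisk_lt1 p_prime pi_roots j xr.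
  have [t ht] : {t : 'I_l -> Cp & forall j : 'I_l, tsum (fps_scale (pi (l - j)%N * x j) E) (t j)}.
    apply: (@boolp.choice _ _ (fun (j : 'I_l) t => tsum (fps_scale (pi (l - j)%N * x j) E) t)) => j.
    exact: E_value.
  exists t; last exact: Theta_sums.
  by move=> j; apply/fps_sumsP; rewrite scale_theta.
have [zeta zetaE] : {zeta : nat -> Cp & forall k, tsum (fps_scale (pi k) E) (zeta k)}.
  apply: (@boolp.choice _ _ (fun k z => tsum (fps_scale (pi k) E) z)) => k.
  by apply: E_value => //; apply: pi_lt1.
split=> //; split.
- move=> a; apply: (subfield_prod (Omega_subfield Cp l)) => j _.
  by apply: (theta_Omega p_prime pi_roots zetaE); apply: leq_subr.
- exists (Theta_radius (p := p)) => [j|x /sums[t _ ht]]; first exact: Theta_radius_gt1.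
  by exists (\prod_(j < l) t j).
- split; [exact: psi_character zetaE _ _|exact: psi_order zetaE _ _|].
  exact: psi_Omega zetaE _ _.
- move=> m m0 x xO; apply: (psi_trace p_prime pi_roots zetaE) => //.
    exact: Ou_unramified.
  exact: phi_iso.
Qed.
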